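(* Let $\mathfrak{o}$ be a compact discrete valuation ring (of arbitrary characteristic) with uniformiser $\pi$ and finite residue field $\mathbf{k}$, let $\ell\in\mathbb{N}$, and let $\mathcal{C}\subset\mathfrak{gl}_3(\mathfrak{o}_\ell)$ be a similarity class. Then $\mathcal{C}$ contains exactly one of the following matrices. (i) $d\,\mathrm{Id}_3$, where $d\in\mathfrak{o}_\ell$; the shadow of $\mathcal{C}$ has type $\mathcal{G}$. (ii) $d\,\mathrm{Id}_3+\pi^iD(a,0,0)$, where $0\le i<\ell$, $d\in\mathfrak{o}_\ell$ and $a\in\mathfrak{o}_{\ell-i}^\times$; the shadow of $\mathcal{C}$ has type $\mathcal{L}$. (iii) $d\,\mathrm{Id}_3+\pi^iD(a,0,0)+\pi^j\begin{bmatrix}0&0\\ 0&C\end{bmatrix}$, where $0\le i<j<\ell$, $d\in\varsigma(\mathfrak{o}_j)$, $a\in\mathfrak{o}_{\ell-i}^\times$ and $C\in\mathfrak{gl}_2(\mathfrak{o}_{\ell-j})$ is a companion matrix; the shadow of $\mathcal{C}$ has type $\mathcal{T}_1$, $\mathcal{T}_2$ or $\mathcal{M}$, depending on $C$. (iv) $d\,\mathrm{Id}_3+\pi^iC$, where $0\le i<\ell$, $d\in\varsigma(\mathfrak{o}_i)$ and $C\in\mathfrak{gl}_3(\mathfrak{o}_{\ell-i})$ is a companion matrix; the shadow of $\mathcal{C}$ has type $\mathcal{T}_1$, $\mathcal{T}_2$, $\mathcal{T}_3$, $\mathcal{M}$ or $\mathcal{N}$, depending on $C$. (v) $d'\,\mathrm{Id}_3+\pi^iE$,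 where $0\le i<\ell$, $d'\in\varsigma(\mathfrak{o}_i)$ and $E\in\mathfrak{gl}_3(\mathfrak{o}_{\ell-i})$ is one of the following matrices: - (I) $E(\ell-i,0,0,c,d)$, where $c,d\in\mathfrak{o}_{\ell-i}$ with $v(c)>0$; - (II) $E(\mu,a,b,c,d)$, where $1\le\mu<\ell-i$, $a,b\in\mathfrak{o}_{\ell-i}$ with $\mu=v(b)\le v(a)$, $c\in\mathfrak{o}_{\ell-i}$ with $v(c)>0$ and $d\in\varsigma(\mathfrak{o}_\mu)$; - (III$_1$) $E(\mu,a,b,c,d)$, where $1\le\mu<\ell-i$, $a,b\in\mathfrak{o}_{\ell-i}$ with $\mu=v(a)<v(b)$, $c\in\mathfrak{o}_{\ell-i}$ with $v(c)>0$ and $d\in\varsigma(\mathfrak{o}_\mu)$; - (III$_0$) $E(\mu,a,b,c,d)$, where $1\le\mu<\ell-i$, $a,b\in\mathfrak{o}_{\ell-i}$ with $\mu<v(a)$ and $\mu<v(b)$, $c\in\mathfrak{o}_{\ell-i}$ with $v(c)>0$ and $d\in\varsigma(\mathfrak{o}_\mu)$; - (III$_\infty$) $E(m,a,b,c,d)$, where $1\le\mu<\ell-i$, $\mu<m\le\ell-i$, $a\in\varsigma(\mathfrak{o}_{\ell-i-m+\mu})$ and $b\in\mathfrak{o}_{\ell-i}$ with $\mu=v(a)<v(b)$, $c\in\mathfrak{o}_{\ell-i}$ with $v(c)>0$ and $d\in\varsigma(\mathfrak{o}_\mu)$; the shadow of $\mathcal{C}$ in the subcases (I), (II), (III$_1$),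 (III$_0$), (III$_\infty$) has type $\mathcal{J}$, $\mathcal{M}$, $\mathcal{N}$, $\mathcal{K}_0$ and $\mathcal{K}_\infty$, respectively.
   Context: $\mathfrak{p}=\pi\mathfrak{o}$, $\mathfrak{o}_\nu=\mathfrak{o}/\mathfrak{p}^\nu$, $v$ is the valuation on $\mathfrak{o}$. A similarity class in $\mathfrak{gl}_3(\mathfrak{o}_\ell)$ is an orbit of $\mathsf{GL}_3(\mathfrak{o})$ acting by conjugation. Notation: $D(a,b,c)=\mathrm{diag}(a,b,c)$ and $$E(m,a,b,c,d)=\begin{bmatrix} d & \pi^m & 0 \\ 0 & d & 1 \\ a & b & c+d \end{bmatrix}.$$ A companion matrix is one of the form $(a_{ij})$ with $a_{ij}=1$ for $i=j+1$, $a_{in}=-c_{i-1}$ in the last column, and all other entries $0$; it is the companion matrix of $t^n+\sum_{i=0}^{n-1}c_it^i$. For every $\nu\in\mathbb{N}_0$ fix a set of representatives $\varsigma(\mathfrak{o}_\nu)\subset\mathfrak{o}$ for $\mathfrak{o}_\nu$, with $\varsigma(a)$ representing $a$ and with $\varsigma(0)=\pi^\nu$; thus $0\le v(\varsigma(a))\le\nu$, and for $a\in\mathfrak{o}_\nu$ one puts $v(a):=v(\varsigma(a))$ (so $v(0)=\nu$). For $\nu<\mu$, $\varsigma(\mathfrak{o}_\nu)$ is also used for its reduction modulo $\mathfrak{p}^\mu$ in $\mathfrak{o}_\mu$; and for a scalar or matrix $X$ over $\mathfrak{o}_{\ell-\nu}$, $\pi^\nu X$ denotes the reduction modulo $\mathfrak{p}^\ell$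 of $\pi^\nu\varsigma(X)$, which is well defined over $\mathfrak{o}_\ell$. Shadows: for $A\in\mathfrak{gl}_3(\mathfrak{o}_\ell)$ let $\mathrm{sh}_{\mathsf{GL}}(A)\le\mathsf{GL}_3(\mathbf{k})$ and $\mathrm{sh}_{\mathfrak{gl}}(A)\le\mathfrak{gl}_3(\mathbf{k})$ be the images modulo $\mathfrak{p}$ of the centralisers of $A$ in $\mathsf{GL}_3(\mathfrak{o})$ and in $\mathfrak{gl}_3(\mathfrak{o})$. The shadow of $\mathcal{C}$ is $\{(\mathrm{sh}_{\mathsf{GL}}(A),\mathrm{sh}_{\mathfrak{gl}}(A))\mid A\in\mathcal{C}\}$; the first component is the unit group of the second, and the type of the shadow is determined by the $\mathsf{GL}_3(\mathbf{k})$-conjugacy class of $\mathrm{sh}_{\mathfrak{gl}}(A)$: for the first eight types it is the class of the centraliser in $\mathfrak{gl}_3(\mathbf{k})$ of a matrix with minimal polynomial over $\mathbf{k}$ of the form (differently named roots in $\mathbf{k}$ being distinct) $\mathcal{G}$: $t-\alpha$; $\mathcal{L}$: $(t-\alpha_1)(t-\alpha_2)$; $\mathcal{J}$: $(t-\alpha)^2$; $\mathcal{T}_1$: $(t-\alpha_1)(t-\alpha_2)(t-\alpha_3)$ (in all cases, the class of the algebra of diagonal matrices); $\mathcal{T}_2$: $(t-\alpha)f(t)$ with $f$ an irreducible quadratic; $\mathcal{T}_3$: an irreducible cubic; $\mathcal{M}$: $(t-\alpha_1)(t-\alpha_2)^2$; $\mathcal{N}$: $(t-\alpha)^3$. Type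 $\mathcal{K}_0$: the class of $\{t\,\mathrm{Id}_3+s_1E_{13}+s_3E_{23}\mid t,s_1,s_3\in\mathbf{k}\}$; type $\mathcal{K}_\infty$: the class of $\{t\,\mathrm{Id}_3+s_2E_{21}+s_3E_{23}\mid t,s_2,s_3\in\mathbf{k}\}$, with $E_{ij}$ elementary matrices. *)

(* Defs.v *)
From HB Require Import structures.
From mathcomp Require Import all_boot all_order all_algebra.
From mathcomp Require Import all_classical topology.

Set Implicit Arguments.
Unset Strict Implicit.
Unset Printing Implicit Defensive.

Import GRing.Theory.
Local Open Scope classical_set_scope.
Local Open Scope ring_scope.

(* A copy of O that carries the pi-adic topology. *)
Definition padic (O : idomainType) (pi : O) : Type := O.

Section PadicTopology.
Variables (O : idomainType) (pi : O).

HB.instance Definition _ := Choice.on (padic pi).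

Definition padic_open (U : set (padic pi)) : Prop :=
  forall x : O, U x -> exists n : nat, forall y : O, U (x + pi ^+ n * y).

Lemma padic_openT : padic_open setT.
Proof. by move=> x _; exists 0%N. Qed.

Lemma padic_openI (A B : set (padic pi)) :
  padic_open A -> padic_open B -> padic_open (A `&` B).
Proof.
move=> oA oB x [/oA[m Am] /oB[n Bn]]; exists (m + n)%N => y; split.
  by rewrite exprD -mulrA; apply: Am.
by rewrite addnC exprD -mulrA; apply: Bn.
Qed.

Lemma padic_open_bigU (I : Type) (f : I -> set (padic pi)) :
  (forall i, padic_open (f i)) -> padic_open (\bigcup_i f i).
Proof.
move=> of_ x [i _ /of_[n fn]]; exists n => y.
by exists i => //; apply: fn.
Qed.

HB.instance Definition _ :=
  isOpenTopological.Build (padic pi) padic_openT padic_openI padic_open_bigU.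

End PadicTopology.

Record compact_dvr (O : idomainType) (pi : O) : Prop := CompactDvr {
  uniformiser_neq0 : pi != 0;
  uniformiser_nunit : pi \isn't a GRing.unit;
  dvr_factor : forall x : O, x != 0 ->
    exists n : nat, exists2 u : O, u \is a GRing.unit & x = u * pi ^+ n;
  dvr_compact : compact [set: padic pi]
}.

(* f presents R as the quotient O / (pi^nu); R is the zero ring if nu = 0. *)
Definition is_reduction (O : idomainType) (pi : O) (nu : nat)
    (R : comPzRingType) (f : {rmorphism O -> R}) : Prop :=
  (forall y : R, exists x : O, f x = y) /\
  (forall x : O, f x = 0 <-> exists y : O, x = pi ^+ nu * y).

Definition valuation (O : idomainType) (pi x : O) : nat :=
  xget 0%N [set n | exists2 u : O, u \is a GRing.unit & x = u * pi ^+ n].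

Definition mx3 (R : pzRingType) (s : seq (seq R)) : 'M[R]_3 :=
  \matrix_(i < 3, j < 3) nth 0 (nth [::] s i) j.

Definition diag3 (R : pzRingType) (a b c : R) : 'M[R]_3 :=
  diag_mx (\row_(j < 3) [:: a; b; c]`_j).

(* With row and column indices starting at 0. This is the transpose of the
   library's companionmx. *)
Definition companion (R : pzRingType) (n : nat) (c : 'I_n -> R) : 'M[R]_n :=
  \matrix_(i < n, j < n)
    if j.+1 == n :> nat then - c i else (i == j.+1 :> nat)%:R.

Definition is_companion (R : pzRingType) (n : nat) (C : 'M[R]_n) : Prop :=
  exists c : 'I_n -> R, C = companion c.

Variant shadow_type := tG | tL | tJ | tT1 | tT2 | tT3 | tM | tN | tK0 | tKoo.

Section ShadowTypes.
Variable k : fieldType.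

Definition mx_centraliser (X : 'M[k]_3) : set 'M[k]_3 :=
  [set Y | Y *m X = X *m Y].

Definition minpoly_form (t : shadow_type) (f : {poly k}) : Prop :=
  match t with
  | tG => exists a, f = 'X - a%:P
  | tL => exists a b, a <> b /\ f = ('X - a%:P) * ('X - b%:P)
  | tJ => exists a, f = ('X - a%:P) ^+ 2
  | tT2 => exists a g, irreducible_poly g /\ size g = 3%N /\
      f = ('X - a%:P) * g
  | tT3 => irreducible_poly f /\ size f = 4%N
  | tM => exists a b, a <> b /\ f = ('X - a%:P) * ('X - b%:P) ^+ 2
  | tN => exists a, f = ('X - a%:P) ^+ 3
  | tT1 | tK0 | tKoo => False
  end.

(* For tT1 the diagonal algebra is used: over the field with two elements no
   matrix has a minimal polynomial with three distinct roots. *)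
Definition type_model (t : shadow_type) (R : set 'M[k]_3) : Prop :=
  match t with
  | tT1 => R = [set diag3 abc.1.1 abc.1.2 abc.2 | abc in [set: k * k * k]]
  | tK0 => R = [set X | exists a s1 s3,
      X = mx3 [:: [:: a; 0; s1]; [:: 0; a; s3]; [:: 0; 0; a]]]
  | tKoo => R = [set X | exists a s2 s3,
      X = mx3 [:: [:: a; 0; 0]; [:: s2; a; s3]; [:: 0; 0; a]]]
  | _ => exists2 X : 'M[k]_3, minpoly_form t (mxminpoly X) &
      R = mx_centraliser X
  end.

Definition conj_set (g : 'M[k]_3) (R : set 'M[k]_3) : set 'M[k]_3 :=
  [set g *m X *m invmx g | X in R].

Definition has_type (S : set (set 'M[k]_3 * set 'M[k]_3)) (t : shadow_type)
    : Prop :=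
  forall s, S s -> exists2 R, type_model t R &
    exists2 g, g \in unitmx & s.2 = conj_set g R.

End ShadowTypes.

Section Similarity.
Variables (O : idomainType) (o : nat -> comPzRingType).
Variables (rho : forall nu, {rmorphism O -> o nu}).
Variables (k : finFieldType) (res : {rmorphism O -> k}).

Definition similarity_class (l : nat) (cls : set 'M[o l]_3) : Prop :=
  exists A : 'M[o l]_3,
    cls = [set map_mx (rho l) g *m A *m map_mx (rho l) (invmx g)
          | g in [set g : 'M[O]_3 | g \in unitmx]].

Definition centraliser_gl (l : nat) (A : 'M[o l]_3) : set 'M[O]_3 :=
  [set X | map_mx (rho l) X *m A = A *m map_mx (rho l) X].

Definition sh_gl (l : nat) (A : 'M[o l]_3) : set 'M[k]_3 :=
  [set map_mx res X | X in centraliser_gl A].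

Definition sh_GL (l : nat) (A : 'M[o l]_3) : set 'M[k]_3 :=
  [set map_mx res X | X in centraliser_gl A `&` [set X | X \in unitmx]].

Definition shadow (l : nat) (cls : set 'M[o l]_3)
    : set (set 'M[k]_3 * set 'M[k]_3) :=
  [set (sh_GL A, sh_gl A) | A in cls].

End Similarity.

Section NormalForms.
Variables (O : idomainType) (pi : O) (o : nat -> comPzRingType).
Variables (rho : forall nu, {rmorphism O -> o nu}).
Variables (sigma : forall nu, o nu -> O).
Arguments sigma : clear implicits.

(* For nu = 0 the second condition makes 1 the representative of o 0. *)
Definition is_representatives : Prop :=
  (forall nu (a : o nu), rho nu (sigma nu a) = a) /\
  (forall nu, sigma nu 0 = pi ^+ nu).

(* v(a) for a in o nu; in particular v(0) = nu. *)
Definition val_red (nu : nat) (a : o nu) : nat := valuation pi (sigma nu a).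

(* a belongs to the image in o mu of the representatives of o nu. *)
Definition in_sigma (nu mu : nat) (a : o mu) : Prop :=
  exists b : o nu, a = rho mu (sigma nu b).

Definition unit_red (nu : nat) (a : o nu) : Prop := exists b, a * b = 1.

(* The matrix pi^i X over o l, for X over o (l - i). *)
Definition pimul (l i : nat) (X : 'M[o (l - i)]_3) : 'M[o l]_3 :=
  map_mx (fun a => rho l (pi ^+ i * sigma (l - i) a)) X.

Definition Emx (nu m : nat) (a b c d : o nu) : 'M[o nu]_3 :=
  mx3 [:: [:: d; rho nu (pi ^+ m); 0];
          [:: 0; d;                1];
          [:: a; b;                c + d]].

Definition lower_block (nu : nat) (C : 'M[o nu]_2) : 'M[o nu]_3 :=
  block_mx (0 : 'M_1) 0 0 C.

Local Notation v := val_red.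

Variant E_form (nu : nat) : 'M[o nu]_3 -> shadow_type -> Prop :=
| E_I (c d : o nu) of (0 < v c)%N :
    E_form (Emx nu 0 0 c d) tJ
| E_II mu (a b c d : o nu) of (1 <= mu < nu)%N &
    mu = v b & (v b <= v a)%N & (0 < v c)%N & in_sigma mu d :
    E_form (Emx mu a b c d) tM
| E_III1 mu (a b c d : o nu) of (1 <= mu < nu)%N &
    mu = v a & (v a < v b)%N & (0 < v c)%N & in_sigma mu d :
    E_form (Emx mu a b c d) tN
| E_III0 mu (a b c d : o nu) of (1 <= mu < nu)%N &
    (mu < v a)%N & (mu < v b)%N & (0 < v c)%N & in_sigma mu d :
    E_form (Emx mu a b c d) tK0
| E_IIIoo m mu (a b c d : o nu) of (1 <= mu < nu)%N & (mu < m <= nu)%N &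
    in_sigma (nu - m + mu) a & mu = v a & (v a < v b)%N & (0 < v c)%N &
    in_sigma mu d :
    E_form (Emx m a b c d) tKoo.

(* The matrices of the list, each with the type of its shadow. The functions
   tau2 and tau3 record how the type depends on the companion matrix C. *)
Variant listed (l : nat) (tau2 : forall nu, 'M[o nu]_2 -> shadow_type)
    (tau3 : forall nu, 'M[o nu]_3 -> shadow_type)
    : 'M[o l]_3 -> shadow_type -> Prop :=
| form_i (d : o l) :
    listed tau2 tau3 d%:M tG
| form_ii i (d : o l) (a : o (l - i)) of (i < l)%N & unit_red a :
    listed tau2 tau3 (d%:M + pimul (diag3 a 0 0)) tL
| form_iii i j (d : o l) (a : o (l - i)) (C : 'M[o (l - j)]_2) of
    (i < j < l)%N & in_sigma j d & unit_red a & is_companion C :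
    listed tau2 tau3
      (d%:M + pimul (diag3 a 0 0) + pimul (lower_block C)) (tau2 _ C)
| form_iv i (d : o l) (C : 'M[o (l - i)]_3) of
    (i < l)%N & in_sigma i d & is_companion C :
    listed tau2 tau3 (d%:M + pimul C) (tau3 _ C)
| form_v i (d' : o l) (E : 'M[o (l - i)]_3) t of
    (i < l)%N & in_sigma i d' & E_form E t :
    listed tau2 tau3 (d'%:M + pimul E) t.

End NormalForms.

(* Main.v *)
(** Everything takes place over [O], modulo powers of [pi]. A matrix that is not
    scalar modulo [pi^l] is [d + pi^i B] with [i < l] maximal, so that [B] is not
    scalar modulo [pi]; the level [i] and the class of [d] modulo [pi^i] are
    invariants. Completing a pair of rows [v], [v B] that is independent modulo
    [pi] to a basis brings [B] to the shape
    [[d, x, 0], [0, d, 1], [a, b, c + d]]. If [x], [a] or [b] is a unit then [B]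
    is cyclic, hence similar to a companion matrix, which its characteristic
    polynomial determines. If only [c] is a unit, Hensel's lemma splits off an
    eigenvalue and the argument is repeated for the remaining 2x2 block.

    If [x], [a], [b], [c] are all divisible by [pi], the ideal [(x, a, b) = (pi^mu)]
    is an invariant, as is [d] modulo [pi^mu]; the entries [c] and [b] (for fixed [d])
    are read off the characteristic polynomial. The normal form is reached by
    changing the first two basis vectors, and uniqueness follows from the nine
    equations that express that a matrix intertwines two normal forms.

    For the shadow: [X] commutes with [d + pi^i B] modulo [pi^l] iff it commutes
    with [B] modulo [pi^(l-i)]. For a cyclic [B] the centraliser consists of
    polynomials in [B], so it lifts from the residue field. In the last family
    the reduction of [X] is [[p, 0, r], [s, p + w, u], [0, 0, p + w]], where
    [(r, s, w)] is the reduction of a vector proportional to [(x, a, b) / pi^mu]. *)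

Require Import Defs.
From mathcomp Require Import all_boot all_order all_algebra.
From mathcomp Require Import all_classical topology.
From mathcomp Require Import ring zify.

Set Implicit Arguments.
Unset Strict Implicit.
Unset Printing Implicit Defensive.

Import GRing.Theory.
Local Open Scope classical_set_scope.
Local Open Scope ring_scope.


(** * Matrices of size two and three *)

(** In the quotients a power of pi cannot be cancelled, whereas in the domain O it can be cancelled
    from a congruence at the cost of precision. Normal forms are therefore lifted to O, and
    similarity means that g A = B g modulo pi^n for some g in GL_3(O), a condition linear in g that
    can be read entry by entry. The chosen representatives enter as a predicate [rep] with three
    properties: every residue class has a representative, it has only one, and the class of 0 is
    represented by pi^i. The last property keeps a an exact multiple of pi^mu in (III_oo) when m =
    n. Hensel's lemma is applied to the precision pi^n, which n Newton steps reach. Once the levels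
    agree, the nonscalar families are told apart by the quadratic polynomials that annihilate B
    modulo pi: none for a companion matrix, t(t - a) with a unit a but no square for a split matrix,
    a square for E. The type attached to a companion matrix has to be a function of the matrix over
    [o nu]; it is obtained by choice, because the shadow depends only on the coefficients modulo
    pi. *)

Section Mx3.
Variable R : pzRingType.
Implicit Types a b c : R.

Definition m3 (a b c d e f g h i : R) : 'M[R]_3 :=
  mx3 [:: [:: a; b; c]; [:: d; e; f]; [:: g; h; i]].

Lemma ord3P (P : 'I_3 -> Prop) : P 0 -> P 1 -> P 2%:R -> forall i, P i.
Proof.
move=> P0 P1 P2 [[|[|[|//]]] Hi].
- by rewrite (_ : Ordinal _ = 0) //; apply: val_inj.
- by rewrite (_ : Ordinal _ = 1) //; apply: val_inj.
- by rewrite (_ : Ordinal _ = 2%:R) //; apply: val_inj.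
Qed.

Lemma ord2P (P : 'I_2 -> Prop) : P 0 -> P 1 -> forall i, P i.
Proof.
move=> P0 P1 [[|[|//]] Hi].
- by rewrite (_ : Ordinal _ = 0) //; apply: val_inj.
- by rewrite (_ : Ordinal _ = 1) //; apply: val_inj.
Qed.

Lemma mx3P (A B : 'M[R]_3) :
  A 0 0 = B 0 0 -> A 0 1 = B 0 1 -> A 0 2%:R = B 0 2%:R ->
  A 1 0 = B 1 0 -> A 1 1 = B 1 1 -> A 1 2%:R = B 1 2%:R ->
  A 2%:R 0 = B 2%:R 0 -> A 2%:R 1 = B 2%:R 1 ->
  A 2%:R 2%:R = B 2%:R 2%:R -> A = B.
Proof. by move=> *; apply/matrixP; apply: ord3P; apply: ord3P. Qed.

Lemma mx2P (A B : 'M[R]_2) :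
  A 0 0 = B 0 0 -> A 0 1 = B 0 1 -> A 1 0 = B 1 0 -> A 1 1 = B 1 1 -> A = B.
Proof. by move=> *; apply/matrixP; apply: ord2P; apply: ord2P. Qed.

Lemma m3_eta (A : 'M[R]_3) :
  A = m3 (A 0 0) (A 0 1) (A 0 2%:R) (A 1 0) (A 1 1) (A 1 2%:R)
         (A 2%:R 0) (A 2%:R 1) (A 2%:R 2%:R).
Proof. by apply: mx3P; rewrite mxE. Qed.

Lemma m3_inj a b c d e f g h i a' b' c' d' e' f' g' h' i' :
  m3 a b c d e f g h i = m3 a' b' c' d' e' f' g' h' i' ->
  [/\ a = a', b = b' & c = c'] /\ [/\ d = d', e = e' & f = f'] /\
  [/\ g = g', h = h' & i = i'].
Proof.
move=> /matrixP E.
move: (E 0 0) (E 0 1) (E 0 2%:R) (E 1 0) (E 1 1) (E 1 2%:R)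
  (E 2%:R 0) (E 2%:R 1) (E 2%:R 2%:R); rewrite !mxE /=.
by move=> -> -> -> -> -> -> -> -> ->.
Qed.

Lemma mul_m3 a b c d e f g h i a' b' c' d' e' f' g' h' i' :
  m3 a b c d e f g h i *m m3 a' b' c' d' e' f' g' h' i' =
  m3 (a * a' + b * d' + c * g') (a * b' + b * e' + c * h')
     (a * c' + b * f' + c * i')
     (d * a' + e * d' + f * g') (d * b' + e * e' + f * h')
     (d * c' + e * f' + f * i')
     (g * a' + h * d' + i * g') (g * b' + h * e' + i * h')
     (g * c' + h * f' + i * i').
Proof. by apply: mx3P; rewrite !mxE !big_ord_recl big_ord0 addr0 !addrA !mxE. Qed.

Lemma add_m3 a b c d e f g h i a' b' c' d' e' f' g' h' i' :
  m3 a b c d e f g h i + m3 a' b' c' d' e' f' g' h' i' =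
  m3 (a + a') (b + b') (c + c') (d + d') (e + e') (f + f')
     (g + g') (h + h') (i + i').
Proof. by apply: mx3P; rewrite !mxE. Qed.

Lemma opp_m3 a b c d e f g h i :
  - m3 a b c d e f g h i =
  m3 (- a) (- b) (- c) (- d) (- e) (- f) (- g) (- h) (- i).
Proof. by apply: mx3P; rewrite !mxE. Qed.

Lemma scale_m3 x a b c d e f g h i :
  x *: m3 a b c d e f g h i =
  m3 (x * a) (x * b) (x * c) (x * d) (x * e) (x * f) (x * g) (x * h) (x * i).
Proof. by apply: mx3P; rewrite !mxE. Qed.

Lemma scalar_m3 x : x%:M = m3 x 0 0 0 x 0 0 0 x.
Proof. by apply: mx3P; rewrite !mxE. Qed.

Lemma diag3_m3 a b c : diag3 a b c = m3 a 0 0 0 b 0 0 0 c.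
Proof. by apply: mx3P; rewrite !mxE. Qed.

Definition m2 (a b c d : R) : 'M[R]_2 :=
  \matrix_(i < 2, j < 2) nth 0 (nth [::] [:: [:: a; b]; [:: c; d]] i) j.

Lemma m2_eta (A : 'M[R]_2) : A = m2 (A 0 0) (A 0 1) (A 1 0) (A 1 1).
Proof. by apply: mx2P; rewrite mxE. Qed.

Lemma m2_inj a b c d a' b' c' d' :
  m2 a b c d = m2 a' b' c' d' -> [/\ a = a', b = b', c = c' & d = d'].
Proof.
move=> /matrixP E; move: (E 0 0) (E 0 1) (E 1 0) (E 1 1); rewrite !mxE /=.
by move=> -> -> -> ->.
Qed.

Lemma mul_m2 a b c d a' b' c' d' :
  m2 a b c d *m m2 a' b' c' d' =
  m2 (a * a' + b * c') (a * b' + b * d') (c * a' + d * c') (c * b' + d * d').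
Proof. by apply: mx2P; rewrite !mxE !big_ord_recl big_ord0 addr0 !mxE. Qed.

Lemma scalar_m2 x : x%:M = m2 x 0 0 x.
Proof. by apply: mx2P; rewrite !mxE. Qed.

End Mx3.

Lemma map_m3 (R S : pzRingType) (f : R -> S) a b c d e f' g h i :
  map_mx f (m3 a b c d e f' g h i) =
  m3 (f a) (f b) (f c) (f d) (f e) (f f') (f g) (f h) (f i).
Proof. by apply: mx3P; rewrite !mxE. Qed.

Lemma det_m3 (R : comPzRingType) (a b c d e f g h i : R) :
  \det (m3 a b c d e f g h i) =
  a * (e * i - f * h) - b * (d * i - f * g) + c * (d * h - e * g).
Proof.
rewrite (expand_det_row _ 0) !big_ord_recl big_ord0 addr0 /cofactor.
do 3 rewrite (expand_det_row _ 0) !big_ord_recl big_ord0 addr0 /cofactor !det_mx11.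
by rewrite !mxE /=; ring.
Qed.

Lemma tr_m3 (R : pzRingType) (a b c d e f g h i : R) :
  \tr (m3 a b c d e f g h i) = a + e + i.
Proof. by rewrite /mxtrace !big_ord_recl big_ord0 addr0 !mxE addrA. Qed.

Lemma det_m2 (R : comPzRingType) (a b c d : R) :
  \det (m2 a b c d) = a * d - b * c.
Proof.
rewrite (expand_det_row _ 0) !big_ord_recl big_ord0 addr0 /cofactor !det_mx11.
by rewrite !mxE /=; ring.
Qed.

Lemma tr_m2 (R : pzRingType) (a b c d : R) : \tr (m2 a b c d) = a + d.
Proof. by rewrite /mxtrace !big_ord_recl big_ord0 addr0 !mxE. Qed.

(** * Similarity modulo powers of the uniformiser *)

Section Divisibility.
Variables (O : idomainType) (pi : O).
Implicit Types x y z u : O.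

Definition dv (n : nat) (x : O) : Prop := exists y, x = pi ^+ n * y.

Lemma dv0 n : dv n 0. Proof. by exists 0; rewrite mulr0. Qed.

Lemma dv_0 x : dv 0 x. Proof. by exists x; rewrite mul1r. Qed.

Lemma dvD n x y : dv n x -> dv n y -> dv n (x + y).
Proof. by move=> [a ->] [b ->]; exists (a + b); rewrite mulrDr. Qed.

Lemma dvN n x : dv n x -> dv n (- x).
Proof. by move=> [a ->]; exists (- a); rewrite mulrN. Qed.

Lemma dvB n x y : dv n x -> dv n y -> dv n (x - y).
Proof. by move=> dx dy; apply/dvD/dvN. Qed.

Lemma dvMl n x y : dv n y -> dv n (x * y).
Proof. by move=> [a ->]; exists (x * a); rewrite mulrCA. Qed.

Lemma dvMr n x y : dv n x -> dv n (x * y).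
Proof. by rewrite mulrC; apply: dvMl. Qed.

Lemma dvM m n x y : dv m x -> dv n y -> dv (m + n) (x * y).
Proof. by move=> [a ->] [b ->]; exists (a * b); rewrite exprD mulrACA. Qed.

Lemma dvX n : dv n (pi ^+ n). Proof. by exists 1; rewrite mulr1. Qed.

Lemma dvW m n x : (m <= n)%N -> dv n x -> dv m x.
Proof. by move=> /subnKC <- [a ->]; exists (pi ^+ (n - m) * a); rewrite exprD mulrA. Qed.

Lemma dvXle m n : (m <= n)%N -> dv m (pi ^+ n).
Proof. by move=> /dvW; apply; apply: dvX. Qed.

Lemma dv_eq n x y : x = y -> dv n y -> dv n x. Proof. by move->. Qed.

Lemma dv_trans n x y : dv n (x - y) -> dv n y -> dv n x.
Proof. by move=> dxy dy; rewrite -(subrK y x); apply: dvD. Qed.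

Lemma dv_transr n x y : dv n (x - y) -> dv n x -> dv n y.
Proof. by move=> dxy dx; rewrite -(subKr x y); apply: dvB. Qed.

Lemma dv_subC n x y : dv n (x - y) -> dv n (y - x).
Proof. by move/dvN; rewrite opprB. Qed.

Lemma dv_unitl n u x : u \is a GRing.unit -> dv n (u * x) -> dv n x.
Proof. by move=> uu /(dvMl u^-1); rewrite mulKr. Qed.

(** Supplies the extremal exponents of the proof: the order of an element cut off at n, the level of
    a matrix, and the exponent [mu] of an ideal. [P] is neither decidable nor monotone in
    general. *)
Lemma dv_max (P : nat -> Prop) n : P 0%N ->
  exists m, [/\ (m <= n)%N, P m & (m < n)%N -> ~ P m.+1].
Proof.
elim: n => [|n IHn] P0; first by exists 0%N.
have [m [le_mn Pm nPm]] := IHn P0.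
have [lt_mn|] := ltnP m n; first by exists m; split=> // [|_]; [lia|apply: nPm].
move=> le_nm; have {le_nm}{}le_mn : m = n by lia.
have [Pn1|nPn1] := pselect (P n.+1); first by exists n.+1; split=> //; lia.
by exists m; split=> //; [lia | rewrite le_mn].
Qed.

Hypothesis hO : compact_dvr pi.

Lemma pi_neq0 : pi != 0. Proof. exact: uniformiser_neq0 hO. Qed.

Lemma piX_neq0 n : pi ^+ n != 0. Proof. exact/expf_neq0/pi_neq0. Qed.

Lemma dv_canc m n x : (m <= n)%N -> dv n (pi ^+ m * x) -> dv (n - m) x.
Proof.
move=> /subnKC {1}<- [y]; rewrite exprD -mulrA => /(mulfI (piX_neq0 m)) ->.
by exists y.
Qed.

Lemma dv_cancD m n x : dv (m + n) (pi ^+ m * x) -> dv n x.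
Proof. by move/(dv_canc (leq_addr n m)); rewrite addKn. Qed.

Lemma dv_scale m n x : dv n x -> dv (m + n) (pi ^+ m * x).
Proof. exact/dvM/dvX. Qed.

Lemma unitPn x : x \is a GRing.unit <-> ~ dv 1 x.
Proof.
split=> [ux [y xy]|ndx].
  move: ux; rewrite xy expr1 unitrM => /andP[upi _].
  by move: (uniformiser_nunit hO); rewrite upi.
have x0 : x != 0 by apply: contra_notN ndx => /eqP ->; apply: dv0.
have [[|n] [u uu xE]] := dvr_factor hO x0; first by rewrite xE mulr1.
by case: ndx; rewrite xE; apply/dvMl/dvXle.
Qed.

Lemma unit_dv n u : (0 < n)%N -> u \is a GRing.unit -> ~ dv n u.
Proof. by move=> n0 /unitPn nu /(dvW n0). Qed.

Lemma not_unit x : ~ x \is a GRing.unit -> dv 1 x.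
Proof. by move=> nu; apply: contrapT => /unitPn. Qed.

Lemma unitDdv u x : u \is a GRing.unit -> dv 1 x -> u + x \is a GRing.unit.
Proof. by move=> /unitPn nu dx; apply/unitPn => /dvB/(_ dx); rewrite addrK. Qed.

Lemma unit_cong u x : dv 1 (u - x) -> u \is a GRing.unit -> x \is a GRing.unit.
Proof. by move=> dx uu; rewrite -(subKr u x) unitDdv //; apply: dvN. Qed.

Lemma dv_prime x y : dv 1 (x * y) -> ~ dv 1 x -> dv 1 y.
Proof. by move=> dxy /unitPn ux; apply: dv_unitl dxy. Qed.

Lemma exact_dv m x : dv m x -> ~ dv m.+1 x ->
  exists2 u, u \is a GRing.unit & x = pi ^+ m * u.
Proof.
move=> [u ->] nd; exists u => //; apply/unitPn => du.
by apply: nd; rewrite -addn1; apply: dv_scale.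
Qed.

Lemma exact_ndv m u : u \is a GRing.unit -> ~ dv m.+1 (pi ^+ m * u).
Proof. by move=> /unitPn nu; rewrite -addn1 => /dv_cancD. Qed.

(** An x that vanishes modulo pi^n counts as pi^n * 1. Hence the (1,2) entry of E can be normalised
    to a power of pi without a separate case for zero. *)
Lemma trunc_val n x : exists m u,
  [/\ (m <= n)%N, u \is a GRing.unit & dv n (x - pi ^+ m * u)].
Proof.
have [m [le_mn dx ndx]] := @dv_max (dv^~ x) n (dv_0 x).
have [lt_mn|le_nm] := ltnP m n.
  have [u uu ->] := exact_dv dx (ndx lt_mn).
  by exists m, u; split=> //; rewrite subrr; apply: dv0.
have <- : m = n by lia.
exists m, 1; split=> //; first exact: unitr1.
by apply: dvB => //; apply/dvMr/dvX.
Qed.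

Lemma valuationP x : x != 0 ->
  exists2 u, u \is a GRing.unit & x = u * pi ^+ valuation pi x.
Proof.
move=> /(dvr_factor hO)[n [u uu xE]]; rewrite /valuation.
by case: xgetP => [m _ [v ? ?]|/(_ n)[]]; [exists v|exists u].
Qed.

Lemma dv_valuation m x : x != 0 -> dv m x <-> (m <= valuation pi x)%N.
Proof.
move=> /valuationP[u uu]; set n := valuation pi x => ->.
split=> [dm|le_mn]; last by apply/dvMl/dvXle.
rewrite leqNgt; apply/negP => lt_nm.
by apply: (@exact_ndv n u uu); rewrite mulrC; apply: dvW dm.
Qed.

End Divisibility.

#[export] Hint Resolve dvD dvB dvN dvMl dvMr dv0 dvX : dv.

(** [t] is the certificate of an ideal membership: [ring] identifies it with the goal, and the hints
    check its summands one by one. *)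
Ltac dvcomb t := apply: (@dv_eq _ _ _ _ t); [by ring | auto 12 with dv].

Section Congruence.
Variables (O : idomainType) (pi : O).
Local Notation dv := (dv pi).

Definition dvmx (p q : nat) (n : nat) (A : 'M[O]_(p, q)) : Prop :=
  forall i j, dv n (A i j).

Lemma dvmx0 p q n : @dvmx p q n 0.
Proof. by move=> i j; rewrite mxE; apply: dv0. Qed.

Lemma dvmxD p q n (A B : 'M[O]_(p, q)) : dvmx n A -> dvmx n B -> dvmx n (A + B).
Proof. by move=> dA dB i j; rewrite mxE; apply: dvD. Qed.

Lemma dvmxN p q n (A : 'M[O]_(p, q)) : dvmx n A -> dvmx n (- A).
Proof. by move=> dA i j; rewrite mxE; apply: dvN. Qed.

Lemma dvmxB p q n (A B : 'M[O]_(p, q)) : dvmx n A -> dvmx n B -> dvmx n (A - B).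
Proof. by move=> dA dB; apply/dvmxD/dvmxN. Qed.

Lemma dvmx_subC p q n (A B : 'M[O]_(p, q)) : dvmx n (A - B) -> dvmx n (B - A).
Proof. by move/dvmxN; rewrite opprB. Qed.

Lemma dv_sum n (I : finType) (F : I -> O) :
  (forall i, dv n (F i)) -> dv n (\sum_i F i).
Proof. by move=> dF; elim/big_ind: _ => // [|x y]; [apply: dv0|apply: dvD]. Qed.

Lemma dvmxMl p q r n (A : 'M[O]_(p, q)) (B : 'M[O]_(q, r)) :
  dvmx n B -> dvmx n (A *m B).
Proof. by move=> dB i j; rewrite mxE; apply: dv_sum => ?; apply/dvMl. Qed.

Lemma dvmxMr p q r n (A : 'M[O]_(p, q)) (B : 'M[O]_(q, r)) :
  dvmx n A -> dvmx n (A *m B).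
Proof. by move=> dA i j; rewrite mxE; apply: dv_sum => ?; apply/dvMr. Qed.

Lemma dvmxW p q m n (A : 'M[O]_(p, q)) : (m <= n)%N -> dvmx n A -> dvmx m A.
Proof. by move=> le_mn dA i j; apply: dvW (dA i j). Qed.

Lemma dvmxX p q m n (A : 'M[O]_(p, q)) : dvmx n A -> dvmx (m + n) (pi ^+ m *: A).
Proof. by move=> dA i j; rewrite mxE; apply/dvM => //; apply: dvX. Qed.

Lemma dvmxXl p q m (A : 'M[O]_(p, q)) : dvmx m (pi ^+ m *: A).
Proof. by move=> i j; rewrite mxE; apply/dvMr/dvX. Qed.

Lemma dvmx_ex p q n (A : 'M[O]_(p, q)) :
  dvmx n A -> exists B, A = pi ^+ n *: B.
Proof.
move=> dA; exists (\matrix_(i, j) sval (cid (dA i j))).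
by apply/matrixP => i j; rewrite !mxE; case: cid.
Qed.

Lemma dvmx_m3 n a b c d e f g h i :
  dvmx n (m3 a b c d e f g h i) <->
  [/\ dv n a, dv n b & dv n c] /\ [/\ dv n d, dv n e & dv n f] /\
  [/\ dv n g, dv n h & dv n i].
Proof.
split=> [H|[[? ? ?] [[? ? ?] [? ? ?]]]].
  move: (H 0 0) (H 0 1) (H 0 2%:R) (H 1 0) (H 1 1) (H 1 2%:R) (H 2%:R 0)
    (H 2%:R 1) (H 2%:R 2%:R); rewrite !mxE /=.
  by do !split.
by apply: ord3P; apply: ord3P; rewrite mxE.
Qed.

Lemma dvmx_m2 n a b c d :
  dvmx n (m2 a b c d) <-> [/\ dv n a, dv n b, dv n c & dv n d].
Proof.
split=> [H|[? ? ? ?]].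
  by move: (H 0 0) (H 0 1) (H 1 0) (H 1 1); rewrite !mxE.
by apply: ord2P; apply: ord2P; rewrite mxE.
Qed.

(** Stated with an intertwiner instead of a conjugate, so that no inverse occurs in the entries. As
    in the definition of a similarity class, g is invertible over O itself. *)
Definition simmod (N n : nat) (A B : 'M[O]_N) : Prop :=
  exists2 g, g \in unitmx & dvmx n (g *m A - B *m g).

Lemma simmod_refl N n (A : 'M[O]_N) : simmod n A A.
Proof.
by exists 1%:M; rewrite ?unitmx1 // mul1mx mulmx1 subrr; apply: dvmx0.
Qed.

Lemma simmod_sym N n (A B : 'M[O]_N) : simmod n A B -> simmod n B A.
Proof.
move=> [g ug dg]; exists (invmx g); first by rewrite unitmx_inv.
have -> : invmx g *m B - A *m invmx g =
    invmx g *m (B *m g - g *m A) *m invmx g.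
  by rewrite mulmxBr mulmxBl !mulmxA mulmxK // mulVmx // mul1mx.
exact/dvmxMr/dvmxMl/dvmx_subC.
Qed.

Lemma simmod_trans N n (A B C : 'M[O]_N) :
  simmod n A B -> simmod n B C -> simmod n A C.
Proof.
move=> [g ug dg] [h uh dh]; exists (h *m g); first by rewrite unitmx_mul uh.
have -> : h *m g *m A - C *m (h *m g) =
    h *m (g *m A - B *m g) + (h *m B - C *m h) *m g.
  by rewrite mulmxBr mulmxBl !mulmxA addrA subrK.
by apply: dvmxD; [apply: dvmxMl|apply: dvmxMr].
Qed.

Lemma simmod_cong N n (A B : 'M[O]_N) : dvmx n (A - B) -> simmod n A B.
Proof. by move=> dAB; exists 1%:M; rewrite ?unitmx1 // mul1mx mulmx1. Qed.

Lemma simmod_eq N n (g A B : 'M[O]_N) :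
  g \in unitmx -> g *m A = B *m g -> simmod n A B.
Proof. by move=> ug E; exists g => //; rewrite E subrr; apply: dvmx0. Qed.

Lemma simmodW N m n (A B : 'M[O]_N) :
  (m <= n)%N -> simmod n A B -> simmod m A B.
Proof. by move=> le_mn [g ug dg]; exists g => //; apply: dvmxW dg. Qed.

Lemma simmod_conj N n (A B : 'M[O]_N) : simmod n A B ->
  exists2 g, g \in unitmx & dvmx n (g *m A *m invmx g - B).
Proof.
move=> [g ug dg]; exists g => //.
have -> : g *m A *m invmx g - B = (g *m A - B *m g) *m invmx g.
  by rewrite mulmxBl mulmxK.
exact: dvmxMr.
Qed.

Lemma commr_sub_scalar N (g A B : 'M[O]_N) (e f x y : O) :
  g *m (e%:M + x *: A) - (f%:M + y *: B) *m g =
  (e - f) *: g + (x *: (g *m A) - y *: (B *m g)).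
Proof.
rewrite mulmxDr mulmxDl -!scalemxAl -!scalemxAr mul_scalar_mx.
by rewrite mul_mx_scalar scalerBl opprD addrACA.
Qed.

Lemma simmod_affine N m n (A B : 'M[O]_N) (e : O) :
  simmod n A B -> simmod (m + n) (e%:M + pi ^+ m *: A) (e%:M + pi ^+ m *: B).
Proof.
move=> [g ug dg]; exists g => //; rewrite commr_sub_scalar subrr scale0r add0r.
by rewrite -scalerBr; apply: dvmxX.
Qed.

Lemma simmod_shift N n (A B : 'M[O]_N) (e : O) :
  simmod n A B -> simmod n (e%:M + A) (e%:M + B).
Proof. by move/(simmod_affine 0 e); rewrite expr0 !scale1r. Qed.

Hypothesis hO : compact_dvr pi.

Lemma unitmx_dv N (g : 'M[O]_N) : g \in unitmx <-> ~ dv 1 (\det g).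
Proof. by rewrite unitmxE; apply: unitPn. Qed.

Lemma dvmx_canc p q m n (A : 'M[O]_(p, q)) :
  dvmx (m + n) (pi ^+ m *: A) -> dvmx n A.
Proof. by move=> dA i j; apply: (dv_cancD hO (m := m)); move: (dA i j); rewrite mxE. Qed.

Lemma dvmx_unitl p q n (g : 'M[O]_p) (A : 'M[O]_(p, q)) :
  g \in unitmx -> dvmx n (g *m A) -> dvmx n A.
Proof. by move=> ug /(dvmxMl (invmx g)); rewrite mulKmx. Qed.

Lemma dvmx_unitr p q n (g : 'M[O]_q) (A : 'M[O]_(p, q)) :
  g \in unitmx -> dvmx n (A *m g) -> dvmx n A.
Proof. by move=> ug /(dvmxMr (invmx g)); rewrite mulmxK. Qed.

(** The factor pi^m cancels from the intertwining relation, and the difference of the scalars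
    survives as the shift e. This is why a matrix at level i matters only modulo pi^(l-i). *)
Lemma simmod_descend N m n (A B : 'M[O]_N) (d d' e : O) :
  d - d' = pi ^+ m * e ->
  simmod (m + n) (d%:M + pi ^+ m *: A) (d'%:M + pi ^+ m *: B) ->
  simmod n (e%:M + A) B.
Proof.
move=> de [g ug]; rewrite commr_sub_scalar de -scalerA -scalerBr -scalerDr.
move=> /dvmx_canc dg; exists g => //.
by rewrite mulmxDr mul_mx_scalar -addrA.
Qed.

Definition nonscalar N (A : 'M[O]_N) : Prop := forall x, ~ dvmx 1 (A - x%:M).

Lemma nonscalar_shift N (A : 'M[O]_N) x : nonscalar A -> nonscalar (x%:M + A).
Proof.
move=> nA y; have -> : x%:M + A - y%:M = A - (y - x)%:M.
  by rewrite raddfB /= opprB addrA [A + _]addrC.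
exact: nA.
Qed.

(** Modulo pi^(i+1) the second matrix is the scalar d', so g cancels and d - d' + pi^i A vanishes.
    Then pi^i divides d - d', and cancelling it makes A scalar modulo pi. *)
Lemma simmod_level_lt N n i i' (A A' : 'M[O]_N.+1) (d d' : O) :
  (i < n)%N -> (i < i')%N -> nonscalar A ->
  ~ simmod n (d%:M + pi ^+ i *: A) (d'%:M + pi ^+ i' *: A').
Proof.
move=> lt_in lt_ii' nA /(simmodW lt_in)[g ug].
rewrite commr_sub_scalar addrA => dg.
have {}dg : dvmx i.+1 (g *m ((d - d')%:M + pi ^+ i *: A)).
  have -> : g *m ((d - d')%:M + pi ^+ i *: A) =
      ((d - d') *: g + pi ^+ i *: (g *m A) - pi ^+ i' *: (A' *m g)) +
      pi ^+ i' *: (A' *m g).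
    by rewrite addrNK mulmxDr mul_mx_scalar -scalemxAr.
  by apply: dvmxD dg _; apply: dvmxW lt_ii' (dvmxXl _ _).
move: dg => /(dvmx_unitl ug) dg.
have [e de] : dv i (d - d').
  have := dg 0 0; rewrite !mxE eqxx mulr1n => /(dvW (leqnSn i)) dgi.
  by apply: dv_trans (dvN (dvMr (A 0 0) (dvX pi i))); rewrite opprK.
move: dg; rewrite de -(addn1 i) -scale_scalar_mx -scalerDr.
move=> /dvmx_canc dA; apply: (nA (- e)).
by rewrite raddfN opprK addrC.
Qed.

Lemma simmod_level N n i i' (A A' : 'M[O]_N.+1) (d d' : O) :
  (i < n)%N -> (i' < n)%N -> nonscalar A -> nonscalar A' ->
  simmod n (d%:M + pi ^+ i *: A) (d'%:M + pi ^+ i' *: A') ->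
  i = i' /\ dv i (d - d').
Proof.
move=> lt_in lt_i'n nA nA' sAA'.
have eq_ii' : i = i'.
  case: (ltngtP i i') => // lt_ii'.
    by case: (simmod_level_lt lt_in lt_ii' nA sAA').
  by case: (simmod_level_lt lt_i'n lt_ii' nA' (simmod_sym sAA')).
split=> //; move: sAA'; rewrite -eq_ii' => /(simmodW (ltnW lt_in))[g ug].
rewrite commr_sub_scalar -scalerBr => dg.
have /(dvmx_unitr ug)/(_ 0 0) : dvmx i ((d - d')%:M *m g).
  rewrite mul_scalar_mx -[X in dvmx i X](addrK (pi ^+ i *: (g *m A - A' *m g))).
  exact/(dvmxB dg)/dvmxXl.
by rewrite mxE eqxx mulr1n.
Qed.

Lemma simmod_scalar N n i (A : 'M[O]_N.+1) (d d' : O) :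
  (i < n)%N -> nonscalar A -> ~ simmod n (d%:M + pi ^+ i *: A) d'%:M.
Proof.
move=> lt_in nA; rewrite -[d'%:M]addr0 -(scaler0 _ (pi ^+ i.+1)).
exact: simmod_level_lt.
Qed.

Lemma simmod_scalars N n (d d' : O) :
  simmod n (d%:M : 'M[O]_N) d'%:M -> dvmx n (d%:M - d'%:M : 'M[O]_N).
Proof.
by move=> [g ug]; rewrite scalar_mxC -mulmxBl => /(dvmx_unitr ug).
Qed.

Lemma nonscalar_decomp N n (A : 'M[O]_N) :
  (exists d, dvmx n (A - d%:M)) \/
  exists i d B, [/\ (i < n)%N, nonscalar B & A = d%:M + pi ^+ i *: B].
Proof.
pose P i := exists d B, A = d%:M + pi ^+ i *: B.
have P0 : P 0%N by exists 0, A; rewrite raddf0 add0r scale1r.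
have [i [le_in [d [B AE]] nPi]] := dv_max n P0.
have [lt_in|le_ni] := ltnP i n; last first.
  left; exists d; rewrite AE addrC addKr.
  exact: dvmxW le_ni (dvmxXl _ _).
right; exists i, d, B; split=> // x /dvmx_ex[C BC].
apply: (nPi lt_in); exists (d + pi ^+ i * x), C.
rewrite AE -(subrK x%:M B) BC expr1 scalerDr scalerA -exprSr scale_scalar_mx.
by rewrite raddfD /= addrA addrAC.
Qed.

End Congruence.

(** * Determinant, trace and quadratic relations as invariants *)

Section Invariants.
Variables (O : idomainType) (pi : O).
Local Notation dv := (dv pi).
Local Notation dvmx := (dvmx pi).
Local Notation simmod := (simmod pi).

Lemma dv_subM n x y x' y' :
  dv n (x - x') -> dv n (y - y') -> dv n (x * y - x' * y').
Proof. by move=> dx dy; dvcomb ((x - x') * y + x' * (y - y')). Qed.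

Lemma dv_det N n (A B : 'M[O]_N) : dvmx n (A - B) -> dv n (\det A - \det B).
Proof.
move=> dAB; rewrite /determinant -sumrB; apply: dv_sum => s.
rewrite -mulrBr; apply: dvMl; elim/big_ind2: _ => [|x y x' y'|i _].
- by rewrite subrr; apply: dv0.
- exact: dv_subM.
- have dj j : dv n (A i j - B i j) by move: (dAB i j); rewrite !mxE.
  exact: dj.
Qed.

Lemma simmod_det N n (A B : 'M[O]_N) :
  simmod n A B -> dv n (\det A - \det B).
Proof.
move=> /simmod_conj[g ug /dv_det]; rewrite !det_mulmx mulrAC -det_mulmx.
by rewrite mulmxV // det1 mul1r.
Qed.

Lemma simmod_tr N n (A B : 'M[O]_N) :
  simmod n A B -> dv n (\tr A - \tr B).
Proof.
move=> /simmod_conj[g ug dAB]; have := dv_sum (fun i => dAB i i).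
by rewrite -/(\tr _) raddfB /= mxtrace_mulC mulKmx.
Qed.

(** Each factor B - z moves past g up to an error divisible by pi^n, hence so does the product. For
    n = 1 this invariant separates the families of normal forms. *)
Lemma simmod_quadratic N n (A B : 'M[O]_N) x y :
  simmod n A B -> dvmx n ((A - x%:M) *m (A - y%:M)) ->
  dvmx n ((B - x%:M) *m (B - y%:M)).
Proof.
move=> [g ug dg] dA; apply: (dvmx_unitr ug).
have sg z : exists2 Z, dvmx n Z & (B - z%:M) *m g = g *m (A - z%:M) + Z.
  exists (B *m g - g *m A); first exact: dvmx_subC.
  by rewrite mulmxBl mulmxBr scalar_mxC [RHS]addrC addrA subrK.
have [Y dY] := sg y; have [X dX] := sg x.
rewrite -mulmxA => EX ->; rewrite mulmxDr mulmxA EX mulmxDl -mulmxA.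
by apply: dvmxD; [apply: dvmxD; [apply: dvmxMl|apply: dvmxMr]|apply: dvmxMl].
Qed.

End Invariants.

(** * The matrices E(m, a, b, c, d) *)

Section EForms.
Variables (O : idomainType) (pi : O).
Hypothesis hO : compact_dvr pi.
Local Notation dv := (dv pi).
Local Notation dvmx := (dvmx pi).
Local Notation simmod := (simmod pi).

(* The matrix E(m, a, b, c, d) with x in place of pi^m. *)
Definition Ex (x a b c d : O) : 'M[O]_3 := m3 d x 0 0 d 1 a b (c + d).

(* The entries of g E - E' g for g = [[p, q, r], [s, t, u], [v, w, z]],
   where y = d - d'. *)
Definition E_trans n (x a b c y x' a' b' c' p q r s t u v w z : O) : Prop :=
  [/\ dv n (p * y + r * a - x' * s), dv n (p * x + q * y + r * b - x' * t)
    & dv n (q + r * (c + y) - x' * u)] /\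
  [/\ dv n (s * y + u * a - v), dv n (s * x + t * y + u * b - w)
    & dv n (t + u * (c + y) - z)] /\
  [/\ dv n (v * y + z * a - (a' * p + b' * s + c' * v)),
      dv n (v * x + w * y + z * b - (a' * q + b' * t + c' * w))
    & dv n (w + z * (c + y) - (a' * r + b' * u + c' * z))].

Lemma E_transP n x a b c d x' a' b' c' d' p q r s t u v w z :
  dvmx n (m3 p q r s t u v w z *m Ex x a b c d -
          Ex x' a' b' c' d' *m m3 p q r s t u v w z) <->
  E_trans n x a b c (d - d') x' a' b' c' p q r s t u v w z.
Proof.
set y := d - d'; have -> : m3 p q r s t u v w z *m Ex x a b c d -
    Ex x' a' b' c' d' *m m3 p q r s t u v w z =
  m3 (p * y + r * a - x' * s) (p * x + q * y + r * b - x' * t)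
     (q + r * (c + y) - x' * u) (s * y + u * a - v)
     (s * x + t * y + u * b - w) (t + u * (c + y) - z)
     (v * y + z * a - (a' * p + b' * s + c' * v))
     (v * x + w * y + z * b - (a' * q + b' * t + c' * w))
     (w + z * (c + y) - (a' * r + b' * u + c' * z)).
  by rewrite !mul_m3 opp_m3 add_m3; congr m3; rewrite /y; ring.
exact: dvmx_m3.
Qed.

Lemma simmod_E n x a b c d x' a' b' c' d' :
  simmod n (Ex x a b c d) (Ex x' a' b' c' d') ->
  exists p q r s t u v w z, m3 p q r s t u v w z \in unitmx /\
    E_trans n x a b c (d - d') x' a' b' c' p q r s t u v w z.
Proof.
move=> [g]; rewrite (m3_eta g) => ug /E_transP dg.
by do 9!eexists; split; [exact: ug | exact: dg].
Qed.

(** Modulo pi, E is d plus a single off-diagonal 1. If y were a unit, the first three entries would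
    make the top row of g vanish modulo pi. So y = 0 there, hence q = v = w = 0 and z = t, and det g
    = p t^2. *)
Lemma E_trans_unit n x a b c y x' a' b' c' p q r s t u v w z :
  (0 < n)%N -> dv 1 x -> dv 1 a -> dv 1 b -> dv 1 c ->
  dv 1 x' -> dv 1 a' -> dv 1 b' -> dv 1 c' ->
  m3 p q r s t u v w z \in unitmx ->
  E_trans n x a b c y x' a' b' c' p q r s t u v w z ->
  [/\ dv 1 y, p \is a GRing.unit, t \is a GRing.unit,
      z \is a GRing.unit & dv 1 q].
Proof.
move=> n0 dx da db dc dx' da' db' dc' /(unitmx_dv hO); rewrite det_m3 => ndet.
move=> [[/(dvW n0) h11 /(dvW n0) h12 /(dvW n0) h13] [[/(dvW n0) h21
  /(dvW n0) h22 /(dvW n0) h23] [/(dvW n0) h31 _ _]]].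
have dpy : dv 1 (p * y).
  by dvcomb ((p * y + r * a - x' * s) - r * a + x' * s).
have dqy : dv 1 (q * y).
  by dvcomb ((p * x + q * y + r * b - x' * t) - p * x - r * b + x' * t).
have dqry : dv 1 (q + r * y).
  by dvcomb ((q + r * (c + y) - x' * u) - r * c + x' * u).
have dy : dv 1 y.
  apply: contrapT => ny; apply: ndet.
  have dp : dv 1 p by apply: (dv_prime hO _ ny); rewrite mulrC.
  have dq : dv 1 q by apply: (dv_prime hO _ ny); rewrite mulrC.
  have dr : dv 1 r.
    apply: (dv_prime hO _ ny); rewrite mulrC.
    by dvcomb (q + r * y - q).
  by auto 12 with dv.
have dq : dv 1 q by dvcomb (q + r * y - r * y).
have dv_ : dv 1 v by dvcomb (s * y + u * a - (s * y + u * a - v)).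
have dw : dv 1 w.
  by dvcomb (s * x + t * y + u * b - (s * x + t * y + u * b - w)).
have dtz : dv 1 (t - z).
  by dvcomb (t + u * (c + y) - z - u * c - u * y).
have nptt : ~ dv 1 (p * t * t).
  move=> dptt; apply: ndet.
  by dvcomb (p * t * t - p * t * (t - z) - p * u * w - q * (s * z - u * v) +
             r * (s * w - t * v)).
have up : p \is a GRing.unit.
  by apply/(unitPn hO) => dp; apply: nptt; auto with dv.
have ut : t \is a GRing.unit.
  by apply/(unitPn hO) => dt; apply: nptt; auto with dv.
by split=> //; apply: unit_cong dtz ut.
Qed.

(** Divisibility is raised by one power at a time. If pi^nu divides x, a, b and y, it divides v and
    w, and their products with x, y and c' gain a factor pi. The entries (3,1), (1,1), (3,2), (1,2)
    then yield a, y, b, x, in this order. *)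
Lemma E_trans_ideal n mu x a b c y x' a' b' c' p q r s t u v w z :
  (0 < mu <= n)%N -> dv 1 x -> dv 1 a -> dv 1 b -> dv 1 c -> dv 1 c' ->
  dv mu x' -> dv mu a' -> dv mu b' ->
  m3 p q r s t u v w z \in unitmx ->
  E_trans n x a b c y x' a' b' c' p q r s t u v w z ->
  [/\ dv mu x, dv mu a, dv mu b & dv mu y].
Proof.
move=> /andP[mu0 le_mun] dx da db dc dc' dx' da' db' ug E.
have n0 := leq_trans mu0 le_mun.
have [dy up ut uz dq] := E_trans_unit n0 dx da db dc (dvW mu0 dx')
  (dvW mu0 da') (dvW mu0 db') dc' ug E.
case: E => [[h11 h12 _] [[h21 h22 _] [h31 h32 _]]].
elim: mu mu0 le_mun dx' da' db' => // nu IHnu _ lt_nun dx' da' db'.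
have [nu0|nu0] := posnP nu; first by rewrite nu0.
have [dx1 da1 db1 dy1] : [/\ dv nu x, dv nu a, dv nu b & dv nu y].
  by apply: IHnu => //; [exact: ltnW|exact: dvW dx'|exact: dvW da'|exact: dvW db'].
have dv1 : dv nu v.
  have {}h21 := dvW (ltnW lt_nun) h21.
  by dvcomb (s * y + u * a - (s * y + u * a - v)).
have dw1 : dv nu w.
  have {}h22 := dvW (ltnW lt_nun) h22.
  by dvcomb (s * x + t * y + u * b - (s * x + t * y + u * b - w)).
have S X Y : dv 1 X -> dv nu Y -> dv nu.+1 (X * Y) by exact: dvM.
move: h11 h12 h31 h32 => /(dvW lt_nun) h11 /(dvW lt_nun) h12.
move=> /(dvW lt_nun) h31 /(dvW lt_nun) h32.
have dyv := S _ _ dy dv1; have dcv := S _ _ dc' dv1.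
have da2 : dv nu.+1 a.
  apply: (dv_unitl uz).
  by dvcomb (v * y + z * a - (a' * p + b' * s + c' * v) - y * v +
             (a' * p + b' * s + c' * v)).
have dy2 : dv nu.+1 y.
  by apply: (dv_unitl up); dvcomb (p * y + r * a - x' * s - r * a + x' * s).
have dxv := S _ _ dx dv1; have dcw := S _ _ dc' dw1.
have db2 : dv nu.+1 b.
  apply: (dv_unitl uz).
  by dvcomb (v * x + w * y + z * b - (a' * q + b' * t + c' * w) - x * v -
             w * y + (a' * q + b' * t + c' * w)).
split=> //; apply: (dv_unitl up).
by dvcomb (p * x + q * y + r * b - x' * t - q * y - r * b + x' * t).
Qed.

(** In the (3,2) entry modulo pi^(mu+1) every term but b' t vanishes: x and b do by assumption, and
    in the remaining products q, y, c' contribute a factor pi and a', w a factor pi^mu. *)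
Lemma E_trans_exact_b n mu x a b c y x' a' b' c' p q r s t u v w z :
  (0 < mu < n)%N -> dv mu.+1 x -> dv mu a -> dv mu b -> dv 1 c ->
  dv mu y -> dv 1 y -> dv mu x' -> dv mu a' -> dv mu b' -> dv 1 c' ->
  dv mu.+1 b -> m3 p q r s t u v w z \in unitmx ->
  E_trans n x a b c y x' a' b' c' p q r s t u v w z -> dv mu.+1 b'.
Proof.
move=> /andP[mu0 lt_mun] dx da db dc dy dy1 dx' da' db' dc' db1 ug E.
have [_ up ut uz dq] := E_trans_unit (ltn_trans mu0 lt_mun)
  (dvW (leqW mu0) dx) (dvW mu0 da) (dvW mu0 db) dc (dvW mu0 dx')
  (dvW mu0 da') (dvW mu0 db') dc' ug E.
case: E => [[h11 h12 _] [[h21 h22 _] [h31 h32 _]]].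
have dw1 : dv mu w.
  have {}h22 := dvW (ltnW lt_mun) h22; have {}dx := dvW (leqnSn mu) dx.
  by dvcomb (s * x + t * y + u * b - (s * x + t * y + u * b - w)).
have S X Y : dv 1 X -> dv mu Y -> dv mu.+1 (X * Y) by exact: dvM.
move: h32 => /(dvW lt_mun) h32.
have dyw := S _ _ dy1 dw1; have dcw := S _ _ dc' dw1; have dqa := S _ _ dq da'.
apply: (dv_unitl ut).
by dvcomb (v * x + y * w + z * b - q * a' - c' * w -
  (v * x + w * y + z * b - (a' * q + b' * t + c' * w))).
Qed.

End EForms.

(** * Uniqueness within the family of the matrices E *)

Section EUniqueness.
Variables (O : idomainType) (pi : O).
Hypothesis hO : compact_dvr pi.
Local Notation dv := (dv pi).
Local Notation dvmx := (dvmx pi).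
Local Notation simmod := (simmod pi).

Variable rep : nat -> O -> Prop.
Hypothesis rep_inj : forall i x y, rep i x -> rep i y -> dv i (x - y) -> x = y.

(** One description of all five subcases, in which pi^mu generates the ideal of pi^m, a, b and pi^n.
    Subcase (I) is mu = n; m = mu < n covers (II), (III_1) and (III_0); the second alternative of
    [E_cases] is (III_oo). *)
Record E_normal n mu m (a b c d : O) : Prop := ENormal {
  E_mu : (0 < mu <= n)%N;
  E_m : (mu <= m <= n)%N;
  E_a : dv mu a;
  E_b : dv mu b;
  E_c : dv 1 c;
  E_d : (mu < n)%N -> rep mu d;
  E_exact : (mu < n)%N -> ~ [/\ dv mu.+1 (pi ^+ m), dv mu.+1 a & dv mu.+1 b];
  E_cases : m = mu \/
    [/\ (mu < m)%N, rep (n - m + mu) a, ~ dv mu.+1 a & dv mu.+1 b] }.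

Lemma E_normal_mu n mu m a b c d mu' m' a' b' c' d' :
  E_normal n mu m a b c d -> E_normal n mu' m' a' b' c' d' ->
  simmod n (Ex (pi ^+ m) a b c d) (Ex (pi ^+ m') a' b' c' d') ->
  (mu' <= mu)%N /\ dv mu' (d - d').
Proof.
move=> [Hmu Hm Ha Hb Hc _ Hex _] [Hmu' Hm' Ha' Hb' Hc' _ _ _].
move=> /simmod_E[p [q [r [s [t [u [v [w [z [ug E]]]]]]]]]].
have m0 : (0 < m)%N by lia.
have m0' : (mu' <= m')%N by lia.
have mu0 : (0 < mu)%N by lia.
have [dx da db dy] := E_trans_ideal hO Hmu' (dvXle pi m0) (dvW mu0 Ha)
  (dvW mu0 Hb) Hc Hc' (dvXle pi m0') Ha' Hb' ug E.
split=> //; rewrite leqNgt; apply/negP => lt_mu; apply: Hex; first lia.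
by split; apply: dvW lt_mu _.
Qed.

(** After subtraction of the common d the characteristic polynomial is t^3 - c t^2 - b t - x a. The
    trace gives c and the determinant x a; the determinant after a further shift by -1, which is the
    value at t = 1 up to sign, then gives b. *)
Lemma simmod_E_char n x a b c d x' a' b' c' :
  simmod n (Ex x a b c d) (Ex x' a' b' c' d) ->
  dv n (c - c') /\ dv n (b - b').
Proof.
move=> /(simmod_shift (- d)) sN; have := simmod_tr sN.
rewrite !scalar_m3 !add_m3 !tr_m3 => /dv_eq dc.
have {}dc : dv n (c - c') by apply: dc; ring.
split=> //; have := simmod_det sN; rewrite !scalar_m3 !add_m3 !det_m3.
set e1 := (X in dv n X) => de1.
have := simmod_det (simmod_shift (- 1) sN).
rewrite !scalar_m3 !add_m3 !det_m3; set e2 := (X in dv n X) => de2.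
have -> : b - b' = e2 - e1 - (c - c') by rewrite /e1 /e2; ring.
by auto with dv.
Qed.

(** The entries (1,3), (2,1), (2,2), (2,3) determine q, v, w, z. This leaves three congruences in p,
    r, s, t, in which c no longer occurs. For equal matrices they describe the centraliser. *)
Lemma simmod_E_same_d n x a b c x' a' b' c' d :
  (0 < n)%N -> dv 1 x -> dv 1 a -> dv 1 b -> dv 1 c ->
  dv 1 x' -> dv 1 a' -> dv 1 b' -> dv 1 c' ->
  simmod n (Ex x a b c d) (Ex x' a' b' c' d) ->
  exists p r s t, [/\ p \is a GRing.unit, t \is a GRing.unit &
    [/\ dv n (b - b'), dv n (r * a - x' * s), dv n (p * x + r * b - x' * t) &
    dv n (t * a - a' * p - b * s)]].
Proof.
move=> n0 dx da db dc dx' da' db' dc' sE; have [dcc dbb] := simmod_E_char sE.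
move: sE => /simmod_E[p [q [r [s [t [u [v [w [z [ug E]]]]]]]]]].
have [_ up ut _ _] := E_trans_unit hO n0 dx da db dc dx' da' db' dc' ug E.
move: E; rewrite /E_trans subrr => -[[h11 h12 _] [[h21 _ h23] [h31 _ _]]].
exists p, r, s, t; do !split => //.
- by dvcomb (p * 0 + r * a - x' * s).
- by dvcomb (p * x + q * 0 + r * b - x' * t).
- by dvcomb ((v * 0 + z * a - (a' * p + b' * s + c' * v)) +
    (t + u * (c + 0) - z) * a - c' * (s * 0 + u * a - v) - u * a * (c - c') -
    (b - b') * s).
Qed.

(** Write a = x al and b = x be with x = pi^mu. The third congruence plus al times the second minus
    be times the first no longer contains r, s, t. *)
Lemma simmod_E_finite n mu a b c a' b' c' d :
  (0 < mu <= n)%N -> dv mu a -> dv mu b -> dv 1 c ->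
  dv mu a' -> dv mu b' -> dv 1 c' ->
  simmod n (Ex (pi ^+ mu) a b c d) (Ex (pi ^+ mu) a' b' c' d) -> dv n (a - a').
Proof.
move=> /andP[mu0 le_mun] da db dc da' db' dc' sE.
have dx := dvXle pi mu0.
have [] := simmod_E_same_d (leq_trans mu0 le_mun) dx (dvW mu0 da) (dvW mu0 db)
  dc dx (dvW mu0 da') (dvW mu0 db') dc' sE.
case: da => al aE; case: db => be bE.
move=> p [r [s [t [up _ [_ h11 h12 h31]]]]].
apply: (dv_unitl up).
have -> : p * (a - a') = (t * a - a' * p - b * s) +
  al * (p * pi ^+ mu + r * b - pi ^+ mu * t) - be * (r * a - pi ^+ mu * s).
  by rewrite aE bE; ring.
by auto with dv.
Qed.

(** Since b and b' are congruent, pi^(mu+1) divides b. Then the congruence for p x + r b - x' t puts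
    p pi^mu into (pi^(mu+1)), although p is a unit. *)
Lemma simmod_E_mixed n mu m a b c a' b' c' d :
  (0 < mu < n)%N -> (mu < m)%N -> dv mu a -> dv mu b -> dv 1 c ->
  dv mu a' -> dv mu.+1 b' -> dv 1 c' ->
  ~ simmod n (Ex (pi ^+ mu) a b c d) (Ex (pi ^+ m) a' b' c' d).
Proof.
move=> /andP[mu0 lt_mun] lt_mum da db dc da' db' dc' sE.
have n0 := ltn_trans mu0 lt_mun.
have [p [r [s [t [up _ [dbb _ h12 _]]]]]] := simmod_E_same_d n0
  (dvXle pi mu0) (dvW mu0 da) (dvW mu0 db) dc
  (dvXle pi (ltn_trans mu0 lt_mum)) (dvW mu0 da') (dvW (leqW mu0) db') dc' sE.
have {}db := dv_trans (dvW lt_mun dbb) db'.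
apply: (exact_ndv hO (m := mu) up); rewrite mulrC.
have {}h12 := dvW lt_mun h12; have dm := dvXle pi lt_mum.
by dvcomb (p * pi ^+ mu + r * b - pi ^+ m * t - r * b + pi ^+ m * t).
Qed.

(** Eliminating r gives pi^m al p = pi^m' (al t - pi be s) modulo pi^n with units al and p, whence m
    = m'. Cancelling pi^m leaves a congruence modulo pi^(n-m); multiplied by pi^mu, it fixes a
    modulo pi^(n-m+mu), the precision at which (III_oo) chooses its representative a. *)
Lemma simmod_E_infinite n mu m m' a b c a' b' c' d :
  (0 < mu < n)%N -> (mu < m <= n)%N -> (m <= m' <= n)%N ->
  dv mu a -> ~ dv mu.+1 a -> dv mu.+1 b -> dv 1 c ->
  dv mu a' -> dv mu.+1 b' -> dv 1 c' ->
  simmod n (Ex (pi ^+ m) a b c d) (Ex (pi ^+ m') a' b' c' d) ->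
  m = m' /\ dv (n - m + mu) (a - a').
Proof.
move=> /andP[mu0 lt_mun] /andP[lt_mum le_mn] /andP[le_mm' le_m'n].
move=> da nda db dc da' db' dc' sE.
have m0 : (0 < m)%N by lia.
have m'0 : (0 < m')%N by lia.
have [] := simmod_E_same_d (leq_trans m0 le_mn) (dvXle pi m0) (dvW mu0 da)
  (dvW (leqW mu0) db) dc (dvXle pi m'0) (dvW mu0 da') (dvW (leqW mu0) db')
  dc' sE.
have [al ual aE] := exact_dv hO da nda; case: db => be; rewrite exprSr => bE.
move=> p [r [s [t [up ut [_ h11 h12 h31]]]]].
have K : dv n (pi ^+ m * (al * p) - pi ^+ m' * (al * t - pi * be * s)).
  have -> : pi ^+ m * (al * p) - pi ^+ m' * (al * t - pi * be * s) =
    al * (p * pi ^+ m + r * b - pi ^+ m' * t) -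
    pi * be * (r * a - pi ^+ m' * s) by rewrite aE bE; ring.
  by auto with dv.
have eq_mm' : m = m'.
  apply/eqP; rewrite eqn_leq le_mm' leqNgt; apply/negP => lt_mm'.
  have uap : al * p \is a GRing.unit by rewrite unitrM ual.
  apply: (exact_ndv hO (m := m) uap).
  apply: dv_trans (dvW _ K) (dvMr _ (dvXle pi lt_mm')); lia.
split=> //; rewrite -eq_mm' -mulrBr in K.
have {}K := dv_canc hO le_mn K.
have {}K := dvM K (dvX pi mu).
have {}h31 : dv (n - m + mu) (t * a - a' * p - b * s) by apply: dvW h31; lia.
apply: (dv_unitl up).
have -> : p * (a - a') = (t * a - a' * p - b * s) +
   (al * p - (al * t - pi * be * s)) * pi ^+ mu by rewrite aE bE; ring.
by auto with dv.
Qed.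

Lemma E_normal_uniq n mu m a b c d mu' m' a' b' c' d' :
  E_normal n mu m a b c d -> E_normal n mu' m' a' b' c' d' ->
  simmod n (Ex (pi ^+ m) a b c d) (Ex (pi ^+ m') a' b' c' d') ->
  dvmx n (Ex (pi ^+ m) a b c d - Ex (pi ^+ m') a' b' c' d').
Proof.
move=> N N' sEE'; have sE'E := simmod_sym sEE'.
have [le1 dd] := E_normal_mu N N' sEE'.
have [le2 _] := E_normal_mu N' N sE'E.
have eq_mu : mu' = mu by lia.
rewrite {}eq_mu in N' dd *; move=> {le1 le2}.
suff [dd' [dm da]] : dv n (d - d') /\ dv n (pi ^+ m - pi ^+ m') /\ dv n (a - a').
  have sd : simmod n (Ex (pi ^+ m) a b c d) (Ex (pi ^+ m') a' b' c' d).
    apply: simmod_trans sEE' _; apply: simmod_cong.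
    rewrite opp_m3 add_m3 !subrr; apply/dvmx_m3; (do !split); try exact: dv0.
    - exact: dv_subC.
    - exact: dv_subC.
    - by dvcomb (- (d - d')).
  have [dc db] := simmod_E_char sd.
  rewrite opp_m3 add_m3 !subrr; apply/dvmx_m3; (do !split) => //; try exact: dv0.
  by dvcomb ((c - c') + (d - d')).
have [/andP[mu0 _] _ _ _ _ _ _ _] := N.
(* For mu = n the entries x, a, b vanish modulo pi^n and d is known to full precision. For mu < n
   the two scalars are representatives of the same class, hence equal. *)
have [lt_mun|le_nmu] := ltnP mu n; last first.
  have [/andP[_ Hmu] _ Ha _ _ _ _ _] := N.
  have [_ Hm' Ha' _ _ _ _ _] := N'.
  have [_ Hm _ _ _ _ _ _] := N.
  split; [exact: dvW dd|split].
    by apply: dvB; apply: dvXle; lia.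
  by apply: dvB; [apply: dvW Ha|apply: dvW Ha'].
have eq_d : d = d'.
  have [_ _ _ _ _ /(_ lt_mun) rd _ _] := N.
  have [_ _ _ _ _ /(_ lt_mun) rd' _ _] := N'.
  exact: rep_inj dd.
rewrite -{}eq_d {dd d'} in N' sEE' sE'E *.
split; first by rewrite subrr; apply: dv0.
have Xd k : dv n (pi ^+ k - pi ^+ k) by rewrite subrr; apply: dv0.
case: N => [Hmu Hm Ha Hb Hc _ Hex HC]; case: N' => [_ Hm' Ha' Hb' Hc' _ Hex' HC'].
have Hmun : (0 < mu < n)%N by rewrite mu0.
case: HC => [Em|[lt_m ra nda db]]; case: HC' => [Em'|[lt_m' ra' nda' db']].
- by subst m m'; split=> //; apply: simmod_E_finite sEE'.
- by subst m; case: (simmod_E_mixed _ _ _ _ _ _ _ _ sEE').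
- by subst m'; case: (simmod_E_mixed _ _ _ _ _ _ _ _ sE'E).
have {}Hm : (mu < m <= n)%N by lia.
have {}Hm' : (mu < m' <= n)%N by lia.
have [le_mm'|/ltnW le_m'm] := leqP m m'.
  have Hmm' : (m <= m' <= n)%N by lia.
  have [Em da] := simmod_E_infinite Hmun Hm Hmm' Ha nda db Hc Ha' db' Hc' sEE'.
  by subst m'; rewrite (rep_inj ra ra' da) !subrr; split; apply: dv0.
have Hmm' : (m' <= m <= n)%N by lia.
have [Em da] := simmod_E_infinite Hmun Hm' Hmm' Ha' nda' db' Hc' Ha db Hc sE'E.
by subst m'; rewrite (rep_inj ra' ra da) !subrr; split; apply: dv0.
Qed.

End EUniqueness.

(** * Existence within the family of the matrices E *)

Section EExistence.
Variables (O : idomainType) (pi : O).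
Hypothesis hO : compact_dvr pi.
Local Notation dv := (dv pi).
Local Notation dvmx := (dvmx pi).
Local Notation simmod := (simmod pi).

Lemma E_trans_sim n x a b c d d' x' a' b' c' p q r s t u v w z :
  m3 p q r s t u v w z \in unitmx ->
  E_trans pi n x a b c (d - d') x' a' b' c' p q r s t u v w z ->
  simmod n (Ex x a b c d) (Ex x' a' b' c' d').
Proof. by move=> ug /E_transP ?; exists (m3 p q r s t u v w z). Qed.

(* For N = E - d acting on row vectors, any basis with e1 (N + y) = x' e2 and
   e3 = e2 (N + y) brings E to the same shape, with d - y in place of d. *)
Lemma E_rebase n x a b c y x' p q r s t u :
  (0 < n)%N -> dv 1 x -> dv 1 a -> dv 1 b -> dv 1 c -> dv 1 x' -> dv 1 y ->
  p \is a GRing.unit -> t \is a GRing.unit ->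
  dv n (p * y + r * a - x' * s) -> dv n (p * x + q * y + r * b - x' * t) ->
  dv n (q + r * (c + y) - x' * u) ->
  exists a' b' c' v w z, [/\ dv 1 a', dv 1 b' & dv 1 c'] /\
    m3 p q r s t u v w z \in unitmx /\
    E_trans pi n x a b c y x' a' b' c' p q r s t u v w z.
Proof.
move=> n0 dx da db dc dx' dy up ut h11 h12 h13.
have dq : dv 1 q.
  have {}h13 := dvW n0 h13.
  by dvcomb (q + r * (c + y) - x' * u - r * (c + y) + x' * u).
pose v := s * y + u * a; pose w := s * x + t * y + u * b.
pose z := t + u * (c + y).
have ug : m3 p q r s t u v w z \in unitmx.
  rewrite unitmxE det_m3; apply: (unit_cong hO (u := p * t * t)).
    by rewrite /v /w /z; dvcomb (- p * t * u * (c + y) +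
      p * u * (s * x + t * y + u * b) +
      q * (s * (t + u * (c + y)) - u * (s * y + u * a)) -
      r * s * (s * x + t * y + u * b) + r * t * (s * y + u * a)).
  by rewrite !unitrM up ut.
set g := m3 _ _ _ _ _ _ _ _ _ in ug.
pose M := g *m Ex x a b c y *m invmx g.
have MgE : M *m g = g *m Ex x a b c y by rewrite mulmxKV.
pose a' := M 2%:R 0; pose b' := M 2%:R 1; pose c' := M 2%:R 2%:R.
have [e31 e32 e33] : [/\ a' * p + b' * s + c' * v = v * y + z * a,
    a' * q + b' * t + c' * w = v * x + w * y + z * b &
    a' * r + b' * u + c' * z = w + z * (c + y)].
  move: MgE; rewrite (m3_eta M) !mul_m3 => /m3_inj[_ [_ [-> -> ->]]].
  by split; ring.
have E : E_trans pi n x a b c y x' a' b' c' p q r s t u v w z.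
  split; first by split.
  rewrite e31 e32 e33 /v /w /z.
  by do !split; rewrite subrr; apply: dv0.
exists a', b', c', v, w, z; split=> //.
have sE : simmod n (Ex x a b c y) (Ex x' a' b' c' 0).
  by apply: E_trans_sim ug _; rewrite subr0.
(* E has square zero modulo pi, and the second row of the square of the new matrix is its third row
   (a', b', c'). This gives the divisibility of the new entries. *)
have sq : dvmx 1 ((Ex x a b c y - 0%:M) *m (Ex x a b c y - 0%:M)).
  rewrite raddf0 !subr0 mul_m3; apply/dvmx_m3.
  rewrite !(mulr0, mul0r, addr0, add0r, mulr1, mul1r).
  by do !split; auto 12 with dv.
move: (simmod_quadratic (simmodW n0 sE) sq).
rewrite raddf0 !subr0 mul_m3 => /dvmx_m3[_ [[da' db' dc'] _]].
split.
- by dvcomb (0 * 0 + 0 * 0 + 1 * a').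
- by dvcomb (0 * x' + 0 * 0 + 1 * b').
- by dvcomb (0 * 0 + 0 * 1 + 1 * (c' + 0)).
Qed.

Lemma simmod_E_ideal n mu x a b c d x' a' b' c' d' :
  (0 < mu <= n)%N -> dv 1 x' -> dv 1 a' -> dv 1 b' -> dv 1 c' -> dv 1 c ->
  simmod n (Ex x a b c d) (Ex x' a' b' c' d') ->
  dv mu x -> dv mu a -> dv mu b -> [/\ dv mu x', dv mu a' & dv mu b'].
Proof.
move=> Hmu dx' da' db' dc' dc /simmod_sym/simmod_E.
move=> [p [q [r [s [t [u [v [w [z [ug E]]]]]]]]]] dx da db.
by have [] := E_trans_ideal hO Hmu dx' da' db' dc' dc dx da db ug E.
Qed.

Variable rep : nat -> O -> Prop.
Hypothesis rep_ex : forall i x, exists2 y, rep i y & dv i (x - y).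
Hypothesis rep_zero : forall i x, rep i x -> dv i x -> x = pi ^+ i.
Local Notation E_normal := (E_normal pi rep).

Definition E_normalizable n (x a b c d : O) : Prop :=
  exists mu m a' b' c' d', E_normal n mu m a' b' c' d' /\
    simmod n (Ex x a b c d) (Ex (pi ^+ m) a' b' c' d').

Lemma E_normalizable_trans n x a b c d x' a' b' c' d' :
  simmod n (Ex x a b c d) (Ex x' a' b' c' d') ->
  E_normalizable n x' a' b' c' d' -> E_normalizable n x a b c d.
Proof.
move=> sE [mu [m [a1 [b1 [c1 [d1 [N sE1]]]]]]].
by exists mu, m, a1, b1, c1, d1; split=> //; apply: simmod_trans sE sE1.
Qed.

(** Only d has to be replaced by its representative d0. With N = E - d and d - d0 = pi^mu s one has
    e1 (N + d - d0) = pi^mu (e2 + s e1), so taking e2 + s e1 as second vector leaves x unchanged. *)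
Lemma E_normalizable_finite n mu a b c d :
  (0 < mu <= n)%N -> dv mu a -> dv mu b -> dv 1 c ->
  E_normalizable n (pi ^+ mu) a b c d.
Proof.
move=> Hmu da db dc; have [mu0 le_mun] := andP Hmu.
have n0 := leq_trans mu0 le_mun; have dx := dvXle pi mu0.
have [d0 rd0 [s ds]] := rep_ex mu d.
have dy : dv 1 (d - d0) by rewrite ds; auto with dv.
have u1 := unitr1 O.
have z0 y : y = 0 -> dv n y by move->; apply: dv0.
have h11 : dv n (1 * (d - d0) + 0 * a - pi ^+ mu * s) by apply: z0; rewrite ds; ring.
have h12 : dv n (1 * pi ^+ mu + 0 * (d - d0) + 0 * b - pi ^+ mu * 1).
  by apply: z0; ring.
have h13 : dv n (0 + 0 * (c + (d - d0)) - pi ^+ mu * 0) by apply: z0; ring.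
have [a' [b' [c' [v [w [z [[da' db' dc'] [ug E]]]]]]]] :=
  E_rebase n0 dx (dvW mu0 da) (dvW mu0 db) dc dx dy u1 u1 h11 h12 h13.
have sE := E_trans_sim ug E.
have [_ {}da' {}db'] := simmod_E_ideal Hmu dx da' db' dc' dc sE (dvX pi mu) da db.
exists mu, mu, a', b', c', d0; split=> //; split=> //; try lia.
move=> _ []; rewrite -[pi ^+ mu]mulr1.
by move=> /(exact_ndv hO (unitr1 O)).
Qed.

(** The matrix diag(1, t, t) multiplies a by t and x by 1/t, and the assumption on t makes the
    second change invisible modulo pi^n. *)
Lemma simmod_E_scale n m a b c d t :
  t \is a GRing.unit -> dv n (pi ^+ m * (t - 1)) ->
  simmod n (Ex (pi ^+ m) a b c d) (Ex (pi ^+ m) (t * a) b c d).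
Proof.
move=> ut dt; apply: (E_trans_sim (p := 1) (q := 0) (r := 0) (s := 0) (t := t)
  (u := 0) (v := 0) (w := 0) (z := t)).
  by rewrite unitmxE det_m3 !(mulr0, mul0r, mul1r, subr0, addr0) unitrM ut.
rewrite /E_trans subrr.
have z0 y : y = 0 -> dv n y by move->; apply: dv0.
do !split; try by apply: z0; ring.
by dvcomb (- (pi ^+ m * (t - 1))).
Qed.

Lemma E_normalizable_infinite n mu m a b c d :
  (0 < mu < n)%N -> (mu < m <= n)%N -> dv mu a -> ~ dv mu.+1 a ->
  dv mu.+1 b -> dv 1 c -> rep mu d -> E_normalizable n (pi ^+ m) a b c d.
Proof.
move=> Hmu Hm da nda db dc rd; have [al ual aE] := exact_dv hO da nda.
have [a0 ra0 [e ae]] := rep_ex (n - m + mu) a.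
pose al0 := al - pi ^+ (n - m) * e.
have a0E : a0 = pi ^+ mu * al0.
  by rewrite -(subKr a a0) ae aE /al0 exprD; ring.
have ual0 : al0 \is a GRing.unit.
  have [Hmn|Hmn] := ltnP m n.
    apply: (unitDdv hO) => //; apply/dvN/dvMr/dvXle; lia.
  (* For m = n, a0 represents the class of 0 modulo pi^mu, and the convention on representatives of
     0 gives a0 = pi^mu, that is al0 = 1. *)
  have E0 : (n - m + mu)%N = mu by lia.
  have := @rep_zero mu a0; rewrite -{1}E0 => /(_ ra0); rewrite a0E.
  move=> /(_ (dvMr _ (dvX pi mu))); rewrite -[RHS]mulr1.
  by move=> /(mulfI (piX_neq0 hO mu)) ->; apply: unitr1.
(* Since a and a0 agree modulo pi^(n-m+mu), t is 1 modulo pi^(n-m), so the rescaling that turns a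
   into a0 does not affect pi^m. *)
pose t := al0 / al; have ut : t \is a GRing.unit by rewrite unitrM unitrV ual0.
have ta : t * a = a0 by rewrite a0E aE /t mulrCA divrK.
have dt : dv n (pi ^+ m * (t - 1)).
  have -> : t - 1 = - (pi ^+ (n - m) * (e / al)).
    by rewrite -(divrr ual) /t -mulrBl /al0 addrAC subrr add0r mulNr mulrA.
  rewrite mulrN [pi ^+ m * _]mulrA -exprD; apply/dvN/dvMr/dvXle; lia.
exists mu, m, a0, b, c, d; split; last by rewrite -ta; apply: simmod_E_scale.
have nda0 : ~ dv mu.+1 a0 by rewrite a0E; apply: exact_ndv.
split=> //; try lia.
- by rewrite a0E; apply/dvMr/dvX.
- exact: dvW db.
- by move=> _ [].
- by right; split=> //; lia.
Qed.

(** The unit factor of x can be moved into the second basis vector, so x = pi^m may be assumed. Let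
    pi^mu be the largest power dividing x, a, b up to the precision. If b attains it but x does not,
    x can be turned into pi^mu; if a alone attains it, the new exponent m stays above mu. *)
Lemma E_normalizableP n x a b c d :
  (0 < n)%N -> dv 1 x -> dv 1 a -> dv 1 b -> dv 1 c ->
  E_normalizable n x a b c d.
Proof.
move=> n0; have z0 y : y = 0 -> dv n y by move->; apply: dv0.
have u1 := unitr1 O.
suff pow m a1 b1 c1 d1 : (0 < m <= n)%N -> dv 1 a1 -> dv 1 b1 -> dv 1 c1 ->
    E_normalizable n (pi ^+ m) a1 b1 c1 d1.
  move=> dx da db dc; have [m [t [le_mn ut xE]]] := trunc_val hO n x.
  have m0 : (0 < m)%N.
    rewrite lt0n; apply/eqP => m0; rewrite m0 mul1r in xE.
    by move/(unitPn hO): ut; apply; apply: dv_transr (dvW n0 xE) dx.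
  have [] := E_rebase (y := 0) (q := 0) (r := 0) (s := 0) (u := 0) n0 dx da db
    dc (dvXle pi m0) (dv0 _ _) u1 ut.
  - by apply: z0; ring.
  - by dvcomb (x - pi ^+ m * t).
  - by apply: z0; ring.
  move=> a' [b' [c' [v [w [z [[da' db' dc'] [ug E]]]]]]].
  apply: (E_normalizable_trans (x' := pi ^+ m) (a' := a') (b' := b') (c' := c')
    (d' := d)); last by apply: pow; rewrite ?m0.
  by apply: E_trans_sim ug _; rewrite subrr.
move=> {x a b c d} Hm; move: a1 b1 c1 d1 => a b c d da db dc.
have [mu [le_mun Pmu nPmu]] := dv_max (P := fun i =>
  [/\ (i <= m)%N, dv i a & dv i b]) n (And3 (leq0n m) (dv_0 pi a) (dv_0 pi b)).
have mu0 : (0 < mu)%N.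
  rewrite lt0n; apply/eqP => mu0; rewrite mu0 in nPmu.
  by apply: nPmu => //; split=> //; lia.
case: Pmu => le_mum dmua dmub.
have [E|/eqP ne_mum] := eqVneq mu m.
  by rewrite -E; apply: E_normalizable_finite; rewrite // mu0.
have lt_mum : (mu < m)%N by lia.
have lt_mun : (mu < n)%N by lia.
have Hmu : (0 < mu <= n)%N by rewrite mu0.
have dx := dvXle pi (leq_trans mu0 le_mum).
have [dmub1|ndmub1] := pselect (dv mu.+1 b); last first.
  have [be ube bE] := exact_dv hO dmub ndmub1; case: (dmua) => s aE.
  (* With N = E - d, (e1 - c e2 + e3) N = (a, x + b, 0). This is pi^mu times a vector whose second
     entry is a unit, because b attains mu and x does not. *)
  have ut : be + pi ^+ (m - mu) \is a GRing.unit.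
    by apply: (unitDdv hO) => //; apply: dvXle; lia.
  have [] := E_rebase (y := 0) (q := - c) (r := 1) (s := s) (u := 0) n0 dx
    da db dc (dvXle pi mu0) (dv0 _ _) u1 ut.
  - by apply: z0; rewrite aE; ring.
  - apply: z0; rewrite bE -(subnKC le_mum) exprD addKn; ring.
  - by apply: z0; ring.
  move=> a' [b' [c' [v [w [z [[da' db' dc'] [ug E]]]]]]].
  have sE : simmod n (Ex (pi ^+ m) a b c d) (Ex (pi ^+ mu) a' b' c' d).
    by apply: E_trans_sim ug _; rewrite subrr.
  apply: (E_normalizable_trans sE).
  have [_ {}da' {}db'] := simmod_E_ideal Hmu (dvXle pi mu0) da' db' dc' dc sE
    (dvXle pi le_mum) dmua dmub.
  exact: E_normalizable_finite.
have nda : ~ dv mu.+1 a by move=> da1; apply: nPmu => //; split.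
have [al ual aE] := exact_dv hO dmua nda.
have [d0 rd0 [e de]] := rep_ex mu d.
have dmuy : dv mu (d - d0) by rewrite de; auto with dv.
have dy := dvW mu0 dmuy.
(* With y = d - d0, [r] gives y + r a = 0 and [q] gives q + r (c + y) = 0, so that the new first
   vector is mapped to a multiple of e2. The factor is the new x; it stays in (pi^(mu+1)). *)
pose r := - (e / al); pose q := - (c + (d - d0)) * r.
have dy1 : dv mu.+1 (pi ^+ m * 1 + q * (d - d0) + r * b).
  have dq : dv 1 q by rewrite /q; auto with dv.
  have := dvM dq dmuy; have := dvXle pi lt_mum.
  by auto with dv.
have [m' [t [le_m'n ut tE]]] := trunc_val hO n (pi ^+ m * 1 + q * (d - d0) + r * b).
have lt_mum' : (mu < m')%N.
  rewrite ltnNge; apply/negP => le_m'mu.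
  by apply: (unit_dv hO _ ut (n := mu.+1 - m')); [lia|];
    apply: (dv_canc hO); [lia|]; apply: dv_transr (dvW lt_mun tE) dy1.
have dx' := dvXle pi (leq_trans mu0 (ltnW lt_mum')).
have [] := E_rebase (p := 1) (q := q) (r := r) (s := 0) (u := 0) n0 dx da db dc dx' dy
   u1 ut.
- apply: z0; transitivity (pi ^+ mu * (e - e / al * al)).
    by rewrite /r de aE; ring.
  by rewrite divrK // subrr mulr0.
- by dvcomb (pi ^+ m * 1 + q * (d - d0) + r * b - pi ^+ m' * t).
- by apply: z0; rewrite /q; ring.
move=> a' [b' [c' [v [w [z [[da' db' dc'] [ug E]]]]]]].
have sE := E_trans_sim ug E; apply: (E_normalizable_trans sE).
have [_ da1 db1] := simmod_E_ideal Hmu dx' da' db' dc' dc sE (dvXle pi le_mum)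
  dmua dmub.
have Hmu' : (0 < mu < n)%N by rewrite mu0.
have db2 := E_trans_exact_b hO Hmu' (dvXle pi lt_mum) dmua dmub dc dmuy dy
  (dvXle pi (ltnW lt_mum')) da1 db1 dc' dmub1 ug E.
apply: (E_normalizable_infinite Hmu') => //; first by rewrite lt_mum'.
(* If pi^(mu+1) divided the new a as well, it would divide the whole new ideal and therefore the old
   a. *)
move=> da2; apply: nda.
have Hmu2 : (0 < mu.+1 <= n)%N by [].
by have [] := simmod_E_ideal Hmu2 dx da db dc dc' (simmod_sym sE)
  (dvXle pi lt_mum') da2 db2.
Qed.

End EExistence.

Lemma map_companion (R S : pzRingType) (f : {rmorphism R -> S}) N (c : 'I_N -> R) :
  map_mx f (companion c) = companion (f \o c).
Proof.
apply/matrixP => i j; rewrite !mxE; case: ifP => _; first by rewrite rmorphN.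
by rewrite rmorph_nat.
Qed.

(** * Companion matrices and Hensel splitting *)

Section Companion.
Variable R : comUnitRingType.

Lemma companion3E (c : 'I_3 -> R) :
  companion c = m3 0 0 (- c 0) 1 0 (- c 1) 0 1 (- c 2%:R).
Proof. by apply: mx3P; rewrite !mxE. Qed.

Lemma companion2E (c : 'I_2 -> R) : companion c = m2 0 (- c 0) 1 (- c 1).
Proof. by apply: mx2P; rewrite !mxE. Qed.

(** In the basis of the columns of g each basis vector is sent to the next one, so only the last
    column is free. *)
Lemma cyclic_companion n (A g : 'M[R]_n.+1) :
  g \in unitmx ->
  (forall i j : 'I_n.+1, j = i.+1 :> nat -> A *m col i g = col j g) ->
  is_companion (invmx g *m A *m g).
Proof.
move=> ug Ag; exists (fun i => - (invmx g *m A *m g) i ord_max).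
apply/matrixP => i j; rewrite [RHS]mxE; case: eqP => [[jn]|njn].
  by rewrite opprK; congr (_ i _); apply: val_inj.
have lt_jn : (j.+1 < n.+1)%N by rewrite ltn_neqAle ltn_ord andbT; apply/eqP.
have -> : (invmx g *m A *m g) i j = (invmx g *m col (Ordinal lt_jn) g) i 0.
  rewrite -(Ag j) // mulmxA colE mulmxA -[in RHS]colE [RHS]mxE.
  by [].
by rewrite colE mulKmx // mxE eqxx andbT.
Qed.

End Companion.

Section Reduction.
Variables (O : idomainType) (pi : O).
Hypothesis hO : compact_dvr pi.
Local Notation dv := (dv pi).
Local Notation dvmx := (dvmx pi).
Local Notation simmod := (simmod pi).

Lemma cyclic_simmod N n (A g : 'M[O]_N.+1) :
  g \in unitmx ->
  (forall i j : 'I_N.+1, j = i.+1 :> nat -> A *m col i g = col j g) ->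
  exists2 C, is_companion C & simmod n A C.
Proof.
move=> ug /(cyclic_companion ug); exists (invmx g *m A *m g) => //.
apply: (@simmod_eq _ _ _ n (invmx g)); first by rewrite unitmx_inv.
by rewrite mulmxK.
Qed.

(** The hypothesis expresses a cyclic vector by entries: A g is g shifted one column to the left,
    with a free last column. *)
Lemma cyclic3_simmod n (A : 'M[O]_3) a b c d e f g h i x y z :
  m3 a b c d e f g h i \in unitmx ->
  A *m m3 a b c d e f g h i = m3 b c x e f y h i z ->
  exists2 C, is_companion C & simmod n A C.
Proof.
move=> ug E; apply: (cyclic_simmod n ug) => i1 j Ej.
have -> : A *m col i1 (m3 a b c d e f g h i) =
    col i1 (A *m m3 a b c d e f g h i) by rewrite !colE mulmxA.
rewrite E; apply/colP => m; rewrite !mxE Ej.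
by move: i1 Ej m; apply: ord3P => Ej; apply: ord3P => //=;
  move: Ej (ltn_ord j) => ->.
Qed.

(** The cyclic vectors are e3, e1 and e1 + e3. The determinants of w, E w, E^2 w are -x, -a^2 and,
    when pi divides x and a, b modulo pi. *)
Lemma E_cyclic n x a b c d :
  x \is a GRing.unit \/ a \is a GRing.unit \/ b \is a GRing.unit ->
  exists2 C, is_companion C & simmod n (Ex x a b c d) C.
Proof.
have [ux _|/(not_unit hO) dx] := pselect (x \is a GRing.unit).
  apply: (@cyclic3_simmod n _ 0 0 x 0 1 (d + (c + d)) 1 (c + d) (b + (c + d) ^+ 2)
    _ _ _).
    rewrite unitmxE det_m3 (_ : _ + _ = - x); last by ring.
    by rewrite unitrN.
  by rewrite mul_m3; congr m3; first [by ring | reflexivity].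
have [ua _|/(not_unit hO) da] := pselect (a \is a GRing.unit).
  apply: (@cyclic3_simmod n _ 1 d (d ^+ 2) 0 0 a 0 a (a * d + (c + d) * a)
    _ _ _).
    rewrite unitmxE det_m3 (_ : _ + _ = - (a * a)); last by ring.
    by rewrite unitrN unitrM ua.
  by rewrite mul_m3; congr m3; first [by ring | reflexivity].
move=> [/(unitPn hO)//|[/(unitPn hO)//|ub]].
apply: (@cyclic3_simmod n _ 1 d (d ^+ 2 + x) 0 1 (d + a + c + d) 1 (a + c + d)
  (a * d + b + (c + d) * (a + c + d)) _ _ _).
  rewrite unitmxE det_m3; apply: (unit_cong hO _ ub).
  by dvcomb (a * (a + c) + x).
by rewrite mul_m3; congr m3; first [by ring | reflexivity].
Qed.

(** The vector e1 is cyclic if c is a unit, e2 if b is one. If neither is, e1 + e2 has determinant d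
    - a modulo pi, a unit because the matrix is not scalar there. *)
Lemma nonscalar2_companion n (A : 'M[O]_2) : nonscalar pi A ->
  exists2 C, is_companion C & simmod n A C.
Proof.
rewrite (m2_eta A).
move: (A 0 0) (A 0 1) (A 1 0) (A 1 1) => a b c d nA.
have cyc e f g h : m2 e f g h \in unitmx -> a * e + b * g = f ->
    c * e + d * g = h -> exists2 C, is_companion C & simmod n (m2 a b c d) C.
  move=> ug Ef Eh; apply: (cyclic_simmod n ug).
  apply: ord2P; apply: ord2P => // _; apply/colP; apply: ord2P;
  by rewrite !mxE !big_ord_recl big_ord0 !mxE /= addr0.
have [uc|/(not_unit hO) dc] := pselect (c \is a GRing.unit).
  apply: (cyc 1 a 0 c); [|by ring|by ring].
  by rewrite unitmxE det_m2 mul1r mulr0 subr0.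
have [ub|/(not_unit hO) db] := pselect (b \is a GRing.unit).
  apply: (cyc 0 b 1 d); [|by ring|by ring].
  by rewrite unitmxE det_m2 mul0r mulr1 sub0r unitrN.
apply: (cyc 1 (a + b) 1 (c + d)); [|by ring|by ring].
rewrite unitmxE det_m2; apply/(unitPn hO) => ddet; apply: (nA a).
move=> i j; rewrite !mxE; move: i j; apply: ord2P; apply: ord2P => /=.
- by dvcomb (0 : O).
- by dvcomb b.
- by dvcomb c.
- by dvcomb ((1 * (c + d) - (a + b) * 1) - c + b).
Qed.

Lemma cyclic3_shape (A g : 'M[O]_3) :
  g \in unitmx -> row 1 g *m A = row 2%:R g ->
  exists x y z a b c h, h \in unitmx /\ h *m A = m3 x y z 0 0 1 a b c *m h.
Proof.
move=> ug rowE; pose M := g *m A *m invmx g.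
have : row 1 M = row 2%:R 1%:M.
  by rewrite /M -mulmxA row_mul mulmxA rowE -row_mul mulmxV.
move=> /rowP E; move: (E 0) (E 1) (E 2%:R); rewrite ![row _ _ _ _]mxE ![1%:M _ _]mxE /= => E0 E1 E2.
exists (M 0 0), (M 0 1), (M 0 2%:R), (M 2%:R 0), (M 2%:R 1), (M 2%:R 2%:R), g.
split=> //; set M' := m3 _ _ _ _ _ _ _ _ _; suff -> : M' = M by rewrite mulmxKV.
by rewrite [RHS]m3_eta E0 E1 E2.
Qed.

(** For standard basis vectors v the determinant of e, v, v A runs through the off-diagonal entries;
    v = e1 + e2 and v = e1 + e3 detect the differences of the diagonal entries. If no such
    determinant were a unit, A would be scalar modulo pi. *)
Lemma nonscalar3_shape (A : 'M[O]_3) : nonscalar pi A ->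
  exists x y z a b c h, h \in unitmx /\ h *m A = m3 x y z 0 0 1 a b c *m h.
Proof.
rewrite (m3_eta A).
move: (A 0 0) (A 0 1) (A 0 2%:R) (A 1 0) (A 1 1) (A 1 2%:R)
  (A 2%:R 0) (A 2%:R 1) (A 2%:R 2%:R) => b00 b01 b02 b10 b11 b12 b20 b21 b22 nA.
apply: contrapT => nE.
have go e0 e1 e2 v0 v1 v2 x : \det (m3 e0 e1 e2 v0 v1 v2
    (v0 * b00 + v1 * b10 + v2 * b20) (v0 * b01 + v1 * b11 + v2 * b21)
    (v0 * b02 + v1 * b12 + v2 * b22)) = x -> dv 1 x.
  set g := m3 _ _ _ _ _ _ _ _ _ => gx; apply: (not_unit hO) => ux; apply: nE.
  apply: (cyclic3_shape (g := g)); first by rewrite unitmxE gx.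
  by rewrite -row_mul mul_m3; apply/rowP; apply: ord3P; rewrite !mxE.
have d01 : dv 1 b01 by apply: (go 0 0 1 1 0 0); rewrite det_m3; ring.
have d02 : dv 1 b02 by apply: (go 0 (-1) 0 1 0 0); rewrite det_m3; ring.
have d10 : dv 1 b10 by apply: (go 0 0 (-1) 0 1 0); rewrite det_m3; ring.
have d12 : dv 1 b12 by apply: (go 1 0 0 0 1 0); rewrite det_m3; ring.
have d20 : dv 1 b20 by apply: (go 0 1 0 0 0 1); rewrite det_m3; ring.
have d21 : dv 1 b21 by apply: (go (-1) 0 0 0 0 1); rewrite det_m3; ring.
have d11 : dv 1 (b01 + b11 - (b00 + b10)).
  by apply: (go 0 0 1 1 1 0); rewrite det_m3; ring.
have d22 : dv 1 (b02 + b22 - (b00 + b20)).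
  by apply: (go 0 (-1) 0 1 0 1); rewrite det_m3; ring.
apply: (nA b00); rewrite scalar_m3 opp_m3 add_m3 !subr0 subrr.
apply/dvmx_m3; (do !split) => //; first exact: dv0.
  by dvcomb (b01 + b11 - (b00 + b10) - b01 + b10).
by dvcomb (b02 + b22 - (b00 + b20) - b02 + b20).
Qed.

(** For the shape with rows (x, y, z), (0, 0, 1), (a, b, c): the vector e1 - z e2 removes z, and
    taking e2 (A - x) = e3 - x e2 as third vector makes the first two diagonal entries equal. *)
Lemma nonscalar_E (A : 'M[O]_3) : nonscalar pi A ->
  exists x a b c d, forall n, simmod n A (Ex x a b c d).
Proof.
move=> /nonscalar3_shape[x [y [z [a [b [c [h [uh hA]]]]]]]].
exists (x * z + y), a, (a * z + b + (c - x) * x), (c - x - x), x => n.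
apply: (simmod_trans (simmod_eq _ _ uh hA)).
apply: (@simmod_eq _ _ _ _ (m3 1 (- z) 0 0 1 0 0 (- x) 1)).
  by rewrite unitmxE det_m3 (_ : _ + _ = 1) ?unitr1 //; ring.
by rewrite !mul_m3; congr m3; ring.
Qed.

End Reduction.

(** * Block matrices and the splitting of an eigenvalue *)

Definition blk3 (R : pzRingType) (x : R) (C : 'M[R]_2) : 'M[R]_3 :=
  m3 x 0 0 0 (C 0 0) (C 0 1) 0 (C 1 0) (C 1 1).

Lemma blk3_mul (R : pzRingType) (x y : R) (C D : 'M[R]_2) :
  blk3 x C *m blk3 y D = blk3 (x * y) (C *m D).
Proof.
rewrite mul_m3 /blk3 !mxE !big_ord_recl !big_ord0.
by rewrite !(mulr0, mul0r, addr0, add0r) (_ : lift ord0 ord0 = 1) //; apply: val_inj.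
Qed.

Lemma blk3B (R : pzRingType) (x y : R) (C D : 'M[R]_2) :
  blk3 x C - blk3 y D = blk3 (x - y) (C - D).
Proof. by rewrite opp_m3 add_m3 /blk3 !subr0 !mxE. Qed.

Lemma blk3_det (R : comPzRingType) (x : R) (C : 'M[R]_2) :
  \det (blk3 x C) = x * \det C.
Proof. by rewrite det_m3 [in RHS](m2_eta C) det_m2; ring. Qed.

Lemma map_blk3 (R S : pzRingType) (f : {rmorphism R -> S}) x C :
  map_mx f (blk3 x C) = blk3 (f x) (map_mx f C).
Proof. by rewrite map_m3 /blk3 !rmorph0 !mxE. Qed.

Lemma scalar_blk3 (R : pzRingType) (x : R) : x%:M = blk3 x x%:M.
Proof. by rewrite {1}scalar_m3 /blk3 !mxE. Qed.

Lemma diag3_blk3 (R : pzRingType) (a : R) : diag3 a 0 0 = blk3 a 0.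
Proof. by rewrite diag3_m3 /blk3 !mxE. Qed.

Lemma affine_blk3 (R : pzRingType) (x y z : R) (C : 'M[R]_2) :
  x%:M + y *: blk3 z C = blk3 (x + y * z) (x%:M + y *: C).
Proof. by rewrite {1}scalar_m3 scale_m3 add_m3 /blk3 !mxE !mulr0 !addr0. Qed.

Section Splitting.
Variables (O : idomainType) (pi : O).
Hypothesis hO : compact_dvr pi.
Local Notation dv := (dv pi).
Local Notation dvmx := (dvmx pi).
Local Notation simmod := (simmod pi).

Lemma dvmx_blk3 n (x : O) (C : 'M[O]_2) :
  dvmx n (blk3 x C) <-> dv n x /\ dvmx n C.
Proof.
rewrite {2}(m2_eta C); split=> [/dvmx_m3[[? ? ?] [[? ? ?] [? ? ?]]]|[? /dvmx_m2[? ? ? ?]]].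
  by split=> //; apply/dvmx_m2.
by apply/dvmx_m3; do !split => //; apply: dv0.
Qed.

Lemma simmod_blk3 n (x : O) (C D : 'M[O]_2) :
  simmod n C D -> simmod n (blk3 x C) (blk3 x D).
Proof.
move=> [g ug dg]; exists (blk3 1 g).
  by rewrite unitmxE blk3_det mul1r -unitmxE.
rewrite !blk3_mul blk3B mulr1 mul1r subrr; apply/dvmx_blk3; split=> //.
exact: dv0.
Qed.

(* Newton step: conjugate by 1 + K, where K has off-diagonal blocks
   y / (al - be) and - z / (al - be). *)
Lemma hensel_step n al be y1 y2 z1 z2 w11 w12 w21 w22 :
  (0 < n)%N -> al - be \is a GRing.unit ->
  dv n y1 -> dv n y2 -> dv n z1 -> dv n z2 ->
  dv 1 (w11 - be) -> dv 1 w12 -> dv 1 w21 -> dv 1 (w22 - be) ->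
  exists al' y1' y2' z1' z2' w11' w12' w21' w22' g,
  g \in unitmx /\
  m3 al' y1' y2' z1' w11' w12' z2' w21' w22' *m g =
    g *m m3 al y1 y2 z1 w11 w12 z2 w21 w22 /\
  [/\ dv n.+1 y1', dv n.+1 y2', dv n.+1 z1' & dv n.+1 z2'] /\
  al' - be \is a GRing.unit /\
  [/\ dv 1 (w11' - be), dv 1 w12', dv 1 w21' & dv 1 (w22' - be)].
Proof.
move=> n0 ue [y1' y1E] [y2' y2E] [z1' z1E] [z2' z2E] d11 d12 d21 d22.
pose e := (al - be)^-1.
pose u1 := y1' * e; pose u2 := y2' * e; pose v1 := - z1' * e; pose v2 := - z2' * e.
pose P := pi ^+ n; rewrite -/P in y1E y2E z1E z2E.
have dP : dv 1 P by apply: dvXle.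
have dPn : dv n P by apply: dvX.
have dPP X : dv n.+1 (P * (P * X)).
  by apply: (@dvW _ _ _ (n + n)); [lia|exact: dvM (dvMr _ _)].
have dP1 X : dv 1 X -> dv n.+1 (P * X) by rewrite -(addn1 n); apply: dvM.
pose g := m3 1 (P * u1) (P * u2) (P * v1) 1 0 (P * v2) 0 1.
have ug : g \in unitmx.
  rewrite unitmxE det_m3; apply: (unit_cong hO _ (unitr1 O)).
  by dvcomb (P * (u1 * P * v1) + P * u2 * (P * v2)).
pose M := m3 al y1 y2 z1 w11 w12 z2 w21 w22.
pose M' := g *m M *m invmx g.
have : M' *m g = g *m M by rewrite mulmxKV.
rewrite (m3_eta M').
move: (M' 0 0) (M' 0 1) (M' 0 2%:R) (M' 1 0) (M' 1 1) (M' 1 2%:R)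
  (M' 2%:R 0) (M' 2%:R 1) (M' 2%:R 2%:R) => A00 A01 A02 A10 A11 A12 A20 A21 A22.
move=> E; exists A00, A01, A02, A10, A20, A11, A12, A21, A22, g.
do 2!split=> //; move: E; rewrite !mul_m3.
move=> /m3_inj[[E00 E01 E02] [[E10 E11 E12] [E20 E21 E22]]].
have eK : (al - be) * e = 1 by rewrite divrr.
have f00 : A00 = al + P * (u1 * z1 + u2 * z2 - A01 * v1 - A02 * v2).
  transitivity (A00 * 1 + A01 * (P * v1) + A02 * (P * v2) -
    P * (A01 * v1 + A02 * v2)); first by ring.
  by rewrite E00; ring.
have f11 : A11 = w11 + P * (v1 * y1 - A10 * u1).
  transitivity (A10 * (P * u1) + A11 * 1 + A12 * 0 - P * (A10 * u1)); first by ring.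
  by rewrite E11; ring.
have f12 : A12 = w12 + P * (v1 * y2 - A10 * u2).
  transitivity (A10 * (P * u2) + A11 * 0 + A12 * 1 - P * (A10 * u2)); first by ring.
  by rewrite E12; ring.
have f21 : A21 = w21 + P * (v2 * y1 - A20 * u1).
  transitivity (A20 * (P * u1) + A21 * 1 + A22 * 0 - P * (A20 * u1)); first by ring.
  by rewrite E21; ring.
have f22 : A22 = w22 + P * (v2 * y2 - A20 * u2).
  transitivity (A20 * (P * u2) + A21 * 0 + A22 * 1 - P * (A20 * u2)); first by ring.
  by rewrite E22; ring.
(* In each off-diagonal entry the part of order pi^n carries the factor 1 - (al - be) e, which is 0.
   The rest is pi^n times elements divisible by pi. *)
have f01 : A01 = P * (y1' * (1 - (al - be) * e)) +
    P * (u1 * (w11 - be) + u2 * w21) - u1 * (P * (A00 - al)).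
  transitivity (A00 * (P * u1) + A01 * 1 + A02 * 0 - A00 * (P * u1)); first by ring.
  by rewrite E01 y1E /u1; ring.
have f02 : A02 = P * (y2' * (1 - (al - be) * e)) +
    P * (u1 * w12 + u2 * (w22 - be)) - u2 * (P * (A00 - al)).
  transitivity (A00 * (P * u2) + A01 * 0 + A02 * 1 - A00 * (P * u2)); first by ring.
  by rewrite E02 y2E /u2; ring.
have f10 : A10 = P * (z1' * (1 - (al - be) * e)) -
    P * (v1 * (w11 - be) + v2 * w12) - v1 * (P * (A11 - w11)) -
    v2 * (P * (A12 - w12)).
  transitivity (A10 * 1 + A11 * (P * v1) + A12 * (P * v2) -
    A11 * (P * v1) - A12 * (P * v2)); first by ring.
  by rewrite E10 z1E /v1; ring.
have f20 : A20 = P * (z2' * (1 - (al - be) * e)) -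
    P * (v1 * w21 + v2 * (w22 - be)) - v1 * (P * (A21 - w21)) -
    v2 * (P * (A22 - w22)).
  transitivity (A20 * 1 + A21 * (P * v1) + A22 * (P * v2) -
    A21 * (P * v1) - A22 * (P * v2)); first by ring.
  by rewrite E20 z2E /v2; ring.
rewrite eK subrr !mulr0 !add0r in f01 f02 f10 f20.
have g00 : dv n.+1 (P * (A00 - al)) by rewrite f00 addrC addKr.
have g11 : dv n.+1 (P * (A11 - w11)) by rewrite f11 addrC addKr.
have g12 : dv n.+1 (P * (A12 - w12)) by rewrite f12 addrC addKr.
have g21 : dv n.+1 (P * (A21 - w21)) by rewrite f21 addrC addKr.
have g22 : dv n.+1 (P * (A22 - w22)) by rewrite f22 addrC addKr.
split.
  split; [rewrite f01|rewrite f02|rewrite f10|rewrite f20];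
  repeat first [exact: g00 | exact: g11 | exact: g12 | exact: g21 | exact: g22
    | apply: dvB | apply: dvN | apply: dvMl; assumption | apply: dvD
    | apply: dP1; auto with dv | apply: dvMl].
split.
  apply: (unit_cong hO _ ue); rewrite f00.
  by dvcomb (- (P * (u1 * z1 + u2 * z2 - A01 * v1 - A02 * v2))).
split.
- by rewrite f11; dvcomb (w11 - be + P * (v1 * y1 - A10 * u1)).
- by rewrite f12; auto with dv.
- by rewrite f21; auto with dv.
- by rewrite f22; dvcomb (w22 - be + P * (v2 * y2 - A20 * u2)).
Qed.

(** A Newton step preserves its own hypotheses (al - be a unit, W congruent to be) while the
    off-diagonal entries gain a factor pi, so it can be repeated until they vanish modulo pi^n. *)
Lemma hensel n al be y1 y2 z1 z2 w11 w12 w21 w22 :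
  (0 < n)%N -> al - be \is a GRing.unit ->
  dv 1 y1 -> dv 1 y2 -> dv 1 z1 -> dv 1 z2 ->
  dv 1 (w11 - be) -> dv 1 w12 -> dv 1 w21 -> dv 1 (w22 - be) ->
  exists al' W, [/\ al' - be \is a GRing.unit, dvmx 1 (W - be%:M) &
    simmod n (m3 al y1 y2 z1 w11 w12 z2 w21 w22) (blk3 al' W)].
Proof.
move=> n0 ue dy1 dy2 dz1 dz2 d11 d12 d21 d22.
suff : exists al' y1' y2' z1' z2' w11' w12' w21' w22' g,
  g \in unitmx /\
  m3 al' y1' y2' z1' w11' w12' z2' w21' w22' *m g =
    g *m m3 al y1 y2 z1 w11 w12 z2 w21 w22 /\
  [/\ dv n y1', dv n y2', dv n z1' & dv n z2'] /\
  al' - be \is a GRing.unit /\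
  [/\ dv 1 (w11' - be), dv 1 w12', dv 1 w21' & dv 1 (w22' - be)].
  move=> [al' [y1' [y2' [z1' [z2' [w11' [w12' [w21' [w22' [g]]]]]]]]]].
  move=> [ug [sM [[ey1 ey2 ez1 ez2] [ue' [e11 e12 e21 e22]]]]].
  exists al', (m2 w11' w12' w21' w22'); split=> //.
    rewrite scalar_m2 => i j; rewrite !mxE; move: i j.
    by apply: ord2P; apply: ord2P; rewrite //= subr0.
  apply: simmod_trans (simmod_eq _ _ ug (esym sM)) _; apply: simmod_cong.
  rewrite /blk3 !mxE /= opp_m3 add_m3 !subr0 !subrr.
  by apply/dvmx_m3; do !split => //; apply: dv0.
elim: n n0 => // n IHn _; have [->|n0] := posnP n.
  exists al, y1, y2, z1, z2, w11, w12, w21, w22, 1%:M.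
  by rewrite unitmx1 mul1mx mulmx1.
have [a' [s1 [s2 [t1 [t2 [v11 [v12 [v21 [v22 [g [ug [gE]]]]]]]]]]]] := IHn n0.
move=> [[ds1 ds2 dt1 dt2] [ua [e11 e12 e21 e22]]].
have [al' [y1' [y2' [z1' [z2' [w11' [w12' [w21' [w22' [h [uh [hE]]]]]]]]]]]] :=
  hensel_step n0 ua ds1 ds2 dt1 dt2 e11 e12 e21 e22.
move=> H; exists al', y1', y2', z1', z2', w11', w12', w21', w22', (h *m g).
by rewrite unitmx_mul uh ug mulmxA hE -!mulmxA gE.
Qed.

End Splitting.

Lemma form_ii_blk3 (R : pzRingType) (d x a : R) :
  d%:M + x *: diag3 a 0 0 = blk3 (d + x * a) d%:M.
Proof. by rewrite diag3_blk3 affine_blk3 scaler0 addr0. Qed.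

Lemma form_iii_blk3 (R : pzRingType) (d x y a : R) (C : 'M[R]_2) :
  d%:M + x *: diag3 a 0 0 + y *: blk3 0 C = blk3 (d + x * a) (d%:M + y *: C).
Proof.
by rewrite form_ii_blk3 scale_m3 add_m3 /blk3 !mxE !mulr0 !addr0.
Qed.

Lemma form_iii_affine (R : pzRingType) (d x a : R) (C : 'M[R]_2) i j :
  (i <= j)%N ->
  d%:M + x ^+ i *: diag3 a 0 0 + x ^+ j *: blk3 0 C =
  d%:M + x ^+ i *: blk3 a (x ^+ (j - i) *: C).
Proof.
by move=> le_ij; rewrite form_iii_blk3 affine_blk3 scalerA -exprD subnKC.
Qed.

(** * Existence and uniqueness of normal forms *)

Section NormalForms.
Variables (O : idomainType) (pi : O).
Hypothesis hO : compact_dvr pi.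
Local Notation dv := (dv pi).
Local Notation dvmx := (dvmx pi).
Local Notation simmod := (simmod pi).

Variable rep : nat -> O -> Prop.
Variable T2 : nat -> 'M[O]_2 -> shadow_type.
Variable T3 : nat -> 'M[O]_3 -> shadow_type.

(** The list over O: truncated valuations become divisibilities, membership in the chosen
    representatives becomes [rep], and in (I) the entry pi^n stands for 0. *)
Variant lifted_E_form (n : nat) : 'M[O]_3 -> shadow_type -> Prop :=
| Lift_I (c d : O) of dv 1 c : lifted_E_form n (Ex (pi ^+ n) 0 0 c d) tJ
| Lift_II mu (a b c d : O) of (0 < mu < n)%N & dv mu a & dv mu b &
    ~ dv mu.+1 b & dv 1 c & rep mu d :
    lifted_E_form n (Ex (pi ^+ mu) a b c d) tM
| Lift_III1 mu (a b c d : O) of (0 < mu < n)%N & dv mu a & ~ dv mu.+1 a &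
    dv mu.+1 b & dv 1 c & rep mu d :
    lifted_E_form n (Ex (pi ^+ mu) a b c d) tN
| Lift_III0 mu (a b c d : O) of (0 < mu < n)%N & dv mu.+1 a & dv mu.+1 b &
    dv 1 c & rep mu d :
    lifted_E_form n (Ex (pi ^+ mu) a b c d) tK0
| Lift_IIIoo m mu (a b c d : O) of (0 < mu < n)%N & (mu < m <= n)%N &
    rep (n - m + mu) a & dv mu a & ~ dv mu.+1 a & dv mu.+1 b & dv 1 c &
    rep mu d :
    lifted_E_form n (Ex (pi ^+ m) a b c d) tKoo.

Variant lifted_form (l : nat) : 'M[O]_3 -> shadow_type -> Prop :=
| Lift_i d : lifted_form l d%:M tG
| Lift_ii i d a of (i < l)%N & a \is a GRing.unit :
    lifted_form l (d%:M + pi ^+ i *: diag3 a 0 0) tL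
| Lift_iii i j d a C of (i < j < l)%N & rep j d & a \is a GRing.unit &
    is_companion C :
    lifted_form l (d%:M + pi ^+ i *: diag3 a 0 0 + pi ^+ j *: blk3 0 C)
      (T2 (l - j) C)
| Lift_iv i d C of (i < l)%N & rep i d & is_companion C :
    lifted_form l (d%:M + pi ^+ i *: C) (T3 (l - i) C)
| Lift_v i d E t of (i < l)%N & rep i d & lifted_E_form (l - i) E t :
    lifted_form l (d%:M + pi ^+ i *: E) t.

Lemma E_normal_lifted_form n mu m a b c d : E_normal pi rep n mu m a b c d ->
  exists E t, lifted_E_form n E t /\ simmod n (Ex (pi ^+ m) a b c d) E.
Proof.
case=> /andP[mu0 le_mun] /andP[le_mum le_mn] da db dc rd ex cases.
have [E|ne_mun] := eqVneq mu n.
  have {}ex : m = n by lia.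
  exists (Ex (pi ^+ n) 0 0 c d), tJ; split; first exact: Lift_I.
  apply: simmod_cong; rewrite ex /Ex opp_m3 add_m3 !subrr !subr0 -E.
  apply/dvmx_m3; (do !split) => //; exact: dv0.
have lt_mun : (mu < n)%N by lia.
have Hmu : (0 < mu < n)%N by rewrite mu0.
move: (rd lt_mun) => {}rd.
have triv A : simmod n A A by exact: simmod_refl.
case: cases => [Em|[lt_mum ra nda db1]]; last first.
  exists (Ex (pi ^+ m) a b c d), tKoo; split=> //.
  apply: (Lift_IIIoo Hmu _ ra) => //; lia.
rewrite Em; exists (Ex (pi ^+ mu) a b c d).
have [db1|ndb] := pselect (dv mu.+1 b); last first.
  by exists tM; split=> //; apply: Lift_II.
have [da1|nda] := pselect (dv mu.+1 a); last first.
  by exists tN; split=> //; apply: Lift_III1.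
by exists tK0; split=> //; apply: Lift_III0.
Qed.

Lemma lifted_E_form_normal n E t : (0 < n)%N -> lifted_E_form n E t ->
  exists mu m a b c d, E = Ex (pi ^+ m) a b c d /\
    E_normal pi rep n mu m a b c d.
Proof.
move=> n0; have nX mu : ~ dv mu.+1 (pi ^+ mu).
  by rewrite -[pi ^+ mu]mulr1 => /(exact_ndv hO (unitr1 O)).
case=> [c d dc|mu a b c d Hmu da db ndb dc rd|mu a b c d Hmu da nda db dc rd|
  mu a b c d Hmu da db dc rd|m mu a b c d Hmu Hm ra da nda db dc rd].
- exists n, n, 0, 0, c, d; split=> //.
  by split=> //; try (by apply: dv0); try lia.
- exists mu, mu, a, b, c, d; split=> //.
  by split=> //; try lia; [move=> _ [/nX]].
- exists mu, mu, a, b, c, d; split=> //.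
  by split=> //; try lia; [exact: dvW db|move=> _ [/nX]].
- exists mu, mu, a, b, c, d; split=> //.
  by split=> //; try lia; [exact: dvW da|exact: dvW db|move=> _ [/nX]].
- exists mu, m, a, b, c, d; split=> //.
  split=> //; try lia; [exact: dvW db|by move=> _ []|].
  by right; split=> //; lia.
Qed.

Lemma companion_form i l d A C : (i < l)%N -> rep i d -> is_companion C ->
  simmod (l - i) A C ->
  exists B t, lifted_form l B t /\ simmod l (d%:M + pi ^+ i *: A) B.
Proof.
move=> lt_il rd cC sAC; exists (d%:M + pi ^+ i *: C), (T3 (l - i) C).
split; first exact: Lift_iv.
by move: (simmod_affine i d sAC); rewrite subnKC // ltnW.
Qed.

Hypothesis rep_ex : forall i x, exists2 y, rep i y & dv i (x - y).
Hypothesis rep_zero : forall i x, rep i x -> dv i x -> x = pi ^+ i.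

(** If W is scalar modulo pi^(l-i) the result is (ii). Otherwise W = e + pi^j W' with W' nonscalar
    modulo pi, where j > 0 because W itself is scalar modulo pi; this gives (iii). *)
Lemma split_form i l d al be W : (i < l)%N -> al - be \is a GRing.unit ->
  dvmx 1 (W - be%:M) ->
  exists B t, lifted_form l B t /\
    simmod l (d%:M + pi ^+ i *: blk3 al W) B.
Proof.
move=> lt_il ue dW; have n0 : (0 < l - i)%N by lia.
rewrite affine_blk3.
have unit_al e : dvmx 1 (W - e%:M) -> al - e \is a GRing.unit.
  move=> dWe; apply: (unit_cong hO _ ue).
  by have := dvmxB dW dWe 0 0; rewrite !mxE !eqxx !mulr1n => /dv_eq; apply; ring.
have [[e dWe]|[j [e [W' [lt_jn nW' WE]]]]] := nonscalar_decomp pi (l - i) W.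
  exists ((d + pi ^+ i * e)%:M + pi ^+ i *: diag3 (al - e) 0 0), tL; split.
    by apply: Lift_ii => //; apply/unit_al/(dvmxW n0 dWe).
  rewrite form_ii_blk3 (_ : d + _ + _ = d + pi ^+ i * al); last by ring.
  apply: simmod_blk3; apply: simmod_cong.
  rewrite raddfD /= opprD addrACA subrr add0r -scale_scalar_mx -scalerBr.
  by have := dvmxX i dWe; rewrite subnKC // ltnW.
have j0 : (0 < j)%N.
  rewrite lt0n; apply/eqP => j0; apply: (nW' (be - e)).
  suff -> : W' - (be - e)%:M = W - be%:M by [].
  by rewrite WE j0 scale1r raddfB /= opprB addrA [W' + _]addrC.
have ule : al - e \is a GRing.unit.
  by apply: unit_al; rewrite WE addrC addKr; apply: (dvmxW j0 (dvmxXl _ _ _)).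
(* The scalar d + pi^i e of the lower block is replaced by its representative modulo pi^(i+j). The
   remainder pi^(i+j) f is absorbed by W' and by the upper left entry. *)
pose J := (i + j)%N; have [d2 rd2 [f df]] := rep_ex J (d + pi ^+ i * e).
have nW2 : nonscalar pi (f%:M + W') by exact: nonscalar_shift.
have [C cC sC] := nonscalar2_companion hO (l - J) nW2.
exists (d2%:M + pi ^+ i *: diag3 (al - e + pi ^+ j * f) 0 0 +
  pi ^+ J *: blk3 0 C), (T2 (l - J) C).
split.
  apply: Lift_iii => //; first lia.
  by apply: (unitDdv hO) => //; apply/dvMr/dvXle.
rewrite form_iii_blk3.
have -> : d2 + pi ^+ i * (al - e + pi ^+ j * f) = d + pi ^+ i * al.
  by rewrite mulrDr mulrA -exprD -/J -df; ring.
apply: simmod_blk3.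
have -> : d%:M + pi ^+ i *: W = d2%:M + pi ^+ J *: (f%:M + W').
  rewrite WE scalerDr scalerA -exprD -/J scale_scalar_mx addrA -raddfD /=.
  rewrite -[X in X%:M](subrK d2) df raddfD /= -scale_scalar_mx scalerDr.
  by rewrite addrAC addrA addrC addrA.
by move: (simmod_affine J d2 sC); rewrite subnKC //; lia.
Qed.

Lemma lifted_form_exists l A : (0 < l)%N ->
  exists B t, lifted_form l B t /\ simmod l A B.
Proof.
move=> l0; have [[d dA]|[i [d0 [B0 [lt_il nB0 AE]]]]] := nonscalar_decomp pi l A.
  by exists d%:M, tG; split; [exact: Lift_i|exact: simmod_cong].
have [d rd [e de]] := rep_ex i d0.
have {}AE : A = d%:M + pi ^+ i *: (e%:M + B0).
  by rewrite AE -(subrK d d0) de raddfD /= scalerDr scale_scalar_mx addrA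
    [_ + d%:M]addrC.
have nB : nonscalar pi (e%:M + B0) by exact: nonscalar_shift.
move: (e%:M + B0) AE nB => B AE nB.
have n0 : (0 < l - i)%N by lia.
have trans B' : simmod (l - i) B B' ->
    simmod l A (d%:M + pi ^+ i *: B').
  by move=> /(simmod_affine i d); rewrite -AE subnKC // ltnW.
have [x [a [b [c [y /(_ (l - i)%N) sB]]]]] := nonscalar_E hO nB.
have [ucyc|ncyc] := pselect (x \is a GRing.unit \/ a \is a GRing.unit \/
    b \is a GRing.unit).
  have [C cC sC] := E_cyclic hO (l - i) c y ucyc.
  rewrite AE; apply: companion_form cC _ => //; exact: simmod_trans sB sC.
have dx : dv 1 x by apply: (not_unit hO) => u; apply: ncyc; left.
have da : dv 1 a by apply: (not_unit hO) => u; apply: ncyc; right; left.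
have db : dv 1 b by apply: (not_unit hO) => u; apply: ncyc; right; right.
have [uc|/(not_unit hO) dc] := pselect (c \is a GRing.unit); last first.
  have [mu [m [a' [b' [c' [d' [N sE]]]]]]] :=
    E_normalizableP hO rep_ex rep_zero y n0 dx da db dc.
  have [E [t [nE sE']]] := E_normal_lifted_form N.
  exists (d%:M + pi ^+ i *: E), t; split; first exact: Lift_v.
  exact: trans (simmod_trans sB (simmod_trans sE sE')).
(* In the basis e3, e1, e2 - e3/c the matrix is diagonal modulo pi with eigenvalues c + y, y, y. *)
pose ic := c^-1; have icc : c * ic = 1 by rewrite divrr.
have uc' : (c + y + b * ic) - y \is a GRing.unit.
  by rewrite addrAC addrK; apply: (unitDdv hO) => //; auto with dv.
have [] := @hensel _ _ hO (l - i) (c + y + b * ic) y a b (x * ic) (- b * ic * ic)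
  y x (- a * ic) (y - b * ic) n0 uc'; auto with dv.
- by rewrite subrr; apply: dv0.
- by dvcomb (- (b * ic)).
move=> al [W [ual dW sH]].
have sB' : simmod (l - i) B (blk3 al W).
  apply: simmod_trans sB (simmod_trans _ sH).
  apply: (@simmod_eq _ _ _ _ (m3 0 0 1 1 0 0 0 1 (- ic))).
    rewrite unitmxE (_ : \det _ = 1) ?unitr1 // det_m3; ring.
  rewrite !mul_m3; congr m3; try ring.
  transitivity ((1 - c * ic) - ic * y); first by ring.
  by rewrite icc; ring.
have [B1 [t [fB1 sB1]]] := split_form d lt_il ual dW.
exists B1, t; split=> //; exact: simmod_trans (trans _ sB') sB1.
Qed.

End NormalForms.

(** * Invariants that separate the normal forms *)

Section Uniqueness.
Variables (O : idomainType) (pi : O).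
Hypothesis hO : compact_dvr pi.
Local Notation dv := (dv pi).
Local Notation dvmx := (dvmx pi).
Local Notation simmod := (simmod pi).
Local Notation nonscalar := (nonscalar pi).

Lemma companion2_uniq n (C C' : 'M[O]_2) :
  is_companion C -> is_companion C' -> simmod n C C' -> dvmx n (C - C').
Proof.
move=> [c ->] [c' ->]; rewrite !companion2E => sC.
have := simmod_tr sC; have := simmod_det sC; rewrite !tr_m2 !det_m2 => hdet htr.
move=> i j; rewrite !mxE; move: i j; apply: ord2P; apply: ord2P => /=.
- by dvcomb (0 : O).
- by apply: dv_eq (dvN hdet); ring.
- by dvcomb (0 : O).
- by apply: dv_eq htr; ring.
Qed.

(** Trace and determinant give two of the coefficients, and the determinant of C - 1 gives the
    third. *)
Lemma companion3_uniq n (C C' : 'M[O]_3) :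
  is_companion C -> is_companion C' -> simmod n C C' -> dvmx n (C - C').
Proof.
move=> [c ->] [c' ->]; rewrite !companion3E => sC.
have htr := simmod_tr sC; have hdet := simmod_det sC.
have := simmod_det (simmod_shift (- 1) sC).
rewrite !scalar_m3 !add_m3 !det_m3 => hdet1; rewrite !tr_m3 in htr.
rewrite !det_m3 in hdet.
have h0 : dv n (- c 0 - - c' 0) by apply: dv_eq hdet; ring.
have h2 : dv n (- c 2%:R - - c' 2%:R) by apply: dv_eq htr; ring.
rewrite opp_m3 add_m3; apply/dvmx_m3; (do !split) => //; try by rewrite subrr; apply: dv0.
apply: dv_eq (dvB hdet1 (dvD h0 h2)); ring.
Qed.

Lemma nonscalar_companion N (C : 'M[O]_N.+2) : is_companion C -> nonscalar C.
Proof.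
move=> [c ->] x /(_ 1 0); rewrite !mxE /= mulr0n subr0.
by apply: (unit_dv hO) => //; apply: unitr1.
Qed.

Lemma nonscalar_E_form x a b c d : nonscalar (Ex x a b c d).
Proof.
move=> y; rewrite scalar_m3 opp_m3 add_m3 => /dvmx_m3[_ [[_ _]]].
by rewrite subr0 => /(unit_dv hO (ltn0Sn 0) (unitr1 O)).
Qed.

Lemma nonscalar_blk3 a (D : 'M[O]_2) :
  a \is a GRing.unit -> dvmx 1 D -> nonscalar (blk3 a D).
Proof.
move=> /(unitPn hO) na dD x; rewrite scalar_m3 opp_m3 add_m3 => /dvmx_m3.
move=> [[dax _ _] [[_ dx _] _]]; apply: na; have d0 := dD 0 0.
by dvcomb (a - x - (D 0 0 - x) + D 0 0).
Qed.

Definition quadratic x y (A : 'M[O]_3) : Prop :=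
  dvmx 1 ((A - x%:M) *m (A - y%:M)).

(** Since C^2 e1 = e3, the (3,1) entry of (C - x)(C - y) is 1. *)
Lemma companion_not_quadratic x y C : is_companion C -> ~ quadratic x y C.
Proof.
move=> [c ->]; rewrite /quadratic companion3E !scalar_m3 !opp_m3 !add_m3 mul_m3.
move=> /dvmx_m3[_ [_ [h _ _]]]; apply: (unit_dv hO (ltn0Sn 0) (unitr1 O)).
by apply: dv_eq h; ring.
Qed.

Lemma blk3_quadratic a D : dvmx 1 D -> quadratic 0 a (blk3 a D).
Proof.
move=> dD; rewrite /quadratic raddf0 subr0 (scalar_blk3 a).
rewrite blk3B blk3_mul subrr mulr0; apply/dvmx_blk3; split; first exact: dv0.
exact: dvmxMr.
Qed.

Lemma dv1_sqr x : dv 1 (x * x) -> dv 1 x.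
Proof.
by move=> dxx; apply: contrapT => nd; apply: (nd); apply: (dv_prime hO dxx).
Qed.

(** Modulo pi the diagonal of the square is (a - x)^2, x^2, x^2. If it vanishes, so do x and a. *)
Lemma blk3_not_square x a D :
  a \is a GRing.unit -> dvmx 1 D -> ~ quadratic x x (blk3 a D).
Proof.
move=> /(unitPn hO) na dD; rewrite /quadratic scalar_m3 opp_m3 add_m3 mul_m3.
move=> /dvmx_m3[[h0 _ _] [[_ h1 _] _]]; apply: na.
have d00 := dD 0 0; have d01 := dD 0 1.
have dx : dv 1 x.
  apply: dv1_sqr; apply: dv_eq (dvB h1 (dvD (dvMl (D 0 0 - x - x) d00)
    (dvMr (D 1 0 - 0) d01))); ring.
have dax : dv 1 (a - x) by apply: dv1_sqr; apply: dv_eq h0; ring.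
by dvcomb (a - x + x).
Qed.

Lemma E_form_square x a b c d :
  dv 1 x -> dv 1 a -> dv 1 b -> dv 1 c -> quadratic d d (Ex x a b c d).
Proof.
move=> dx da db dc; rewrite /quadratic scalar_m3 opp_m3 add_m3 mul_m3.
rewrite !subrr !subr0 addrK !(mul0r, mulr0, addr0, add0r, mul1r, mulr1).
by apply/dvmx_m3; do !split; auto with dv.
Qed.

Lemma simmod_level_quadratic l i i' d d' A A' x y :
  (i < l)%N -> (i' < l)%N -> nonscalar A -> nonscalar A' ->
  simmod l (d%:M + pi ^+ i *: A) (d'%:M + pi ^+ i' *: A') ->
  quadratic x y A -> exists e, quadratic (e + x) (e + y) A'.
Proof.
move=> lt_il lt_i'l nA nA' sAA' qA.
have [Ei [e de]] := simmod_level hO lt_il lt_i'l nA nA' sAA'.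
rewrite -Ei -(subnKC (ltnW lt_il)) in sAA'.
have {}sAA' := simmod_descend hO de sAA'.
exists e; have l1 : (1 <= l - i)%N by lia.
apply: simmod_quadratic (simmodW l1 sAA') _.
suff shift z : e%:M + A - (e + z)%:M = A - z%:M by rewrite !shift.
by rewrite raddfD /= opprD addrACA subrr add0r.
Qed.

(** First pi divides e: otherwise W is invertible and W' is zero modulo pi, which annihilates the
    lower right block of g. Then al' - W is invertible, so the rest of the first row of g vanishes,
    and the diagonal blocks of g are invertible intertwiners. *)
Lemma simmod_split n e al al' W W' :
  (0 < n)%N -> al - e \is a GRing.unit -> al' \is a GRing.unit ->
  dvmx 1 (W - e%:M) -> dvmx 1 W' -> simmod n (blk3 al W) (blk3 al' W') ->
  dv n (al - al') /\ simmod n W W'.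
Proof.
move=> n0 uale ual' dW dW' [g]; rewrite (m3_eta g).
move: (g 0 0) (g 0 1) (g 0 2%:R) (g 1 0) (g 1 1) (g 1 2%:R)
  (g 2%:R 0) (g 2%:R 1) (g 2%:R 2%:R) => p q r s t u v w z ug.
have [dW00 dW01 dW10 dW11] : [/\ dv 1 (W 0 0 - e), dv 1 (W 0 1), dv 1 (W 1 0)
    & dv 1 (W 1 1 - e)].
  by move: dW; rewrite (m2_eta W) scalar_m2 => dW;
    split; [move: (dW 0 0)|move: (dW 0 1)|move: (dW 1 0)|move: (dW 1 1)];
    rewrite !mxE /= ?subr0.
move: (dW' 0 0) (dW' 0 1) (dW' 1 0) (dW' 1 1); rewrite (m2_eta W) (m2_eta W').
rewrite /blk3 ![m2 _ _ _ _ _ _]mxE /=.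
move: (W 0 0) (W 0 1) (W 1 0) (W 1 1) dW00 dW01 dW10 dW11.
move=> w00 w01 w10 w11 dw00 dw01 dw10 dw11.
move: (W' 0 0) (W' 0 1) (W' 1 0) (W' 1 1) => x00 x01 x10 x11 dx00 dx01 dx10 dx11.
rewrite !mul_m3 opp_m3 add_m3 !(mulr0, mul0r, addr0, add0r).
move=> /dvmx_m3[[h00 h01 h02] [[h10 h11 h12] [h20 h21 h22]]].
have ndet : ~ dv 1 (\det (m3 p q r s t u v w z)) by apply/(unitmx_dv hO).
rewrite det_m3 in ndet.
have de : dv 1 e.
  apply: contrapT => ne; apply: ndet.
  have unit_e f : dv 1 (f * e) -> dv 1 f.
    by rewrite mulrC => fe; apply: dv_prime ne.
  have dt : dv 1 t.
    by apply: unit_e; have := dvW n0 h11 => k; dvcomb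
      (t * w00 + u * w10 - (x00 * t + x01 * w) - t * (w00 - e) - u * w10 +
       (x00 * t + x01 * w)).
  have du : dv 1 u.
    by apply: unit_e; have := dvW n0 h12 => k; dvcomb
      (t * w01 + u * w11 - (x00 * u + x01 * z) - u * (w11 - e) - t * w01 +
       (x00 * u + x01 * z)).
  have dw : dv 1 w.
    by apply: unit_e; have := dvW n0 h21 => k; dvcomb
      (w * w00 + z * w10 - (x10 * t + x11 * w) - w * (w00 - e) - z * w10 +
       (x10 * t + x11 * w)).
  have dz : dv 1 z.
    by apply: unit_e; have := dvW n0 h22 => k; dvcomb
      (w * w01 + z * w11 - (x10 * u + x11 * z) - z * (w11 - e) - w * w01 +
       (x10 * u + x11 * z)).
  by auto 12 with dv.
have ual : al \is a GRing.unit.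
  by apply: (unit_cong hO _ uale); dvcomb (- e).
have d1 : dv 1 w00 by dvcomb (w00 - e + e).
have d2 : dv 1 w11 by dvcomb (w11 - e + e).
have uD : (w00 - al') * (w11 - al') - w10 * w01 \is a GRing.unit.
  apply: (unit_cong hO (u := al' * al')); last by rewrite unitrM ual'.
  by dvcomb (w00 * (al' - w11) + al' * w11 + w10 * w01).
have uD' : (al - x00) * (al - x11) - x10 * x01 \is a GRing.unit.
  apply: (unit_cong hO (u := al * al)); last by rewrite unitrM ual.
  by dvcomb (x00 * (al - x11) + al * x11 + x10 * x01).
have dq : dv n q.
  apply: (dv_unitl uD).
  by dvcomb ((w11 - al') * (q * w00 + r * w10 - al' * q) -
             w10 * (q * w01 + r * w11 - al' * r)).
have dr : dv n r.
  apply: (dv_unitl uD).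
  by dvcomb ((w00 - al') * (q * w01 + r * w11 - al' * r) -
             w01 * (q * w00 + r * w10 - al' * q)).
have nptz : ~ dv 1 (p * (t * z - u * w)).
  have {}dq := dvW n0 dq; have {}dr := dvW n0 dr.
  move=> k; apply: ndet; by auto 12 with dv.
have up : p \is a GRing.unit.
  by apply/(unitPn hO) => k; apply: nptz; auto with dv.
split; first by apply: (dv_unitl up); dvcomb (p * al - al' * p).
exists (m2 t u w z).
  rewrite unitmxE det_m2; apply/(unitPn hO) => k; apply: nptz; auto with dv.
rewrite !mul_m2 => i j; rewrite !mxE; move: i j.
by apply: ord2P; apply: ord2P.
Qed.

End Uniqueness.

Section FormUniqueness.
Variables (O : idomainType) (pi : O).
Hypothesis hO : compact_dvr pi.
Local Notation dv := (dv pi).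
Local Notation dvmx := (dvmx pi).
Local Notation simmod := (simmod pi).
Local Notation nonscalar := (nonscalar pi).

Variable rep : nat -> O -> Prop.
Hypothesis rep_inj : forall i x y, rep i x -> rep i y -> dv i (x - y) -> x = y.
Variable T2 : nat -> 'M[O]_2 -> shadow_type.
Variable T3 : nat -> 'M[O]_3 -> shadow_type.
Local Notation lifted_form := (lifted_form pi rep T2 T3).

(* The lower block of a matrix of type (ii) or (iii). *)
Definition block_form l (V : 'M[O]_2) : Prop :=
  (exists d, V = d%:M) \/
  exists j d C, [/\ (j < l)%N, rep j d, is_companion C & V = d%:M + pi ^+ j *: C].

(** Coarser than the list: (ii) and (iii) differ only in the lower block, and the subcases of (v)
    are collected in [E_normal]. Four kinds remain to be compared. *)
Variant form_kind (l : nat) : 'M[O]_3 -> Prop :=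
| KindScalar d : form_kind l d%:M
| KindSplit i d a D of (i < l)%N & a \is a GRing.unit & dvmx 1 D &
    block_form l (d%:M + pi ^+ i *: D) :
    form_kind l (d%:M + pi ^+ i *: blk3 a D)
| KindCyclic i d C of (i < l)%N & rep i d & is_companion C :
    form_kind l (d%:M + pi ^+ i *: C)
| KindE i d mu m a b c y of (i < l)%N & rep i d &
    E_normal pi rep (l - i) mu m a b c y :
    form_kind l (d%:M + pi ^+ i *: Ex (pi ^+ m) a b c y).

Lemma lifted_form_kind l B t : lifted_form l B t -> form_kind l B.
Proof.
case=> {B t} [d|i d a lt_il ua|i j d a C Hij rd ua cC|i d C lt_il rd cC|
  i d E t lt_il rd fE].
- exact: KindScalar.
- rewrite diag3_blk3.
  apply: KindSplit => //; first exact: dvmx0.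
  by rewrite scaler0 addr0; left; exists d.
- rewrite form_iii_affine; last lia.
  have V : d%:M + pi ^+ i *: (pi ^+ (j - i) *: C) = d%:M + pi ^+ j *: C.
    by rewrite scalerA -exprD subnKC //; lia.
  apply: KindSplit => //; [lia| |rewrite V].
    apply: (dvmxW (_ : 1 <= j - i)%N (dvmxXl _ _ _)); lia.
   right; exists j, d, C; split=> //; lia.
- exact: KindCyclic.
- have [mu [m [a [b [c [y [-> N]]]]]]] := lifted_E_form_normal hO (n := l - i)
    ltac:(lia) fE.
  exact: KindE N.
Qed.

Lemma block_form_uniq l V V' : block_form l V -> block_form l V' ->
  simmod l V V' -> dvmx l (V - V').
Proof.
move=> [[d ->]|[j [d [C [lt_jl rd cC ->]]]]] [[d' ->]|[j' [d' [C' [lt_j'l rd' cC' ->]]]]] sV.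
- exact: simmod_scalars sV.
- by case: (simmod_scalar hO lt_j'l (nonscalar_companion hO cC') (simmod_sym sV)).
- by case: (simmod_scalar hO lt_jl (nonscalar_companion hO cC) sV).
have [Ej dd] := simmod_level hO lt_jl lt_j'l (nonscalar_companion hO cC)
  (nonscalar_companion hO cC') sV.
subst j'; have Ed := rep_inj rd rd' dd; subst d'.
have d0 : d - d = pi ^+ j * 0 by rewrite subrr mulr0.
move: sV; rewrite -{1}(subnKC (ltnW lt_jl)) => /(simmod_descend hO d0).
rewrite raddf0 add0r => /(companion2_uniq cC cC')/(dvmxX j).
by rewrite subnKC ?(ltnW lt_jl) // opprD addrACA subrr add0r -scalerBr.
Qed.

(** Scalar forms are recognised by the level, the other kinds by their quadratic relations modulo
    pi. Within one kind the levels agree, pi^i is cancelled, and the uniqueness of the splitting, of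
    the companion matrix or of E applies. *)
Lemma form_kind_uniq l B B' : form_kind l B -> form_kind l B' ->
  simmod l B B' -> dvmx l (B - B').
Proof.
have nE x a b c d := @nonscalar_E_form _ _ hO x a b c d.
have nC C := @nonscalar_companion _ _ hO 1 C.
have nS a D := @nonscalar_blk3 _ _ hO a D.
have EQ n mu m a b c d : E_normal pi rep n mu m a b c d ->
    quadratic pi d d (Ex (pi ^+ m) a b c d).
  case=> Hmu Hm da db dc _ _ _; apply: E_form_square => //.
  - by apply: dvXle; lia.
  - by apply: dvW da; lia.
  - by apply: dvW db; lia.
case=> {B} [d|i d a D lt ua dD bV|i d C lt rd cC|i d mu m a b c y lt rd N];
case=> {B'} [d'|i' d' a' D' lt' ua' dD' bV'|i' d' C' lt' rd' cC'|
  i' d' mu' m' a' b' c' y' lt' rd' N'] sB.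
- exact: simmod_scalars sB.
- by case: (simmod_scalar hO lt' (nS _ _ ua' dD') (simmod_sym sB)).
- by case: (simmod_scalar hO lt' (nC _ cC') (simmod_sym sB)).
- by case: (simmod_scalar hO lt' (nE _ _ _ _ _) (simmod_sym sB)).
- by case: (simmod_scalar hO lt (nS _ _ ua dD) sB).
- have [Ei [e de]] := simmod_level hO lt lt' (nS _ _ ua dD) (nS _ _ ua' dD') sB.
  subst i'; have l0 : (0 < l - i)%N by lia.
  have sD : simmod (l - i) (blk3 (e + a) (e%:M + D)) (blk3 a' D').
    move: sB; rewrite -{1}(subnKC (ltnW lt)) => /(simmod_descend hO de).
    by rewrite scalar_m3 add_m3 /blk3 !mxE !addr0.
  have uae : e + a - e \is a GRing.unit by rewrite addrC addKr.
  have dDe : dvmx 1 (e%:M + D - e%:M) by rewrite addrC addKr.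
  have [daa sDD] := simmod_split hO l0 uae ua' dDe dD' sD.
  rewrite !affine_blk3 blk3B; apply/dvmx_blk3; split.
    have := dvM (dvX pi i) daa; rewrite subnKC ?(ltnW lt) //.
    by apply: dv_eq; rewrite -(subrK d' d) de; ring.
  apply: block_form_uniq bV bV' _.
  have := simmod_affine i d' sDD; rewrite subnKC ?(ltnW lt) // scalerDr.
  rewrite addrA scale_scalar_mx -de -raddfD /= addrC.
  by rewrite [d' + _]addrC subrK addrC.
- have [e] := simmod_level_quadratic hO lt lt' (nS _ _ ua dD) (nC _ cC') sB
    (blk3_quadratic a dD).
  by move/(companion_not_quadratic hO cC').
- have [e] := simmod_level_quadratic hO lt' lt (nE _ _ _ _ _) (nS _ _ ua dD)
    (simmod_sym sB) (EQ _ _ _ _ _ _ _ N').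
  by move/(blk3_not_square hO ua dD).
- by case: (simmod_scalar hO lt (nC _ cC) sB).
- have [e] := simmod_level_quadratic hO lt' lt (nS _ _ ua' dD') (nC _ cC)
    (simmod_sym sB) (blk3_quadratic a' dD').
  by move/(companion_not_quadratic hO cC).
- have [Ei dd] := simmod_level hO lt lt' (nC _ cC) (nC _ cC') sB.
  subst i'; have Ed := rep_inj rd rd' dd; subst d'.
  have d0 : d - d = pi ^+ i * 0 by rewrite subrr mulr0.
  move: sB; rewrite -{1}(subnKC (ltnW lt)) => /(simmod_descend hO d0).
  rewrite raddf0 add0r => /(companion3_uniq cC cC')/(dvmxX i).
  by rewrite subnKC ?(ltnW lt) // opprD addrACA subrr add0r -scalerBr.
- have [e] := simmod_level_quadratic hO lt' lt (nE _ _ _ _ _) (nC _ cC)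
    (simmod_sym sB) (EQ _ _ _ _ _ _ _ N').
  by move/(companion_not_quadratic hO cC).
- by case: (simmod_scalar hO lt (nE _ _ _ _ _) sB).
- have [e] := simmod_level_quadratic hO lt lt' (nE _ _ _ _ _) (nS _ _ ua' dD') sB
    (EQ _ _ _ _ _ _ _ N).
  by move/(blk3_not_square hO ua' dD').
- have [e] := simmod_level_quadratic hO lt lt' (nE _ _ _ _ _) (nC _ cC') sB
    (EQ _ _ _ _ _ _ _ N).
  by move/(companion_not_quadratic hO cC').
have [Ei dd] := simmod_level hO lt lt' (nE _ _ _ _ _) (nE _ _ _ _ _) sB.
subst i'; have Ed := rep_inj rd rd' dd; subst d'.
have d0 : d - d = pi ^+ i * 0 by rewrite subrr mulr0.
move: sB; rewrite -{1}(subnKC (ltnW lt)) => /(simmod_descend hO d0).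
rewrite raddf0 add0r => /(E_normal_uniq hO rep_inj N N')/(dvmxX i).
by rewrite subnKC ?(ltnW lt) // opprD addrACA subrr add0r -scalerBr.
Qed.

End FormUniqueness.

(** * Centralisers over the residue field *)

Section FieldShadows.
Variable k : fieldType.
Implicit Types (X Y g : 'M[k]_3) (p q : {poly k}) (t : shadow_type).

Definition of_type t (R : set 'M[k]_3) : Prop :=
  exists2 M, type_model t M & exists2 g, g \in unitmx & R = conj_set g M.

Lemma conj_set1 (R : set 'M[k]_3) : conj_set 1%:M R = R.
Proof.
apply/seteqP; split=> [X [Y RY <-]|X RX]; first by rewrite mul1mx invmx1 mulmx1.
by exists X => //; rewrite mul1mx invmx1 mulmx1.
Qed.

Lemma conj_set_comp g h (R : set 'M[k]_3) : g \in unitmx -> h \in unitmx ->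
  conj_set g (conj_set h R) = conj_set (g *m h) R.
Proof.
move=> ug uh; have E : invmx (g *m h) = invmx h *m invmx g := invrM ug uh.
apply/seteqP; split=> [_ [_ [X RX <-] <-]|_ [X RX <-]].
  by exists X => //; rewrite E !mulmxA.
exists (h *m X *m invmx h); first by exists X.
by rewrite E !mulmxA.
Qed.

Lemma of_type_model t R : type_model t R -> of_type t R.
Proof. by move=> tR; exists R => //; exists 1%:M; rewrite ?unitmx1 ?conj_set1. Qed.

Lemma of_type_conj t g R : g \in unitmx -> of_type t R -> of_type t (conj_set g R).
Proof.
move=> ug [M tM [h uh ->]]; exists M => //; exists (g *m h).
  by rewrite unitmx_mul ug.
exact: conj_set_comp.
Qed.

Lemma mxminpoly_eq X p : p \is monic -> horner_mx X p = 0 ->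
  (forall q, (size q < size p)%N -> horner_mx X q = 0 -> q = 0) ->
  mxminpoly X = p.
Proof.
move=> mp Xp minp; have dvd := mxminpoly_min Xp.
have mX := mxminpoly_monic X.
apply/eqP; rewrite -eqp_monic // -dvdp_size_eqp // eqn_leq dvdp_leq ?monic_neq0 //=.
rewrite leqNgt; apply/negP => /minp/(_ (mx_root_minpoly X)) m0.
by move: mX; rewrite m0 monicE lead_coef0 eq_sym oner_eq0.
Qed.

Definition cyclic_basis X g : Prop :=
  [/\ g \in unitmx, X *m col 0 g = col 1 g & X *m col 1 g = col 2%:R g].

Lemma cyclic_ann X Y g : cyclic_basis X g -> Y *m X = X *m Y ->
  Y *m col 0 g = 0 -> Y = 0.
Proof.
move=> [ug g1 g2] YX Y0.
have Y1 : Y *m col 1 g = 0 by rewrite -g1 mulmxA YX -mulmxA Y0 mulmx0.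
have Y2 : Y *m col 2%:R g = 0 by rewrite -g2 mulmxA YX -mulmxA Y1 mulmx0.
rewrite -[Y](mulmxK ug); suff -> : Y *m g = 0 by rewrite mul0mx.
apply/matrixP => i j; rewrite [RHS]mxE.
have -> : (Y *m g) i j = (Y *m col j g) i 0.
  by rewrite !mxE; apply: eq_bigr => m _; rewrite mxE.
by move: j; apply: ord3P; rewrite ?Y0 ?Y1 ?Y2 mxE.
Qed.

(** Some polynomial in X of degree at most two agrees with Y on the cyclic vector; as both commute
    with X, they agree everywhere. *)
Lemma cyclic_centraliser X Y g : cyclic_basis X g -> Y *m X = X *m Y ->
  exists c0 c1 c2, Y = c0%:M + c1 *: X + c2 *: (X *m X).
Proof.
move=> cX YX; have [ug g1 g2] := cX.
have [c Yc] : exists c : 'cV[k]_3, Y *m col 0 g = g *m c.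
  by exists (invmx g *m (Y *m col 0 g)); rewrite mulKVmx.
exists (c 0 0), (c 1 0), (c 2%:R 0); apply/eqP; rewrite -subr_eq0; apply/eqP.
apply: (cyclic_ann cX).
  rewrite mulmxBl mulmxBr YX !mulmxDl !mulmxDr -!scalemxAl -!scalemxAr.
  by rewrite scalar_mxC mulmxA.
rewrite mulmxBl mulmxDl mulmxDl mul_scalar_mx -!scalemxAl -mulmxA g1 g2 Yc.
apply/colP => i; rewrite !mxE !big_ord_recl big_ord0 addr0.
rewrite (_ : lift ord0 (lift ord0 ord0) = 2%:R); last exact: val_inj.
by rewrite (_ : lift ord0 ord0 = 1); [ring | exact: val_inj].
Qed.

Lemma horner_mx_quadratic X (q : {poly k}) : (size q <= 3)%N ->
  horner_mx X q = (q`_0)%:M + q`_1 *: X + q`_2 *: (X *m X).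
Proof.
move=> sq; have -> : q = (q`_0)%:P + q`_1 *: 'X + q`_2 *: 'X^2.
  apply/polyP => i; rewrite !coefE.
  case: i => [|[|[|i]]] /=; rewrite ?(mulr0, mulr1, addr0, add0r) //.
  by rewrite nth_default //; apply: leq_trans sq _.
rewrite !rmorphD /= horner_mx_C !linearZ /= rmorphXn /= horner_mx_X expr2.
by rewrite !coefE /= !(mulr0, mulr1, addr0, add0r).
Qed.

(** An annihilating polynomial of degree at most two would be a linear relation between the columns
    of g. *)
Lemma cyclic_mxminpoly X g p : cyclic_basis X g -> p \is monic -> size p = 4 ->
  horner_mx X p = 0 -> mxminpoly X = p.
Proof.
move=> cX mp sp Xp; apply: mxminpoly_eq => // q; rewrite sp ltnS => sq.
rewrite horner_mx_quadratic // => qX; have [ug g1 g2] := cX.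
pose c : 'cV[k]_3 := \col_(i < 3) q`_i.
have : g *m c = 0.
  have <- : ((q`_0)%:M + q`_1 *: X + q`_2 *: (X *m X)) *m col 0 g = g *m c.
    rewrite mulmxDl mulmxDl mul_scalar_mx -!scalemxAl -mulmxA g1 g2.
    apply/colP => i; rewrite !mxE !big_ord_recl big_ord0 addr0 !mxE /=.
    rewrite (_ : lift ord0 (lift ord0 ord0) = 2%:R); last exact: val_inj.
    by rewrite (_ : lift ord0 ord0 = 1); [rewrite /bump /=; ring | exact: val_inj].
  by rewrite qX mul0mx.
move/(congr1 (mulmx (invmx g))); rewrite mulKmx // mulmx0 => /colP c0.
apply/polyP => i; rewrite coef0; have [lt_i3|le3i] := ltnP i 3.
  by have := c0 (Ordinal lt_i3); rewrite !mxE.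
by rewrite nth_default //; apply: leq_trans sq _.
Qed.

End FieldShadows.

(** * Factorisation of monic quadratics and cubics *)

Section Polynomials.
Variable k : fieldType.
Implicit Types (p q : {poly k}).

Lemma monic_mulXsubC a p : p \is monic ->
  ('X - a%:P) * p \is monic /\ size (('X - a%:P) * p) = (size p).+1.
Proof.
move=> mp; split; first by rewrite rpredM // monicXsubC.
by rewrite size_Mmonic ?polyXsubC_eq0 // size_XsubC.
Qed.

Lemma monic_factor p a : p \is monic -> root p a ->
  exists q, [/\ q \is monic, p = ('X - a%:P) * q & size p = (size q).+1].
Proof.
move=> mp /factor_theorem[q pE]; rewrite mulrC in pE; exists q.
have mq : q \is monic.
  by move: mp; rewrite pE !monicE lead_coef_monicM ?monicXsubC.
by split=> //; rewrite pE; case: (monic_mulXsubC a mq).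
Qed.

Lemma linear_factor p : p \is monic -> size p = 2 -> exists a, p = 'X - a%:P.
Proof.
move=> mp sp; exists (- p`_0); rewrite raddfN opprK; apply/polyP => i.
rewrite coefD coefX coefC; case: i => [|[|i]] /=; rewrite ?add0r ?addr0 //.
  by move: mp; rewrite monicE lead_coefE sp => /eqP.
by rewrite nth_default // sp.
Qed.

Lemma quadratic_cases p : p \is monic -> size p = 3 ->
  irreducible_poly p \/ exists a b, p = ('X - a%:P) * ('X - b%:P).
Proof.
move=> mp sp; have [[a ra]|nr] := pselect (exists a, root p a); [right|left].
  have [q [mq pE]] := monic_factor mp ra; rewrite sp => -[sq].
  by have [b qE] := linear_factor mq (esym sq); exists a, b; rewrite pE qE.
apply: cubic_irreducible; first by rewrite sp.
by move=> x; apply/negP => rx; apply: nr; exists x.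
Qed.

Lemma cubic_cases p : p \is monic -> size p = 4 ->
  [\/ irreducible_poly p,
      exists a q, [/\ irreducible_poly q, size q = 3 & p = ('X - a%:P) * q] |
      exists a b c, p = ('X - a%:P) * (('X - b%:P) * ('X - c%:P))].
Proof.
move=> mp sp; have [[a ra]|nr] := pselect (exists a, root p a); last first.
  apply: Or31; apply: cubic_irreducible; first by rewrite sp.
  by move=> x; apply/negP => rx; apply: nr; exists x.
have [q [mq pE]] := monic_factor mp ra; rewrite sp => -[sq].
have [iq|[b [c qE]]] := quadratic_cases mq (esym sq).
  by apply: Or32; exists a, q.
by apply: Or33; exists a, b, c; rewrite pE qE.
Qed.

Definition monic_poly (s : seq k) : {poly k} := Poly (rcons s 1).

Lemma monic_polyE s : monic_poly s = rcons s 1 :> seq k.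
Proof. by rewrite (@PolyK _ 0) // last_rcons oner_neq0. Qed.

Lemma monic_poly_monic s : monic_poly s \is monic.
Proof. by rewrite monicE lead_coefE monic_polyE size_rcons nth_rcons ltnn eqxx. Qed.

Lemma size_monic_poly s : size (monic_poly s) = (size s).+1.
Proof. by rewrite monic_polyE size_rcons. Qed.

End Polynomials.

(** * Types of centralisers of 3x3 companion matrices *)

Section CompanionShadows.
Variable k : fieldType.
Implicit Types (X Y g : 'M[k]_3).

Lemma cyclic_basis_m3 X (a b c d e f g h i x y z : k) :
  \det (m3 a b c d e f g h i) != 0 ->
  X *m m3 a b c d e f g h i = m3 b c x e f y h i z ->
  cyclic_basis X (m3 a b c d e f g h i).
Proof.
move=> ug E; rewrite /cyclic_basis unitmxE unitfE ug.
by split=> //; rewrite colE mulmxA E -colE; apply/colP; apply: ord3P; rewrite !mxE.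
Qed.

Lemma centraliser_similar X Y g : g \in unitmx -> g *m X = Y *m g ->
  mx_centraliser X = conj_set (invmx g) (mx_centraliser Y).
Proof.
move=> ug gX; have XE : X = invmx g *m Y *m g by rewrite -mulmxA -gX mulKmx.
rewrite /mx_centraliser; apply/seteqP; split=> [Z /= ZX|_ [Z /= ZY <-] /=].
  exists (g *m Z *m invmx g); last first.
    by rewrite invmxK !mulmxA mulVmx // mul1mx mulmxKV.
  have YE : Y = g *m X *m invmx g by rewrite gX mulmxK.
  by rewrite /= YE !mulmxA !mulmxKV // -!(mulmxA g) ZX.
by rewrite invmxK XE !mulmxA !mulmxK // -!(mulmxA (invmx g)) ZY.
Qed.

Lemma diagonal_centraliser (a b c : k) : a != b -> a != c -> b != c ->
  mx_centraliser (diag3 a b c) = [set diag3 x.1.1 x.1.2 x.2 | x in [set: k * k * k]].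
Proof.
move=> ab ac bc; rewrite /mx_centraliser diag3_m3; apply/seteqP; split=> [Y|_ [x _ <-]] /=.
  rewrite (m3_eta Y) !mul_m3 !(mulr0, mul0r, addr0, add0r).
  move=> /m3_inj[[_ h01 h02] [[h10 _ h12] [h20 h21 _]]].
  have z (x y m : k) : x != y -> m * x = y * m -> m = 0.
    move=> xy /eqP; rewrite mulrC -subr_eq0 -mulrBl mulf_eq0 subr_eq0 (negPf xy).
    by move/eqP.
  exists (Y 0 0, Y 1 1, Y 2%:R 2%:R) => //=; rewrite diag3_m3.
  rewrite (z b a _ _ h01) ?(z c a _ _ h02) ?(z a b _ _ h10) ?(z c b _ _ h12)
    ?(z a c _ _ h20) ?(z b c _ _ h21) //; by rewrite eq_sym.
by rewrite diag3_m3 !mul_m3 !(mulr0, mul0r, addr0, add0r); congr m3; rewrite mulrC.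
Qed.

Lemma horner_companion3 (c : 'I_3 -> k) :
  horner_mx (companion c) (monic_poly [:: c 0; c 1; c 2%:R]) = 0.
Proof.
rewrite /monic_poly /= !cons_poly_def mul0r add0r.
rewrite !(rmorphD, rmorphM) /= !horner_mx_C horner_mx_X companion3E.
rewrite -!mulmxE !scalar_m3 !(mul_m3, add_m3).
by apply: mx3P; rewrite !mxE /=; ring.
Qed.

Lemma companion3_cyclic (c : 'I_3 -> k) : cyclic_basis (companion c) 1%:M.
Proof.
rewrite scalar_m3 companion3E; apply: cyclic_basis_m3; last first.
  by rewrite mul_m3 !(mulr0, mul0r, mulr1, addr0, add0r).
by rewrite det_m3 !(mulr0, mul0r, mulr1, mul1r, subr0, addr0) oner_neq0.
Qed.

(** The minimal polynomial has degree three, and its factorisation gives the type. For three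
    distinct roots the model is the diagonal algebra, so the matrix is diagonalised explicitly. *)
Lemma companion3_of_type (c : 'I_3 -> k) :
  exists t, (t = tT1 \/ t = tT2 \/ t = tT3 \/ t = tM \/ t = tN) /\
    of_type t (mx_centraliser (companion c)).
Proof.
pose p := monic_poly [:: c 0; c 1; c 2%:R].
have mp : p \is monic by apply: monic_poly_monic.
have sp : size p = 4 by rewrite size_monic_poly.
have minp := cyclic_mxminpoly (companion3_cyclic c) mp sp (horner_companion3 c).
have cent t : minpoly_form t p -> t <> tT1 -> t <> tK0 -> t <> tKoo ->
    of_type t (mx_centraliser (companion c)).
  move=> ft nT1 nK0 nKoo; apply: of_type_model.
  by case: t ft nT1 nK0 nKoo => //= ft _ _ _; exists (companion c); rewrite ?minp.
have [ip|[a [q [iq sq pE]]]|[a [b [d pE]]]] := cubic_cases mp sp.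
- by exists tT3; split; [do 2!right; left|apply: cent].
- by exists tT2; split; [right; left|apply: cent => //; exists a, q].
have tMc x y : x <> y -> p = ('X - x%:P) * ('X - y%:P) ^+ 2 ->
    exists t, (t = tT1 \/ t = tT2 \/ t = tT3 \/ t = tM \/ t = tN) /\
    of_type t (mx_centraliser (companion c)).
  move=> xy pxy; exists tM; split; first by do 3!right; left.
  by apply: cent => //; exists x, y.
have [eab|nab] := eqVneq a b.
  have [ead|nad] := eqVneq a d.
    exists tN; split; first by do 4!right.
    by apply: cent => //; exists a; rewrite pE -eab -ead exprS expr2.
  apply: (tMc d a); first by move=> e; rewrite e eqxx in nad.
  by rewrite pE -eab mulrA -expr2 mulrC.
have [ead|nad] := eqVneq a d.
  apply: (tMc b a); first by move=> e; rewrite e eqxx in nab.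
  by rewrite pE -ead mulrCA expr2.
have [ebd|nbd] := eqVneq b d.
  by apply: (tMc a b); [apply/eqP|rewrite pE -ebd expr2].
have rt x : root p x -> c 0 + c 1 * x + c 2%:R * x ^+ 2 + x ^+ 3 = 0.
  rewrite /root /p /monic_poly horner_Poly /= => /eqP <-; ring.
have ra := rt a; have rb := rt b; have rd := rt d.
rewrite pE !rootM !root_XsubC !eqxx !orbT /= in ra rb rd.
(* Vandermonde matrix: for a root x, (1, x, x^2) is a left eigenvector of the companion matrix. *)
pose V := m3 1 a (a ^+ 2) 1 b (b ^+ 2) 1 d (d ^+ 2).
have uV : V \in unitmx.
  rewrite unitmxE unitfE det_m3 (_ : _ + _ = (b - a) * (d - a) * (d - b)); last by ring.
  by rewrite !mulf_neq0 // subr_eq0 eq_sym.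
have VC : V *m companion c = diag3 a b d *m V.
  rewrite companion3E diag3_m3 !mul_m3; congr m3; try ring.
  - transitivity (a ^+ 3 - (c 0 + c 1 * a + c 2%:R * a ^+ 2 + a ^+ 3)).
      by ring.
    by rewrite ra //; ring.
  - transitivity (b ^+ 3 - (c 0 + c 1 * b + c 2%:R * b ^+ 2 + b ^+ 3)).
      by ring.
    by rewrite rb //; ring.
  - transitivity (d ^+ 3 - (c 0 + c 1 * d + c 2%:R * d ^+ 2 + d ^+ 3)).
      by ring.
    by rewrite rd //; ring.
exists tT1; split; first by left.
rewrite (centraliser_similar uV VC) diagonal_centraliser //.
by apply: of_type_conj; [rewrite unitmx_inv|apply: of_type_model].
Qed.

End CompanionShadows.

(** * Types of block centralisers *)

Section BlockShadows.
Variable k : fieldType.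
Implicit Types (X Y g : 'M[k]_3).

(** The upper left entry is free, as in the centraliser of [blk3 a C] for a outside the spectrum of
    C. Such an a need not exist in k, so the algebra is defined directly. *)
Definition block_centraliser (C : 'M[k]_2) : set 'M[k]_3 :=
  [set Y | exists x W, W *m C = C *m W /\ Y = blk3 x W].

Lemma companion2_comm (R : comUnitRingType) (c : 'I_2 -> R) W :
  W *m companion c = companion c *m W ->
  W = (W 0 0)%:M + W 1 0 *: companion c.
Proof.
rewrite companion2E (m2_eta W) !mul_m2 => /m2_inj[e1 _ e2 _].
apply: mx2P; rewrite !mxE /=.
- by ring.
- by rewrite -[LHS]addr0; transitivity (W 0 0 * 0 + W 0 1 * 1);
    [ring | rewrite e1; ring].
- by ring.
- by transitivity (W 1 0 * 0 + W 1 1 * 1); [ring | rewrite e2; ring].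
Qed.

(** The vector e1 + e2 is cyclic: the determinant of its iterates is the characteristic polynomial
    of C at a. *)
Lemma block_cyclic a (c : 'I_2 -> k) : a ^+ 2 + c 1 * a + c 0 != 0 ->
  cyclic_basis (blk3 a (companion c)) (m3 1 a (a ^+ 2) 1 0 (- c 0) 0 1 (- c 1)).
Proof.
move=> na; rewrite /blk3 companion2E !mxE /=; apply: cyclic_basis_m3.
  by rewrite det_m3; apply: contraNneq na => <-; apply/eqP; ring.
by rewrite mul_m3; congr m3; ring.
Qed.

Lemma block_centraliserE a (c : 'I_2 -> k) : a ^+ 2 + c 1 * a + c 0 != 0 ->
  block_centraliser (companion c) = mx_centraliser (blk3 a (companion c)).
Proof.
move=> na; rewrite /block_centraliser /mx_centraliser.
apply/seteqP; split=> Y /=.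
  by move=> [x [W [WC ->]]]; rewrite !blk3_mul WC mulrC.
move=> YX; have [c0 [c1 [c2 ->]]] := cyclic_centraliser (block_cyclic na) YX.
exists (c0 + c1 * a + c2 * (a * a)),
  (c0%:M + c1 *: companion c + c2 *: (companion c *m companion c)).
split.
  by rewrite !mulmxDl !mulmxDr -!scalemxAl -!scalemxAr scalar_mxC mulmxA.
rewrite blk3_mul scalar_m3 !scale_m3 !add_m3 /blk3 [in RHS]mxE.
by apply: mx3P; rewrite !mxE /= ?mulr0 ?addr0 // !mulr1n ?mulr0n ?add0r.
Qed.

Lemma block_mxminpoly a (c : 'I_2 -> k) : a ^+ 2 + c 1 * a + c 0 != 0 ->
  mxminpoly (blk3 a (companion c)) =
  ('X - a%:P) * monic_poly [:: c 0; c 1].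
Proof.
move=> na; have [mp sp] := monic_mulXsubC a (monic_poly_monic [:: c 0; c 1]).
apply: (cyclic_mxminpoly (block_cyclic na) mp).
  by rewrite sp size_monic_poly.
rewrite /monic_poly /= !cons_poly_def mul0r add0r.
rewrite !(rmorphB, rmorphD, rmorphM) /= !horner_mx_C horner_mx_X companion2E.
rewrite -!mulmxE /blk3 !mxE /= !scalar_m3 !(opp_m3, mul_m3, add_m3).
by apply: mx3P; rewrite !mxE /=; ring.
Qed.

Lemma companion2_of_type (c : 'I_2 -> k) :
  exists t, (t = tT1 \/ t = tT2 \/ t = tM) /\
    of_type t (block_centraliser (companion c)).
Proof.
pose p := monic_poly [:: c 0; c 1].
have mp : p \is monic by apply: monic_poly_monic.
have sp : size p = 3 by rewrite size_monic_poly.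
have rtE x : p.[x] = x ^+ 2 + c 1 * x + c 0.
  by rewrite /p /monic_poly horner_Poly /=; ring.
have [ip|[a [b pE]]] := quadratic_cases mp sp.
  have n0 : 0 ^+ 2 + c 1 * 0 + c 0 != 0.
    rewrite -rtE -rootE; apply/negP => r0.
    have [_ /(_ ('X - 0%:P))] := ip.
    rewrite size_XsubC dvdp_XsubCl => /(_ isT r0)/eqp_size.
    by rewrite size_XsubC sp.
  exists tT2; split; first by right; left.
  rewrite (block_centraliserE n0); apply: of_type_model.
  by exists (blk3 0 (companion c)) => //; rewrite block_mxminpoly //; exists 0, p.
have [eab|nab] := eqVneq a b.
  (* The element b + 1 differs from the only root b, over every field. *)
  have n1 : (b + 1) ^+ 2 + c 1 * (b + 1) + c 0 != 0.
    rewrite -rtE -rootE pE -eab rootM !root_XsubC orbb.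
    by rewrite -subr_eq0 addrAC subrr add0r oner_neq0.
  exists tM; split; first by right; right.
  rewrite (block_centraliserE n1); apply: of_type_model.
  exists (blk3 (b + 1) (companion c)) => //; rewrite block_mxminpoly //.
  exists (b + 1), b; split; last by rewrite -/p pE eab expr2.
  by move/eqP; rewrite -subr_eq0 addrAC subrr add0r oner_eq0.
have rt x : root p x -> x ^+ 2 + c 1 * x + c 0 = 0.
  by rewrite rootE rtE => /eqP.
have ra := rt a; have rb := rt b.
rewrite pE !rootM !root_XsubC !eqxx !orbT /= in ra rb.
(* Over the field with two elements nothing differs from both roots, so the algebra is conjugated to
   the diagonal one directly. The rows of V are left eigenvectors. *)
pose V := m2 1 a 1 b; pose D := m2 a 0 0 b.
have uV2 : V \in unitmx.
  by rewrite unitmxE unitfE det_m2 mul1r mulr1 subr_eq0 eq_sym.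
have uV : blk3 1 V \in unitmx by rewrite unitmxE blk3_det mul1r -unitmxE.
have VC : V *m companion c = D *m V.
  rewrite companion2E !mul_m2; congr m2; try ring.
  - transitivity (a ^+ 2 - (a ^+ 2 + c 1 * a + c 0)); first by ring.
    by rewrite ra //; ring.
  - transitivity (b ^+ 2 - (b ^+ 2 + c 1 * b + c 0)); first by ring.
    by rewrite rb //; ring.
exists tT1; split; first by left.
suff -> : block_centraliser (companion c) = conj_set (invmx (blk3 1 V))
    [set diag3 x.1.1 x.1.2 x.2 | x in [set: k * k * k]].
  by apply: of_type_conj; [rewrite unitmx_inv|apply: of_type_model].
have CE : companion c = invmx V *m D *m V by rewrite -mulmxA -VC mulKmx.
have DE : D = V *m companion c *m invmx V by rewrite VC mulmxK.
have invV x W : blk3 1 V *m blk3 x W *m invmx (blk3 1 V) = blk3 x (V *m W *m invmx V).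
  rewrite (_ : _ *m blk3 x W = blk3 x (V *m W *m invmx V) *m blk3 1 V) ?mulmxK //.
  by rewrite !blk3_mul mulmxKV // mul1r mulr1.
have invV' x W : invmx (blk3 1 V) *m blk3 x W *m blk3 1 V = blk3 x (invmx V *m W *m V).
  rewrite -[RHS](mulKmx uV) -mulmxA; congr (_ *m _).
  by rewrite !blk3_mul mul1r mulr1 !mulmxA mulmxV // mul1mx.
rewrite /block_centraliser; apply/seteqP; split=> [Y [x [W [WC ->]]]|_ [_ [y _ <-] <-]] /=.
  have : (V *m W *m invmx V) *m D = D *m (V *m W *m invmx V).
    by rewrite DE !mulmxA !mulmxKV // -!(mulmxA V) WC.
  set Z := _ *m invmx V; rewrite (m2_eta Z) !mul_m2 => /m2_inj[_ e1 e2 _].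
  have z01 : Z 0 1 = 0.
    apply/eqP; have : Z 0 1 * (b - a) == 0.
      rewrite -subr_eq0 in nab; apply/eqP.
      transitivity ((Z 0 0 * 0 + Z 0 1 * b) - (a * Z 0 1 + 0 * Z 1 1)); first by ring.
      by rewrite e1 subrr.
    by rewrite mulf_eq0 subr_eq0 [b == a]eq_sym (negPf nab) orbF.
  have z10 : Z 1 0 = 0.
    apply/eqP; have : Z 1 0 * (b - a) == 0.
      apply/eqP; transitivity ((0 * Z 0 0 + b * Z 1 0) - (Z 1 0 * a + Z 1 1 * 0)).
        by ring.
      by rewrite e2 subrr.
    by rewrite mulf_eq0 subr_eq0 [b == a]eq_sym (negPf nab) orbF.
  exists (diag3 x (Z 0 0) (Z 1 1)); first by exists (x, Z 0 0, Z 1 1).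
  rewrite invmxK; have -> : diag3 x (Z 0 0) (Z 1 1) = blk3 x Z.
    by rewrite diag3_m3 /blk3 z01 z10.
  by rewrite invV' /Z !mulmxA mulVmx // mul1mx mulmxKV.
rewrite invmxK diag3_m3.
have -> : m3 y.1.1 0 0 0 y.1.2 0 0 0 y.2 = blk3 y.1.1 (m2 y.1.2 0 0 y.2).
  by rewrite /blk3 !mxE.
exists y.1.1, (invmx V *m m2 y.1.2 0 0 y.2 *m V); split; last exact: invV'.
rewrite CE !mulmxA !mulmxK // -!(mulmxA (invmx V)) /D !mul_m2; congr (_ *m _).
by congr m2; ring.
Qed.

End BlockShadows.

(** * The remaining types *)

Section OtherShadows.
Variable k : fieldType.
Implicit Types (X Y g : 'M[k]_3).

Lemma horner_mx_linear X (q : {poly k}) : (size q <= 2)%N ->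
  horner_mx X q = (q`_0)%:M + q`_1 *: X.
Proof.
move=> sq; rewrite horner_mx_quadratic ?(leqW sq) //.
by rewrite (nth_default _ sq) scale0r addr0.
Qed.

Lemma poly_size2_eq0 (q : {poly k}) : (size q <= 2)%N ->
  q`_0 = 0 -> q`_1 = 0 -> q = 0.
Proof.
move=> sq q0 q1; apply/polyP => i; rewrite coef0; case: i => [|[|i]] //.
by rewrite nth_default //; apply: leq_trans sq _.
Qed.

Lemma full_of_type : of_type tG [set: 'M[k]_3].
Proof.
apply: of_type_model; exists 0 => /=.
  exists 0; apply: mxminpoly_eq => [||q]; first exact: monicXsubC.
    by rewrite rmorphB /= horner_mx_X horner_mx_C raddf0 subr0.
  rewrite size_XsubC ltnS => sq; rewrite horner_mx_linear ?(leqW sq) //.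
  rewrite scaler0 addr0 => /matrixP/(_ 0 0); rewrite !mxE => q0.
  by apply: poly_size2_eq0; rewrite ?(leqW sq) // nth_default.
by rewrite /mx_centraliser; apply/seteqP; split=> Y //= _; rewrite mulmx0 mul0mx.
Qed.

Lemma block_of_type : of_type tL [set Y : 'M[k]_3 | exists x W, Y = blk3 x W].
Proof.
apply: of_type_model; exists (diag3 1 0 0) => /=.
  exists 1, 0; split; first exact/eqP/oner_neq0.
  have [mp sp] := monic_mulXsubC (1 : k) (monicXsubC 0).
  apply: mxminpoly_eq => [//||q].
    rewrite rmorphM !rmorphB /= horner_mx_X !horner_mx_C raddf0 subr0 -mulmxE.
    rewrite diag3_m3 scalar_m3 opp_m3 add_m3 mul_m3.
    by apply: mx3P; rewrite !mxE /=; ring.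
  rewrite sp size_XsubC ltnS => sq; rewrite horner_mx_linear // => /matrixP qX.
  have := qX 0 0; have := qX 1 1; rewrite diag3_m3 !mxE /= mulr0 addr0 mulr1n => q0.
  by rewrite q0 add0r mulr1 => q1; apply: poly_size2_eq0.
rewrite /mx_centraliser; apply/seteqP; split=> Y /=.
  by move=> [x [W ->]]; rewrite diag3_m3 !mul_m3; congr m3; ring.
rewrite (m3_eta Y) diag3_m3 !mul_m3 => /m3_inj[[_ e1 e2] [[e3 _ _] [e4 _ _]]].
exists (Y 0 0), (m2 (Y 1 1) (Y 1 2%:R) (Y 2%:R 1) (Y 2%:R 2%:R)).
rewrite /blk3 !mxE /=; congr m3.
- by transitivity (1 * Y 0 1 + 0 * Y 1 1 + 0 * Y 2%:R 1); [ring|rewrite -e1; ring].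
- by transitivity (1 * Y 0 2%:R + 0 * Y 1 2%:R + 0 * Y 2%:R 2%:R);
    [ring|rewrite -e2; ring].
- by transitivity (Y 1 0 * 1 + Y 1 1 * 0 + Y 1 2%:R * 0); [ring|rewrite e3; ring].
- by transitivity (Y 2%:R 0 * 1 + Y 2%:R 1 * 0 + Y 2%:R 2%:R * 0);
    [ring|rewrite e4; ring].
Qed.

Lemma jordan_of_type : of_type tJ
  [set Y : 'M[k]_3 | exists p r s t u, Y = m3 p 0 r s t u 0 0 t].
Proof.
apply: of_type_model; exists (m3 0 0 0 0 0 1 0 0 0) => /=.
  exists 0; rewrite expr2.
  have [mp sp] := monic_mulXsubC (0 : k) (monicXsubC 0).
  apply: mxminpoly_eq => [//||q].
    rewrite rmorphM !rmorphB /= horner_mx_X !horner_mx_C raddf0 subr0 -mulmxE.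
    by rewrite mul_m3; apply: mx3P; rewrite !mxE /=; ring.
  rewrite sp size_XsubC ltnS => sq; rewrite horner_mx_linear // => /matrixP qX.
  have := qX 0 0; have := qX 1 2%:R; rewrite !mxE /= mulr0 !addr0 mulr1n mulr1.
  by rewrite mulr0n add0r => q1 q0; apply: poly_size2_eq0.
rewrite /mx_centraliser; apply/seteqP; split=> Y /=.
  by move=> [p [r [s [t [u ->]]]]]; rewrite !mul_m3; congr m3; ring.
rewrite (m3_eta Y) !mul_m3 => /m3_inj[[_ _ e1] [[e2 e3 e4] [_ _ e5]]].
exists (Y 0 0), (Y 0 2%:R), (Y 1 0), (Y 1 1), (Y 1 2%:R); congr m3.
- by transitivity (Y 0 0 * 0 + Y 0 1 * 1 + Y 0 2%:R * 0); [ring|rewrite e1; ring].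
- by transitivity (0 * Y 0 0 + 0 * Y 1 0 + 1 * Y 2%:R 0); [ring|rewrite -e2; ring].
- by transitivity (0 * Y 0 1 + 0 * Y 1 1 + 1 * Y 2%:R 1); [ring|rewrite -e3; ring].
- by transitivity (0 * Y 0 2%:R + 0 * Y 1 2%:R + 1 * Y 2%:R 2%:R);
    [ring|rewrite -e4; ring].
Qed.

(** For x = pi^mu, al and be are the residues of a/pi^mu and b/pi^mu, and the vector (r, s, w) of
    the overview is r (1, al, be). *)
Definition E_shadow (al be : k) : set 'M[k]_3 :=
  [set Y | exists p r u, Y = m3 p 0 r (al * r) (p + be * r) u 0 0 (p + be * r)].

(** The element of the algebra with p = 0 and r = 1 has e3 as cyclic vector, with determinant al +
    be u; the free entry u serves to make it nonzero. *)
Lemma E_shadow_cyclic (al be u : k) : al + be * u != 0 ->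
  cyclic_basis (m3 0 0 1 al be u 0 0 be)
    (m3 0 1 be 0 u (al + be * u + u * be) 1 be (be * be)).
Proof.
move=> nz; apply: cyclic_basis_m3.
  by rewrite det_m3; apply: contraNneq nz => <-; apply/eqP; ring.
by rewrite mul_m3; congr m3; ring.
Qed.

Lemma E_shadow_centraliser (al be u : k) : al + be * u != 0 ->
  E_shadow al be = mx_centraliser (m3 0 0 1 al be u 0 0 be).
Proof.
move=> nz; rewrite /mx_centraliser /E_shadow; apply/seteqP; split=> Y /=.
  by move=> [p [r [v ->]]]; rewrite !mul_m3; congr m3; ring.
move=> /(cyclic_centraliser (E_shadow_cyclic nz))[c0 [c1 [c2 ->]]].
rewrite mul_m3 scalar_m3 !scale_m3 !add_m3.
exists c0, (c1 + c2 * be), (c1 * u + c2 * (al + be * u + u * be)).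
by congr m3; ring.
Qed.

Lemma E_shadow_M (al be : k) : be != 0 -> of_type tM (E_shadow al be).
Proof.
(* This u makes al + be u equal to 1, and the generator has the eigenvalues 0, be, be. *)
move=> nb; pose u := (1 - al) / be.
have nz : al + be * u != 0.
  by rewrite /u mulrC divfK // addrCA subrr addr0 oner_neq0.
rewrite (E_shadow_centraliser nz); apply: of_type_model.
exists (m3 0 0 1 al be u 0 0 be) => //; exists 0, be; split.
  by move=> e; rewrite -e eqxx in nb.
have [m1 s1] := monic_mulXsubC be (monicXsubC be).
have [mp sp] := monic_mulXsubC 0 m1; rewrite expr2.
apply: (cyclic_mxminpoly (E_shadow_cyclic nz) mp).
  by rewrite sp s1 size_XsubC.
rewrite !rmorphM !rmorphB /= horner_mx_X !horner_mx_C -!mulmxE.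
rewrite !scalar_m3 !opp_m3 !add_m3 !mul_m3.
by apply: mx3P; rewrite !mxE /=; ring.
Qed.

Lemma E_shadow_N (al : k) : al != 0 -> of_type tN (E_shadow al 0).
Proof.
move=> na; have nz : al + 0 * 0 != 0 by rewrite mul0r addr0.
rewrite (E_shadow_centraliser nz); apply: of_type_model.
exists (m3 0 0 1 al 0 0 0 0 0) => //; exists 0.
have [m1 s1] := monic_mulXsubC (0 : k) (monicXsubC 0).
have [mp sp] := monic_mulXsubC 0 m1; rewrite exprS expr2.
apply: (cyclic_mxminpoly (E_shadow_cyclic nz) mp).
  by rewrite sp s1 size_XsubC.
rewrite !rmorphM !rmorphB /= horner_mx_X !horner_mx_C -!mulmxE.
rewrite !scalar_m3 !opp_m3 !add_m3 !mul_m3.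
by apply: mx3P; rewrite !mxE /=; ring.
Qed.

Lemma E_shadow_K0 : of_type tK0 (E_shadow 0 0).
Proof.
apply: of_type_model; rewrite /= /E_shadow; apply/seteqP; split=> Y /=.
  by move=> [p [r [u ->]]]; exists p, r, u; rewrite !mul0r addr0.
by move=> [p [r [u ->]]]; exists p, r, u; rewrite !mul0r addr0.
Qed.

Lemma Koo_of_type : of_type tKoo
  [set Y : 'M[k]_3 | exists p s u, Y = m3 p 0 0 s p u 0 0 p].
Proof. by apply: of_type_model. Qed.

End OtherShadows.

(** * Shadows of the normal forms *)

Section LiftedShadows.
Variables (O : idomainType) (pi : O).
Hypothesis hO : compact_dvr pi.
Variables (k : fieldType) (res : {rmorphism O -> k}).
Hypothesis hres : is_reduction pi 1 res.
Local Notation dv := (dv pi).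
Local Notation dvmx := (dvmx pi).
Local Notation simmod := (simmod pi).
Local Notation resm := (map_mx res).

Lemma res_eq0 x : res x = 0 <-> dv 1 x.
Proof. by have [_ /(_ x)] := hres. Qed.

Lemma res_eq x y : dv 1 (x - y) -> res x = res y.
Proof. by move/res_eq0/eqP; rewrite rmorphB subr_eq0 => /eqP. Qed.

Lemma res_surj y : exists x, res x = y.
Proof. by have [+ _] := hres; apply. Qed.

Lemma resm_unit N (g : 'M[O]_N) : g \in unitmx -> resm g \in unitmx.
Proof. by rewrite !unitmxE det_map_mx; apply: rmorph_unit. Qed.

Lemma resm_eq N (A B : 'M[O]_N) : dvmx 1 (A - B) -> resm A = resm B.
Proof.
move=> dAB; apply/matrixP => i j; rewrite !mxE; apply: res_eq.
by move: (dAB i j); rewrite !mxE.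
Qed.

Definition lifted_shadow n (B : 'M[O]_3) : set 'M[k]_3 :=
  [set resm X | X in [set X | dvmx n (X *m B - B *m X)]].

Lemma lifted_shadow_affine l i d A : (i <= l)%N ->
  lifted_shadow l (d%:M + pi ^+ i *: A) = lifted_shadow (l - i) A.
Proof.
move=> le_il; have E X : dvmx l (X *m (d%:M + pi ^+ i *: A) -
    (d%:M + pi ^+ i *: A) *m X) <-> dvmx (l - i) (X *m A - A *m X).
  rewrite commr_sub_scalar subrr scale0r add0r -scalerBr -{1}(subnKC le_il).
  by split=> [/(dvmx_canc hO)|/(dvmxX i)].
by apply/seteqP; split=> Y [X /E]; exists X.
Qed.

Lemma lifted_shadow_simmod n B B' : simmod n B B' ->
  exists2 g, g \in unitmx & lifted_shadow n B' = conj_set g (lifted_shadow n B).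
Proof.
move=> [g ug dg]; exists (resm g); first exact: resm_unit.
have conj h X (A A' : 'M[O]_3) : h \in unitmx -> dvmx n (h *m A - A' *m h) ->
    dvmx n (X *m A - A *m X) ->
    dvmx n (h *m X *m invmx h *m A' - A' *m (h *m X *m invmx h)).
  move=> uh dh dX; apply: (dvmx_unitr uh).
  have Yh : h *m X *m invmx h *m h = h *m X by rewrite mulmxKV.
  move: (h *m X *m invmx h) Yh => Y Yh.
  have -> : (Y *m A' - A' *m Y) *m h =
      h *m (X *m A - A *m X) + (h *m A - A' *m h) *m X - Y *m (h *m A - A' *m h).
    rewrite !mulmxBl !mulmxBr !mulmxA Yh -(mulmxA A' Y) Yh mulmxA.
    by rewrite opprB [X in _ = X + _]addrA subrK [RHS]addrC addrA subrK.
  apply: dvmxB; last exact: dvmxMl.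
  by apply: dvmxD; [apply: dvmxMl|apply: dvmxMr].
have dg' : dvmx n (invmx g *m B' - B *m invmx g).
  apply: (dvmx_unitr ug); apply: (dvmx_unitl ug).
  by rewrite mulmxBl mulmxKV // mulmxBr !mulmxA mulmxV // mul1mx; apply: dvmx_subC.
have resmV : resm (invmx g) = invmx (resm g).
  rewrite -[LHS](mulmxK (resm_unit ug)) -map_mxM mulVmx // map_mx1 mul1mx.
  by [].
apply/seteqP; split=> [_ [X /= dX <-]|_ [_ [X /= dX <-] <-]].
  have ug' : invmx g \in unitmx by rewrite unitmx_inv.
  exists (resm (invmx g *m X *m g)).
    by exists (invmx g *m X *m g) => //=; have := conj _ _ _ _ ug' dg' dX; rewrite invmxK.
  by rewrite -resmV -!map_mxM !mulmxA mulmxV // mul1mx mulmxK.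
exists (g *m X *m invmx g); first exact: conj.
by rewrite !map_mxM resmV.
Qed.

Lemma resm_surj N (Y : 'M[k]_N) : exists X, resm X = Y.
Proof.
pose lift y := sval (cid (res_surj y)).
exists (map_mx lift Y); apply/matrixP => i j.
by rewrite !mxE /lift; case: cid.
Qed.

Lemma lifted_shadow_scalar n d : lifted_shadow n d%:M = [set: 'M[k]_3].
Proof.
apply/seteqP; split=> // Y _; have [X <-] := resm_surj Y.
by exists X => //=; rewrite scalar_mxC subrr; apply: dvmx0.
Qed.

Lemma lifted_shadow_companion n (c : 'I_3 -> O) : (0 < n)%N ->
  lifted_shadow n (companion c) = mx_centraliser (companion (res \o c)).
Proof.
move=> n0; rewrite /mx_centraliser; apply/seteqP; split=> [_ [X /= dX <-]|Y /=].
  rewrite -map_companion -!map_mxM; apply: resm_eq; exact: dvmxW dX.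
move=> /(cyclic_centraliser (companion3_cyclic _))[c0 [c1 [c2 ->]]].
have [x0 <-] := res_surj c0; have [x1 <-] := res_surj c1.
have [x2 <-] := res_surj c2.
exists (x0%:M + x1 *: companion c + x2 *: (companion c *m companion c)).
  rewrite /= !mulmxDl !mulmxDr -!scalemxAl -!scalemxAr scalar_mxC mulmxA subrr.
  exact: dvmx0.
by rewrite !map_mxD !map_mxZ map_mxM map_scalar_mx map_companion.
Qed.

(** Since D vanishes modulo pi, the off-diagonal blocks of the commutator are there, up to sign, a
    times those of X, and a is a unit. *)
Lemma blk3_comm n a D X : (0 < n)%N -> a \is a GRing.unit -> dvmx 1 D ->
  dvmx n (X *m blk3 a D - blk3 a D *m X) ->
  let W := m2 (X 1 1) (X 1 2%:R) (X 2%:R 1) (X 2%:R 2%:R) in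
  resm X = blk3 (res (X 0 0)) (resm W) /\ dvmx n (W *m D - D *m W).
Proof.
move=> n0 ua dD; rewrite (m3_eta X) (m2_eta D) /blk3 ![m2 _ _ _ _ _ _]mxE /=.
move: (X 0 0) (X 0 1) (X 0 2%:R) (X 1 0) (X 1 1) (X 1 2%:R)
  (X 2%:R 0) (X 2%:R 1) (X 2%:R 2%:R) => p q r s t u v w z.
have d00 := dD 0 0; have d01 := dD 0 1; have d10 := dD 1 0; have d11 := dD 1 1.
rewrite !mul_m3 opp_m3 add_m3 !(mulr0, mul0r, addr0, add0r).
move=> /dvmx_m3[[_ h01 h02] [[h10 h11 h12] [h20 h21 h22]]].
rewrite ![m3 _ _ _ _ _ _ _ _ _ _ _]mxE /= map_m3.
have z0 x : dv 1 (a * x) -> res x = 0.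
  by move=> dax; apply/res_eq0; apply: dv_unitl dax.
rewrite (z0 q) ?(z0 r) ?(z0 s) ?(z0 v).
- split; first by rewrite !mxE.
  by rewrite !mul_m2 => i j; rewrite !mxE; move: i j; apply: ord2P; apply: ord2P.
- by have {}h20 := dvW n0 h20; dvcomb (v * a -
    (D 1 0 * s + D 1 1 * v) + D 1 0 * s + D 1 1 * v).
- by have {}h10 := dvW n0 h10; dvcomb (s * a -
    (D 0 0 * s + D 0 1 * v) + D 0 0 * s + D 0 1 * v).
- by have {}h02 := dvW n0 h02; dvcomb (q * D 0 1 +
    r * D 1 1 - (q * D 0 1 + r * D 1 1 - a * r)).
- by have {}h01 := dvW n0 h01; dvcomb (q * D 0 0 +
    r * D 1 0 - (q * D 0 0 + r * D 1 0 - a * q)).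
Qed.

Lemma lifted_shadow_ii n a : (0 < n)%N -> a \is a GRing.unit ->
  lifted_shadow n (diag3 a 0 0) = [set Y | exists x W, Y = blk3 x W].
Proof.
move=> n0 ua; rewrite diag3_blk3.
have d0 : dvmx 1 (0 : 'M[O]_2) by apply: dvmx0.
apply/seteqP; split=> [_ [X /= dX <-]|_ [x [W ->]]].
  have [-> _] := blk3_comm n0 ua d0 dX.
  by eexists; eexists.
have [y <-] := res_surj x; have [V <-] := resm_surj W.
exists (blk3 y V); last by rewrite map_blk3.
by rewrite /= !blk3_mul mulmx0 mul0mx mulrC subrr; apply: dvmx0.
Qed.

(** The lower block commutes with pi^j C modulo pi^n, hence with C modulo pi as j < n. Conversely, a
    matrix w0 + w1 C over the residue field lifts to one that commutes with C exactly. *)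
Lemma lifted_shadow_iii n j a (c : 'I_2 -> O) : (0 < j < n)%N ->
  a \is a GRing.unit ->
  lifted_shadow n (blk3 a (pi ^+ j *: companion c)) =
  block_centraliser (companion (res \o c)).
Proof.
move=> /andP[j0 lt_jn] ua; have n0 := ltn_trans j0 lt_jn.
have dC : dvmx 1 (pi ^+ j *: companion c) by apply: dvmxW j0 (dvmxXl _ _ _).
rewrite /block_centraliser; apply/seteqP; split=> [_ [X /= dX <-]|_ [x [W [WC ->]]]].
  have [-> dW] := blk3_comm n0 ua dC dX; eexists; eexists; split; last by [].
  rewrite -map_companion -!map_mxM; apply: resm_eq.
  move: dW; rewrite -scalemxAl -scalemxAr -scalerBr -{1}(subnKC (ltnW lt_jn)).
  by move=> /(dvmx_canc hO); apply: dvmxW; rewrite subn_gt0.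
rewrite (companion2_comm WC).
have [y <-] := res_surj x; have [w0 <-] := res_surj (W 0 0).
have [w1 <-] := res_surj (W 1 0).
exists (blk3 y (w0%:M + w1 *: companion c)).
  rewrite /= !blk3_mul blk3B; apply/dvmx_blk3; split.
    by rewrite mulrC subrr; apply: dv0.
  rewrite -scalemxAl -scalemxAr mulmxDl mulmxDr -scalemxAl -scalemxAr scalar_mxC.
  by rewrite subrr; apply: dvmx0.
by rewrite map_blk3 map_mxD map_mxZ map_scalar_mx map_companion.
Qed.

(** The elimination is that of [simmod_E_same_d]: q, v, w, z are determined by the other entries,
    and modulo pi they are 0, 0, 0, t. *)
Lemma lifted_shadow_E n x a b c d : (0 < n)%N ->
  dv 1 x -> dv 1 a -> dv 1 b -> dv 1 c ->
  lifted_shadow n (Ex x a b c d) =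
  [set Y | exists p r s t u, [/\ dv n (r * a - x * s),
     dv n (p * x + r * b - x * t), dv n (t * a - a * p - b * s) &
     Y = m3 (res p) 0 (res r) (res s) (res t) (res u) 0 0 (res t)]].
Proof.
move=> n0 dx da db dc.
have res0 y : dv 1 y -> res y = 0 by move/res_eq0.
apply/seteqP; split=> [_ [X /= dX <-]|_ [p [r [s [t [u [h1 h2 h3 ->]]]]]]].
  rewrite (m3_eta X) in dX *.
  move: (X 0 0) (X 0 1) (X 0 2%:R) (X 1 0) (X 1 1) (X 1 2%:R) (X 2%:R 0)
    (X 2%:R 1) (X 2%:R 2%:R) dX => p q r s t u v w z /E_transP.
  rewrite /E_trans subrr => -[[h11 h12 h13] [[h21 h22 h23] [h31 h32 h33]]].
  exists p, r, s, t, u; split.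
  - by dvcomb (p * 0 + r * a - x * s).
  - by dvcomb (p * x + q * 0 + r * b - x * t).
  - by dvcomb ((v * 0 + z * a - (a * p + b * s + c * v)) +
      (t + u * (c + 0) - z) * a - c * (s * 0 + u * a - v)).
  rewrite map_m3 (res0 q) ?(res0 v) ?(res0 w) ?(res_eq (x := z) (y := t)) //.
  - by have {}h23 := dvW n0 h23; dvcomb (u * c - (t + u * (c + 0) - z)).
  - by have {}h22 := dvW n0 h22; dvcomb (s * x + u * b - (s * x + t * 0 + u * b - w)).
  - by have {}h21 := dvW n0 h21; dvcomb (u * a - (s * 0 + u * a - v)).
  - by have {}h13 := dvW n0 h13; dvcomb (q + r * (c + 0) - x * u - r * c + x * u).
pose q := x * u - r * c; pose v := u * a; pose w := s * x + u * b; pose z := t + u * c.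
exists (m3 p q r s t u v w z); last first.
  rewrite map_m3 (res0 q) ?(res0 v) ?(res0 w) ?(res_eq (x := z) (y := t)) //.
  - by rewrite /z; dvcomb (u * c).
  - by rewrite /w; auto with dv.
  - by rewrite /v; auto with dv.
  - by rewrite /q; auto with dv.
have z0 y : y = 0 -> dv n y by move->; apply: dv0.
apply/E_transP; rewrite /E_trans subrr /q /v /w /z; do !split.
- by dvcomb (r * a - x * s).
- by dvcomb (p * x + r * b - x * t).
- by apply: z0; ring.
- by apply: z0; ring.
- by apply: z0; ring.
- by apply: z0; ring.
- by dvcomb (t * a - a * p - b * s).
- by dvcomb (c * (r * a - x * s)).
- by dvcomb (- (r * a - x * s)).
Qed.

Lemma lifted_shadow_I n c d : (0 < n)%N -> dv 1 c ->
  lifted_shadow n (Ex (pi ^+ n) 0 0 c d) =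
  [set Y | exists p r s t u, Y = m3 p 0 r s t u 0 0 t].
Proof.
move=> n0 dc; have dx := dvXle pi n0; have d0 := dv0 pi 1; rewrite lifted_shadow_E //.
apply/seteqP; split=> [Y [p [r [s [t [u [_ _ _ ->]]]]]]|_ [p [r [s [t [u ->]]]]]].
  by exists (res p), (res r), (res s), (res t), (res u).
have [p' <-] := res_surj p; have [r' <-] := res_surj r.
have [s' <-] := res_surj s; have [t' <-] := res_surj t.
have [u' <-] := res_surj u; exists p', r', s', t', u'; split=> //.
- by dvcomb (- (pi ^+ n * s')).
- by dvcomb (p' * pi ^+ n - pi ^+ n * t').
- by dvcomb (0 : O).
Qed.

(** Divided by pi^mu, the first two congruences say s = al r and t = p + be r modulo pi^(n-mu); the
    third follows when these hold exactly. *)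
Lemma lifted_shadow_finite n mu al be c d : (0 < mu < n)%N -> dv 1 c ->
  lifted_shadow n (Ex (pi ^+ mu) (pi ^+ mu * al) (pi ^+ mu * be) c d) =
  E_shadow (res al) (res be).
Proof.
move=> /andP[mu0 lt_mun] dc; have n0 := ltn_trans mu0 lt_mun.
have dx := dvXle pi mu0; rewrite lifted_shadow_E // /E_shadow; try exact: dvMr.
have canc y : dv n (pi ^+ mu * y) -> dv 1 y.
  by move/(dv_canc hO (ltnW lt_mun)); apply: dvW; rewrite subn_gt0.
apply/seteqP; split=> [Y [p [r [s [t [u [h1 h2 _ ->]]]]]]|_ [p [r [u ->]]]].
  exists (res p), (res r), (res u); rewrite -!rmorphM -rmorphD.
  rewrite (res_eq (x := s) (y := al * r)).
    rewrite (res_eq (x := t) (y := p + be * r)) //.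
    by apply: canc; apply: dv_eq (dvN h2); ring.
  by apply: canc; apply: dv_eq (dvN h1); ring.
have [p' <-] := res_surj p; have [r' <-] := res_surj r.
have [u' <-] := res_surj u; exists p', r', (al * r'), (p' + be * r'), u'.
have z0 y : y = 0 -> dv n y by move->; apply: dv0.
by split; [apply: z0; ring..|rewrite rmorphD !rmorphM].
Qed.

(** Here pi^(mu+1) divides x and b but not a. The first congruence gives r = 0 and the third t = p
    modulo pi, while s is arbitrary: division by the unit al completes any s to a solution. *)
Lemma lifted_shadow_infinite n mu m al be c d : (0 < mu < n)%N ->
  (mu < m <= n)%N -> al \is a GRing.unit -> dv 1 c ->
  lifted_shadow n (Ex (pi ^+ m) (pi ^+ mu * al) (pi ^+ mu.+1 * be) c d) =
  [set Y | exists p s u, Y = m3 p 0 0 s p u 0 0 p].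
Proof.
move=> /andP[mu0 lt_mun] /andP[lt_mum le_mn] ual dc.
have n0 := ltn_trans mu0 lt_mun; have m0 := ltn_trans mu0 lt_mum.
rewrite lifted_shadow_E //; try by [apply/dvXle|apply/dvMr/dvXle].
have canc y : dv n (pi ^+ mu * y) -> dv 1 y.
  by move/(dv_canc hO (ltnW lt_mun)); apply: dvW; rewrite subn_gt0.
have mE : pi ^+ m = pi ^+ mu * (pi ^+ (m - mu.+1) * pi).
  by rewrite -exprSr -exprD; congr (_ ^+ _); lia.
have dpi : dv 1 pi by exists 1; rewrite mulr1.
apply/seteqP; split=> [Y [p [r [s [t [u [h1 _ h3 ->]]]]]]|_ [p [s [u ->]]]].
  exists (res p), (res s), (res u).
  have dr : dv 1 r.
    apply: (dv_unitl ual).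
    have : dv 1 (al * r - (pi ^+ (m - mu.+1) * pi) * s).
      by apply: canc; apply: dv_eq h1; rewrite mE; ring.
    by move=> k1; dvcomb (al * r - pi ^+ (m - mu.+1) * pi * s + pi ^+ (m - mu.+1) * pi * s).
  have dt : dv 1 (t - p).
    apply: (dv_unitl ual).
    have : dv 1 (al * (t - p) - pi * be * s).
      by apply: canc; apply: dv_eq h3; rewrite exprSr; ring.
    by move=> k1; dvcomb (al * (t - p) - pi * be * s + pi * be * s).
  by have /res_eq0 -> := dr; rewrite (res_eq dt).
have [p' <-] := res_surj p; have [s' <-] := res_surj s.
have [u' <-] := res_surj u.
pose r' := pi ^+ (m - mu.+1) * pi * s' / al; pose t' := p' + pi * be * s' / al.
have alr : al * r' = pi ^+ (m - mu.+1) * pi * s' by rewrite mulrC divrK.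
have alt : al * (t' - p') = pi * be * s' by rewrite addrC addKr mulrC divrK.
exists p', r', s', t', u'.
have z0 y : y = 0 -> dv n y by move->; apply: dv0.
have r0 : res r' = 0 by apply/res_eq0; rewrite /r'; auto with dv.
have t0 : res t' = res p'.
  by apply: res_eq; rewrite /t' addrC addKr; auto with dv.
split; last by rewrite r0 t0.
- apply: z0; transitivity (pi ^+ mu * (al * r') - pi ^+ m * s'); first by ring.
  by rewrite alr mE; ring.
(* After multiplication by al the terms r and t - p can be expressed by s through the other two
   equations. *)
- apply: z0; apply: (mulfI (x := al)); first by apply: contraTneq ual => ->; rewrite unitr0.
  transitivity (pi ^+ mu.+1 * be * (al * r') - pi ^+ m * (al * (t' - p'))); first by ring.
  by rewrite alr alt mE exprSr; ring.
- apply: z0; transitivity (pi ^+ mu * (al * (t' - p')) - pi ^+ mu.+1 * be * s').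
    by ring.
  by rewrite alt exprSr; ring.
Qed.

End LiftedShadows.

(** * Passage to the quotients of O *)

Section Reductions.
Variables (O : idomainType) (pi : O).
Hypothesis hO : compact_dvr pi.
Variables (o : nat -> comPzRingType) (rho : forall nu, {rmorphism O -> o nu}).
Hypothesis hrho : forall nu, is_reduction pi nu (rho nu).
Variable sigma : forall nu, o nu -> O.
Hypothesis hsigma : is_representatives pi rho sigma.
Local Notation dv := (dv pi).
Local Notation dvmx := (dvmx pi).
Local Notation simmod := (simmod pi).

Lemma rho_eq n x y : rho n x = rho n y <-> dv n (x - y).
Proof.
have [_ /(_ (x - y)) [h1 h2]] := hrho n; split=> [E|/h2].
  by apply: h1; rewrite rmorphB E subrr.
by rewrite rmorphB => /eqP; rewrite subr_eq0 => /eqP.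
Qed.

Lemma rho_surj n y : exists x, rho n x = y.
Proof. by have [+ _] := hrho n; apply. Qed.

Lemma rho_sigma n b : rho n (sigma b) = b. Proof. by case: hsigma. Qed.

Lemma rho_mx_eq p q n (A B : 'M[O]_(p, q)) :
  map_mx (rho n) A = map_mx (rho n) B <-> dvmx n (A - B).
Proof.
split=> [/matrixP E i j|E]; first by rewrite !mxE; apply/rho_eq; move: (E i j); rewrite !mxE.
by apply/matrixP => i j; rewrite !mxE; apply/rho_eq; move: (E i j); rewrite !mxE.
Qed.

Lemma rho_mx_sigma p q n (A : 'M[o n]_(p, q)) :
  map_mx (rho n) (map_mx (@sigma n) A) = A.
Proof. by apply/matrixP => i j; rewrite !mxE rho_sigma. Qed.

Definition representative i (x : O) : Prop := exists b : o i, x = sigma b.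

Lemma representative_ex i x : exists2 y, representative i y & dv i (x - y).
Proof.
by exists (sigma (rho i x)); [exists (rho i x)|apply/rho_eq; rewrite rho_sigma].
Qed.

Lemma representative_inj i x y :
  representative i x -> representative i y -> dv i (x - y) -> x = y.
Proof. by move=> [b ->] [b' ->] /rho_eq; rewrite !rho_sigma => ->. Qed.

Lemma representative_zero i x : representative i x -> dv i x -> x = pi ^+ i.
Proof.
move=> [b ->]; rewrite -[X in dv i X]subr0 => /rho_eq; rewrite rho_sigma rmorph0 => ->.
by case: hsigma.
Qed.

Lemma in_sigmaP i m (a : o m) : in_sigma rho sigma i a <->
  exists2 x, representative i x & a = rho m x.
Proof.
split=> [[b ->]|[_ [b ->] ->]]; last by exists b.
by exists (sigma b) => //; exists b.
Qed.

(** The valuation on [o n] is capped at n, whence m <= n. A representative is never 0, because 0 is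
    represented by pi^n; at 0 [valuation] would return its default 0. *)
Lemma val_red_ge m n x : (m <= n)%N ->
  (m <= val_red pi sigma (rho n x))%N <-> dv m x.
Proof.
move=> le_mn; have dx : dv m (sigma (rho n x) - x).
  by apply: dvW le_mn _; apply/rho_eq; rewrite rho_sigma.
have nz : sigma (rho n x) != 0.
  apply/eqP => s0; have := rho_sigma (rho n x); rewrite s0 rmorph0 => E.
  move: s0; rewrite -E; case: hsigma => _ ->; apply/eqP; exact: piX_neq0.
rewrite /val_red; split=> [/(dv_valuation hO m nz)|dmx].
  exact: dv_transr.
by apply/(dv_valuation hO m nz); apply: dv_trans dx dmx.
Qed.

Lemma val_red_eq m n x : (m < n)%N ->
  m = val_red pi sigma (rho n x) <-> dv m x /\ ~ dv m.+1 x.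
Proof.
move=> lt_mn; have Hm := val_red_ge x (ltnW lt_mn).
have HS := val_red_ge x lt_mn; split=> [E|[/Hm le_m nS]].
  by split; [apply/Hm; rewrite -E|move/HS; rewrite -E ltnn].
apply/eqP; rewrite eqn_leq le_m leqNgt; apply/negP => /HS; exact: nS.
Qed.

Lemma unit_redP n x : (0 < n)%N -> unit_red (rho n x) <-> x \is a GRing.unit.
Proof.
move=> n0; split=> [[b]|ux]; last first.
  by exists (rho n x^-1); rewrite -rmorphM divrr // rmorph1.
have [y <-] := rho_surj b; rewrite -rmorphM -(rmorph1 (rho n)) => /rho_eq dxy.
have : x * y \is a GRing.unit.
  by apply: (unit_cong hO _ (unitr1 O)); apply: dv_subC; apply: dvW n0 dxy.
by rewrite unitrM => /andP[].
Qed.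

(** Modulo pi^l, pi^i x depends only on x modulo pi^(l-i), so the chosen representatives may be
    replaced by any lift. *)
Lemma pimulE l i A : (i <= l)%N ->
  pimul pi rho sigma (map_mx (rho (l - i)) A) = map_mx (rho l) (pi ^+ i *: A).
Proof.
move=> le_il; apply/matrixP => p q; rewrite !mxE; apply/rho_eq.
rewrite -mulrBr; have := dvM (dvX pi i) (_ : dv (l - i) (sigma (rho (l - i) (A p q)) - A p q)).
by rewrite subnKC //; apply; apply/rho_eq; rewrite rho_sigma.
Qed.

Lemma lower_blockE n (C : 'M[o n]_2) : lower_block C = blk3 0 C.
Proof.
have e0 : (0 : 'I_3) = lshift 2 (0 : 'I_1) by apply: val_inj.
have e1 : (1 : 'I_3) = rshift 1 (0 : 'I_2) by apply: val_inj.
have e2 : (2%:R : 'I_3) = rshift 1 (1 : 'I_2) by apply: val_inj.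
rewrite /lower_block; apply: mx3P; rewrite [RHS]mxE /= ?e0 ?e2 ?e1.
all: first [rewrite (@block_mxEul _ 1 2 1 2) | rewrite (@block_mxEur _ 1 2 1 2)
  | rewrite (@block_mxEdl _ 1 2 1 2) | rewrite (@block_mxEdr _ 1 2 1 2)].
all: by rewrite ?mxE.
Qed.

Lemma map_diag3 (R S : pzRingType) (f : {rmorphism R -> S}) a :
  map_mx f (diag3 a 0 0) = diag3 (f a) 0 0.
Proof. by rewrite !diag3_m3 map_m3 !rmorph0. Qed.

Lemma EmxE n m a b c d :
  Emx pi rho m (rho n a) (rho n b) (rho n c) (rho n d) =
  map_mx (rho n) (Ex (pi ^+ m) a b c d).
Proof. by rewrite map_m3 !rmorph0 rmorph1 rmorphD. Qed.

Lemma companion_lift n N (C : 'M[o n]_N) : is_companion C ->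
  exists2 c : 'I_N -> O, is_companion (companion c) & C = map_mx (rho n) (companion c).
Proof.
move=> [c ->]; exists (@sigma n \o c); first by eexists.
rewrite map_companion; congr companion; apply/funext => i /=.
by rewrite rho_sigma.
Qed.

Lemma companion_rho n N (C : 'M[O]_N) : is_companion C ->
  is_companion (map_mx (rho n) C).
Proof. by move=> [c ->]; rewrite map_companion; eexists. Qed.

Lemma E_formP n E t : (0 < n)%N -> E_form pi rho sigma E t <->
  exists2 F, lifted_E_form pi representative n F t & E = map_mx (rho n) F.
Proof.
move=> n0; have lt_v m x : (m < n)%N -> (m < val_red pi sigma (rho n x))%N <-> dv m.+1 x.
  exact: val_red_ge.
split.
- case=> [c d|mu a b c d|mu a b c d|mu a b c d|m mu a b c d].
  + have [c' <-] := rho_surj c; have [d' <-] := rho_surj d => /(lt_v _ _ n0) dc.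
    exists (Ex (pi ^+ n) 0 0 c' d'); first exact: Lift_I.
    by rewrite -EmxE rmorph0.
  + have [a' <-] := rho_surj a; have [b' <-] := rho_surj b.
    have [c' <-] := rho_surj c => Hmu; have lt_mun : (mu < n)%N by lia.
    move=> Eb; rewrite -{1}Eb => /(val_red_ge _ (ltnW lt_mun)) da.
    move: Eb => /(val_red_eq _ lt_mun)[db ndb] /(lt_v _ _ n0) dc.
    move=> /in_sigmaP[d' rd ->].
    exists (Ex (pi ^+ mu) a' b' c' d'); first exact: Lift_II.
    by rewrite -EmxE.
  + have [a' <-] := rho_surj a; have [b' <-] := rho_surj b.
    have [c' <-] := rho_surj c => Hmu; have lt_mun : (mu < n)%N by lia.
    move=> Ea; rewrite -{1}Ea => /(lt_v _ _ lt_mun) db.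
    move: Ea => /(val_red_eq _ lt_mun)[da nda] /(lt_v _ _ n0) dc.
    move=> /in_sigmaP[d' rd ->].
    exists (Ex (pi ^+ mu) a' b' c' d'); first exact: Lift_III1.
    by rewrite -EmxE.
  + have [a' <-] := rho_surj a; have [b' <-] := rho_surj b.
    have [c' <-] := rho_surj c => Hmu; have lt_mun : (mu < n)%N by lia.
    move=> /(lt_v _ _ lt_mun) da /(lt_v _ _ lt_mun) db /(lt_v _ _ n0) dc.
    move=> /in_sigmaP[d' rd ->].
    exists (Ex (pi ^+ mu) a' b' c' d'); first exact: Lift_III0.
    by rewrite -EmxE.
  + have [b' <-] := rho_surj b; have [c' <-] := rho_surj c => Hmu Hm.
    have lt_mun : (mu < n)%N by lia.
    move=> /in_sigmaP[a' ra ->] Ea; rewrite -{1}Ea => /(lt_v _ _ lt_mun) db.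
    move: Ea => /(val_red_eq _ lt_mun)[da nda] /(lt_v _ _ n0) dc.
    move=> /in_sigmaP[d' rd ->].
    exists (Ex (pi ^+ m) a' b' c' d'); first exact: (Lift_IIIoo Hmu Hm ra).
    by rewrite -EmxE.
move=> [F [c d dc|mu a b c d Hmu da db ndb dc rd|mu a b c d Hmu da nda db dc rd|
  mu a b c d Hmu da db dc rd|m mu a b c d Hmu Hm ra da nda db dc rd] ->];
  rewrite -EmxE.
- by rewrite rmorph0; apply: E_I; apply/(lt_v _ _ n0).
- have lt_mun : (mu < n)%N by lia.
  have Eb : mu = val_red pi sigma (rho n b) by apply/(val_red_eq _ lt_mun).
  apply: (E_II (mu := mu)) => //; [|exact/(lt_v _ _ n0)|by apply/in_sigmaP; exists d].
  by rewrite -Eb; apply/(val_red_ge _ (ltnW lt_mun)).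
- have lt_mun : (mu < n)%N by lia.
  have Ea : mu = val_red pi sigma (rho n a) by apply/(val_red_eq _ lt_mun).
  apply: (E_III1 (mu := mu)) => //; [|exact/(lt_v _ _ n0)|by apply/in_sigmaP; exists d].
  by rewrite -Ea; apply/(lt_v _ _ lt_mun).
- have lt_mun : (mu < n)%N by lia.
  apply: (E_III0 (mu := mu)) => //; [exact/(lt_v _ _ lt_mun)|exact/(lt_v _ _ lt_mun)|
    exact/(lt_v _ _ n0)|by apply/in_sigmaP; exists d].
- have lt_mun : (mu < n)%N by lia.
  have Ea : mu = val_red pi sigma (rho n a) by apply/(val_red_eq _ lt_mun).
  apply: (E_IIIoo (mu := mu)) => //; [by apply/in_sigmaP; exists a| |
    exact/(lt_v _ _ n0)|by apply/in_sigmaP; exists d].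
  by rewrite -Ea; apply/(lt_v _ _ lt_mun).
Qed.

Variable tau2 : forall nu, 'M[o nu]_2 -> shadow_type.
Variable tau3 : forall nu, 'M[o nu]_3 -> shadow_type.

Lemma listedP l M t : listed pi rho sigma tau2 tau3 M t <->
  exists2 B, lifted_form pi representative
      (fun n C => tau2 (map_mx (rho n) C)) (fun n C => tau3 (map_mx (rho n) C))
      l B t &
    M = map_mx (rho l) B.
Proof.
have diagE i a : (i < l)%N -> pimul pi rho sigma (diag3 (rho (l - i) a) 0 0) =
    map_mx (rho l) (pi ^+ i *: diag3 a 0 0).
  by move=> lt_il; rewrite -map_diag3 pimulE // ltnW.
have blockE j (C : 'M[O]_2) : (j < l)%N ->
    pimul pi rho sigma (lower_block (map_mx (rho (l - j)) C)) =
    map_mx (rho l) (pi ^+ j *: blk3 0 C).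
  move=> lt_jl; rewrite lower_blockE -(rmorph0 (rho (l - j))) -map_blk3.
  by rewrite pimulE // ltnW.
split.
- case=> [d|i d a|i j d a C|i d C|i d E {}t].
  + have [d' <-] := rho_surj d; exists d'%:M; first exact: Lift_i.
    by rewrite map_scalar_mx.
  + have [d' <-] := rho_surj d; have [a' <-] := rho_surj a => lt_il ua.
    exists (d'%:M + pi ^+ i *: diag3 a' 0 0).
      by apply: Lift_ii => //; apply/(unit_redP a' (_ : 0 < l - i)%N); rewrite ?subn_gt0.
    by rewrite map_mxD map_scalar_mx diagE.
  + have [a' <-] := rho_surj a => Hij /in_sigmaP[d' rd ->] ua.
    have [lt_ij lt_jl] := andP Hij; have lt_il := ltn_trans lt_ij lt_jl.
    move=> /companion_lift[c cC ->].
    exists (d'%:M + pi ^+ i *: diag3 a' 0 0 + pi ^+ j *: blk3 0 (companion c)).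
      apply: Lift_iii => //.
      by apply/(unit_redP a' (_ : 0 < l - i)%N); rewrite ?subn_gt0.
    by rewrite !map_mxD map_scalar_mx diagE // blockE.
  + move=> lt_il /in_sigmaP[d' rd ->] /companion_lift[c cC ->].
    exists (d'%:M + pi ^+ i *: companion c); first exact: Lift_iv.
    by rewrite map_mxD map_scalar_mx pimulE // ltnW.
  + move=> lt_il /in_sigmaP[d' rd ->].
    have n0 : (0 < l - i)%N by rewrite subn_gt0.
    move=> /(E_formP _ _ n0)[F fF ->]; exists (d'%:M + pi ^+ i *: F).
      exact: Lift_v.
    by rewrite map_mxD map_scalar_mx pimulE // ltnW.
move=> [B [d|i d a lt_il ua|i j d a C Hij rd ua cC|i d C lt_il rd cC|
  i d E {}t lt_il rd fE] ->].
- by rewrite map_scalar_mx; apply: form_i.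
- rewrite map_mxD map_scalar_mx -diagE //; apply: form_ii => //.
  by apply/unit_redP => //; rewrite subn_gt0.
- have [lt_ij lt_jl] := andP Hij; have lt_il := ltn_trans lt_ij lt_jl.
  rewrite !map_mxD map_scalar_mx -diagE // -blockE //; apply: form_iii => //.
  + by apply/in_sigmaP; exists d.
  + by apply/unit_redP => //; rewrite subn_gt0.
  + exact: companion_rho.
- rewrite map_mxD map_scalar_mx -pimulE ?(ltnW lt_il) //; apply: form_iv => //.
  + by apply/in_sigmaP; exists d.
  + exact: companion_rho.
rewrite map_mxD map_scalar_mx -pimulE ?(ltnW lt_il) //; apply: form_v => //.
- by apply/in_sigmaP; exists d.
- by apply/E_formP; [rewrite subn_gt0|exists E].
Qed.

End Reductions.

(** * Assembly: types of companion matrices and the shadow of a class *)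

Section Classification.
Variables (O : idomainType) (pi : O).
Hypothesis hO : compact_dvr pi.
Variables (k : finFieldType) (res : {rmorphism O -> k}).
Hypothesis hres : is_reduction pi 1 res.
Variables (o : nat -> comPzRingType) (rho : forall nu, {rmorphism O -> o nu}).
Hypothesis hrho : forall nu, is_reduction pi nu (rho nu).
Variable sigma : forall nu, o nu -> O.
Hypothesis hsigma : is_representatives pi rho sigma.
Local Notation simmod := (simmod pi).
Local Notation dvmx := (dvmx pi).

(** The type must be a function of C over [o nu], not of a lift. For nu > 0 two lifts agree modulo
    pi, so the type found for one serves all of them. *)
Lemma companion_type_ex N (good : shadow_type -> Prop)
    (F : 'M[k]_N -> set 'M[k]_3) (t0 : shadow_type) :
  good t0 -> (forall c : 'I_N -> k, exists t, good t /\ of_type t (F (companion c))) ->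
  exists tau : forall nu, 'M[o nu]_N -> shadow_type,
    (forall nu C, good (tau nu C)) /\
    forall nu (c : 'I_N -> O), (0 < nu)%N ->
      of_type (tau nu (map_mx (rho nu) (companion c))) (F (companion (res \o c))).
Proof.
move=> good0 goodF.
have H (x : {nu & 'M[o nu]_N}) : exists t, good t /\
    forall c : 'I_N -> O, (0 < projT1 x)%N ->
    projT2 x = map_mx (rho (projT1 x)) (companion c) ->
    of_type t (F (companion (res \o c))).
  case: x => nu C /=.
  have [[c [nu0 CE]]|nc] := pselect (exists c : 'I_N -> O, (0 < nu)%N /\
      C = map_mx (rho nu) (companion c)); last first.
    (* Matrices that are not companion, and all matrices for nu = 0, receive the default type. *)
    by exists t0; split=> // c nu0 CE; case: nc; exists c.
  have [t [gt tF]] := goodF (res \o c); exists t; split=> // c' _.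
  rewrite CE => /(rho_mx_eq hrho)/(dvmxW nu0)/(resm_eq hres).
  by rewrite !map_companion => <-.
have [f fP] := choice H.
exists (fun nu C => f (existT _ nu C)); split=> [nu C|nu c nu0].
  by have [] := fP (existT _ nu C).
by have [_ /(_ c nu0)] := fP (existT _ nu (map_mx (rho nu) (companion c))); apply.
Qed.

Lemma similarity_classP l cls : similarity_class rho cls ->
  exists A0 : 'M[O]_3, forall B, cls (map_mx (rho l) B) <-> simmod l A0 B.
Proof.
move=> [A ->]; exists (map_mx (@sigma l) A) => B.
have AE := rho_mx_sigma hsigma A; set A0 := map_mx _ A in AE *.
split=> [[g /= ug]|/simmod_conj[g ug dg]].
  rewrite -{1}AE -!map_mxM => /(rho_mx_eq hrho) dg.
  apply: simmod_trans _ (simmod_cong dg); apply: (simmod_eq _ _ ug).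
  by rewrite mulmxKV.
by exists g => //; rewrite -{1}AE -!map_mxM; apply/(rho_mx_eq hrho).
Qed.

Lemma sh_glE l (B : 'M[O]_3) :
  sh_gl rho res (map_mx (rho l) B) = lifted_shadow pi res l B.
Proof.
have E X : centraliser_gl rho (map_mx (rho l) B) X <-> dvmx l (X *m B - B *m X).
  by rewrite /centraliser_gl /= -!map_mxM; apply: rho_mx_eq.
by apply/seteqP; split=> Y [X /E]; exists X.
Qed.

Variable rep : nat -> O -> Prop.
Variable T2 : nat -> 'M[O]_2 -> shadow_type.
Variable T3 : nat -> 'M[O]_3 -> shadow_type.
Hypothesis T2P : forall n (c : 'I_2 -> O), (0 < n)%N ->
  of_type (T2 n (companion c)) (block_centraliser (companion (res \o c))).
Hypothesis T3P : forall n (c : 'I_3 -> O), (0 < n)%N ->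
  of_type (T3 n (companion c)) (mx_centraliser (companion (res \o c))).

Lemma lifted_E_form_of_type n F t : (0 < n)%N -> lifted_E_form pi rep n F t ->
  of_type t (lifted_shadow pi res n F).
Proof.
move=> n0.
have nres x : ~ dv pi 1 x -> res x != 0.
  by move=> nx; apply/eqP => /(res_eq0 hres).
have nS mu x : ~ dv pi mu.+1 (pi ^+ mu * x) -> ~ dv pi 1 x.
  by move=> nd dx; apply: nd; rewrite -(addn1 mu); apply: dv_scale.
have resS x : res (pi * x) = 0 by apply/(res_eq0 hres); exists x; rewrite expr1.
case=> [c d dc|mu a b c d Hmu [al ->] [be ->] /nS/nres ndb dc rd|
  mu a b c d Hmu [al ->] /nS/nres nda [be ->] dc rd|
  mu a b c d Hmu [al ->] [be ->] dc rd|
  m mu a b c d Hmu Hm ra da nda [be ->] dc rd].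
- by rewrite (lifted_shadow_I hres) //; apply: jordan_of_type.
- by rewrite (lifted_shadow_finite hO hres) //; apply: E_shadow_M.
- rewrite exprSr -[_ * pi * be]mulrA (lifted_shadow_finite hO hres) // resS.
  exact: E_shadow_N.
- rewrite exprSr -!(mulrA _ pi) (lifted_shadow_finite hO hres) // !resS.
  exact: E_shadow_K0.
have [al ual ->] := exact_dv hO da nda.
by rewrite (lifted_shadow_infinite hO hres) //; apply: Koo_of_type.
Qed.

Lemma lifted_form_of_type l B t : lifted_form pi rep T2 T3 l B t ->
  of_type t (lifted_shadow pi res l B).
Proof.
case=> [d|i d a lt_il ua|i j d a C Hij rd ua [c ->]|i d C lt_il rd [c ->]|
  i d E {}t lt_il rd fE].
- by rewrite (lifted_shadow_scalar hres); apply: full_of_type.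
- rewrite (lifted_shadow_affine hO) ?(ltnW lt_il) //.
  by rewrite (lifted_shadow_ii hres) ?subn_gt0 //; apply: block_of_type.
- have [lt_ij lt_jl] := andP Hij; have lt_il := ltn_trans lt_ij lt_jl.
  rewrite form_iii_affine ?(ltnW lt_ij) // (lifted_shadow_affine hO) ?(ltnW lt_il) //.
  by rewrite (lifted_shadow_iii hO hres) //; [apply: T2P; lia | lia].
- rewrite (lifted_shadow_affine hO) ?(ltnW lt_il) //.
  by rewrite (lifted_shadow_companion hres) ?subn_gt0 //; apply: T3P; rewrite subn_gt0.
rewrite (lifted_shadow_affine hO) ?(ltnW lt_il) //.
by apply: lifted_E_form_of_type fE; rewrite subn_gt0.
Qed.

End Classification.

Theorem theorem2p11 (O : idomainType) (pi : O) (hO : compact_dvr pi)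
    (k : finFieldType) (res : {rmorphism O -> k})
    (hres : is_reduction pi 1 res)
    (o : nat -> comPzRingType) (rho : forall nu, {rmorphism O -> o nu})
    (hrho : forall nu, is_reduction pi nu (rho nu))
    (sigma : forall nu, o nu -> O) (hsigma : is_representatives pi rho sigma)
    (l : nat) (hl : (0 < l)%N) :
  exists (tau2 : forall nu, 'M[o nu]_2 -> shadow_type)
         (tau3 : forall nu, 'M[o nu]_3 -> shadow_type),
    (forall nu (C : 'M[o nu]_2), is_companion C ->
       [\/ tau2 nu C = tT1, tau2 nu C = tT2 | tau2 nu C = tM]) /\
    (forall nu (C : 'M[o nu]_3), is_companion C ->
       tau3 nu C = tT1 \/ tau3 nu C = tT2 \/ tau3 nu C = tT3 \/
       tau3 nu C = tM \/ tau3 nu C = tN) /\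
    forall cls : set 'M[o l]_3, similarity_class rho cls ->
      (exists! M : 'M[o l]_3,
         cls M /\ exists t, listed pi rho sigma tau2 tau3 M t) /\
      (forall (M : 'M[o l]_3) (t : shadow_type),
         cls M -> listed pi rho sigma tau2 tau3 M t ->
         has_type (shadow rho res cls) t).
Proof.
have rex := representative_ex hrho hsigma.
have rinj := @representative_inj _ _ _ _ hrho _ hsigma.
have rzero := @representative_zero _ _ _ _ hrho _ hsigma.
have [tau2 [good2 tau2P]] := companion_type_ex hres hrho
  (or_introl (erefl tT1)) (@companion2_of_type k).
have [tau3 [good3 tau3P]] := companion_type_ex hres hrho
  (or_introl (erefl tT1)) (@companion3_of_type k).
exists tau2, tau3; split; last split.
- by move=> nu C _; have [->|[->|->]] := good2 nu C; [apply: Or31|apply: Or32|apply: Or33].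
- by move=> nu C _; apply: good3.
move=> cls hcls; have [A0 clsP] := similarity_classP hrho hsigma hcls.
have listP := listedP hO hrho hsigma tau2 tau3.
split.
  have [B [t [fB sB]]] := lifted_form_exists hO
    (fun n C => tau2 n (map_mx (rho n) C)) (fun n C => tau3 n (map_mx (rho n) C))
    rex rzero A0 hl.
  exists (map_mx (rho l) B); split.
    by split; [apply/clsP|exists t; apply/listP; exists B].
  move=> M' [cM' [t' /listP[B' fB' ME]]]; rewrite {}ME in cM' *.
  move: cM' => /clsP sB'.
  apply/(rho_mx_eq hrho); apply: (form_kind_uniq hO rinj (lifted_form_kind hO fB)
    (lifted_form_kind hO fB')).
  exact: simmod_trans (simmod_sym sB) sB'.
(* The type is computed on the lift B of the listed matrix. Any A' of the class lifts to a matrix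
   similar to B modulo pi^l, whose shadow is a conjugate. *)
move=> M t cM /listP[B fB ME] s [A' cA' <-] /=; rewrite {}ME in cM.
move: cM => /clsP sB.
have A'E := rho_mx_sigma hsigma A'; rewrite -A'E in cA' *.
move: cA' => /clsP sA'; rewrite (sh_glE res hrho).
have [g ug ->] := lifted_shadow_simmod res (simmod_trans (simmod_sym sB) sA').
apply: (of_type_conj ug); apply: (lifted_form_of_type hO hres) fB => n c n0.
  exact: tau2P.
exact: tau3P.
Qed.
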